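(* Let $X$ be an ultrahomogeneous chain (with the discrete topology) and $G=(\mathrm{Aut}(X),\tau_{\partial})$. Then ${\rm WAP}\,G$ is the closure of $G$ in $b_r{\rm U}(\ell^2(X))={\rm WAP}\,{\rm U}(\ell^2(X))$.
   Context: A chain is an infinite linearly ordered set; $X$ is ultrahomogeneous if for every $n$ and all $x_1<\dots<x_n$, $y_1<\dots<y_n$ in $X$ there is an order automorphism $g\in\mathrm{Aut}(X)$ with $g(x_i)=y_i$. $\tau_\partial$ is the topology of pointwise convergence on $\mathrm{Aut}(X)$ for discrete $X$ (permutation topology). $\ell^2(X)$ is the Hilbert space with orthonormal basis $(e_x)_{x\in X}$, and ${\rm U}(\ell^2(X))$ is its unitary group in the strong operator topology. $G$ is topologically embedded in ${\rm U}(\ell^2(X))$ by $g(e_x)=e_{gx}$. $b_r{\rm U}(\ell^2(X))$ is the Roelcke compactification; it is known to be the space of all linear operators on $\ell^2(X)$ of norm $\le1$ in the weak operator topology, and to be the WAP-compactification of ${\rm U}(\ell^2(X))$. The WAP-compactification ${\rm WAP}\,G$ of a topological group $G$ is the maximal semitopological semigroup compactification: a compact Hausdorff semitopological (separately continuous multiplication) monoid $W$ with a continuous homomorphism $w:G\to W$ with dense image through which every continuous homomorphism of $G$ into a compact Hausdorff semitopological semigroup factors. The identification of compactifications is by a homeomorphism commuting with the maps of $G$. *)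

(* Defs.v *)
From HB Require Import structures.
From mathcomp Require Import all_boot all_order all_algebra.
From mathcomp Require Import complex ring lra.
From mathcomp Require Import all_classical all_reals all_analysis.

Set Implicit Arguments.
Unset Strict Implicit.
Unset Printing Implicit Defensive.

Import Order.TTheory GRing.Theory Num.Theory.
Import numFieldNormedType.Exports.

Local Open Scope classical_set_scope.
Local Open Scope ring_scope.

(* As for the library's [PreTopologicalZmodule], continuity of the operations
   is not part of the structure; no definition below depends on it. *)
#[short(type="preTopologicalGroupType")]
HB.structure Definition PreTopologicalGroup :=
  {G of Group G & Topological G}.

Definition compact_hausdorff (K : topologicalType) : Prop :=
  compact [set: K] /\ hausdorff_space K.

Record semitopological_semigroup (S : topologicalType) (mul : S -> S -> S)
    : Prop := SemitopologicalSemigroup {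
  semitop_mulA : associative mul;
  semitop_mul_continuousl : forall a, continuous (mul a);
  semitop_mul_continuousr : forall a, continuous (mul^~ a)
}.

Section compactifications.
Variable G : preTopologicalGroupType.

(* The multiplication of [W] is existentially quantified so that the predicate
   can be applied to a bare compactification; it is determined by [w], whose
   range is dense. *)
Definition is_WAP_compactification (W : topologicalType) (w : G -> W) : Prop :=
  [/\ compact_hausdorff W, continuous w, dense (range w)
    & exists (mul : W -> W -> W) (one : W),
      [/\ semitopological_semigroup mul,
          left_id one mul /\ right_id one mul,
          {morph w : g h / (g * h)%g >-> mul g h} /\ w 1%g = one
        & forall (S : topologicalType) (mulS : S -> S -> S) (phi : G -> S),
            compact_hausdorff S -> semitopological_semigroup mulS ->
            continuous phi ->
            {morph phi : g h / (g * h)%g >-> mulS g h} ->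
            exists psi : W -> S,
              [/\ continuous psi,
                  {morph psi : x y / mul x y >-> mulS x y}
                & psi \o w = phi]]].

Variable R : realType.

(* The sets {(g, a g b) | a, b in V}, V a neighbourhood of 1, form a base of
   the Roelcke uniformity, the infimum of the left and right uniformities. *)
Definition roelcke_uniformly_continuous (f : G -> R) : Prop :=
  forall e : R, 0 < e -> exists2 V : set G, nbhs (1%g : G) V &
    forall g a b, V a -> V b -> `|f (a * g * b)%g - f g| < e.

(* The compactification given by the algebra of bounded Roelcke uniformly
   continuous functions. *)
Definition is_Roelcke_compactification (K : topologicalType) (k : G -> K)
    : Prop :=
  [/\ compact_hausdorff K, continuous k, dense (range k)
    & forall f : G -> R,
        (exists M, forall g, `|f g| <= M) /\ roelcke_uniformly_continuous f <->
        exists2 F : K -> R, continuous F & F \o k = f].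

End compactifications.

Definition to_closure (T : Type) (K : topologicalType) (j : T -> K) (t : T) :
    closure (range j) :=
  exist _ (j t) (mem_set (subset_closure (imageT j t))).

Section order_automorphisms.
Context {d : Order.disp_t}.
Variable X : orderType d.

Record order_aut := OrderAut {
  order_aut_fun :> X -> X;
  order_aut_bij : bijective order_aut_fun;
  order_aut_mono : {mono order_aut_fun : x y / (x <= y)%O} }.

HB.instance Definition _ := gen_eqMixin order_aut.
HB.instance Definition _ := gen_choiceMixin order_aut.

Lemma order_aut_eqP (g h : order_aut) : g =1 h -> g = h.
Proof.
case: g h => [g gb gm] [h hb hm] /= /funext gh; subst h.
by congr OrderAut; exact: Prop_irrelevance.
Qed.

Definition order_aut_one : order_aut :=
  @OrderAut id (Bijective (fun=> erefl) (fun=> erefl)) (fun _ _ => erefl).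

Definition order_aut_mul (g h : order_aut) : order_aut :=
  @OrderAut (g \o h) (bij_comp (order_aut_bij g) (order_aut_bij h))
    (fun x y => etrans (order_aut_mono g _ _) (order_aut_mono h x y)).

Lemma order_aut_exists_inv (g : order_aut) :
  exists h : order_aut, cancel g h /\ cancel h g.
Proof.
case: (order_aut_bij g) => h gh hg.
have hb : bijective h by exists g.
have hm : {mono h : x y / (x <= y)%O}.
  by move=> x y; rewrite -{2}(hg x) -{2}(hg y) order_aut_mono.
by exists (OrderAut hb hm).
Qed.

Definition order_aut_inv (g : order_aut) : order_aut :=
  sval (cid (order_aut_exists_inv g)).

Lemma order_autK (g : order_aut) : cancel g (order_aut_inv g).
Proof. by rewrite /order_aut_inv; case: cid => h /= []. Qed.

Lemma order_autVK (g : order_aut) : cancel (order_aut_inv g) g.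
Proof. by rewrite /order_aut_inv; case: cid => h /= []. Qed.

Let order_aut_mulA : associative order_aut_mul.
Proof. by move=> f g h; exact: order_aut_eqP. Qed.

Let order_aut_mul1g : left_id order_aut_one order_aut_mul.
Proof. by move=> g; exact: order_aut_eqP. Qed.

Let order_aut_mulg1 : right_id order_aut_one order_aut_mul.
Proof. by move=> g; exact: order_aut_eqP. Qed.

Let order_aut_mulVg : left_inverse order_aut_one order_aut_inv order_aut_mul.
Proof. by move=> g; apply: order_aut_eqP => x /=; rewrite order_autK. Qed.

Let order_aut_mulgV : right_inverse order_aut_one order_aut_inv order_aut_mul.
Proof. by move=> g; apply: order_aut_eqP => x /=; rewrite order_autVK. Qed.

HB.instance Definition _ := isGroup.Build order_aut order_aut_mulA
  order_aut_mul1g order_aut_mulg1 order_aut_mulVg order_aut_mulgV.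

(* The permutation topology. *)
HB.instance Definition _ := Topological.copy order_aut
  (initial_topology
     (order_aut_fun : order_aut -> {ptws X -> discrete_topology X})).

Definition ultrahomogeneous : Prop :=
  forall (n : nat) (x y : 'I_n -> X),
    {homo x : i j / (i < j)%N >-> (i < j)%O} ->
    {homo y : i j / (i < j)%N >-> (i < j)%O} ->
    exists g : order_aut, forall i, g (x i) = y i.

End order_automorphisms.

Section sums.
Variables (R : realType) (X : choiceType).

(* The sum of an absolutely summable family of reals; the value is junk
   otherwise. *)
Definition rsum (h : X -> R) : R :=
  fine (\esum_(x in [set: X]) (EFin \o h)^\+%E x)
  - fine (\esum_(x in [set: X]) (EFin \o h)^\-%E x).

Definition csum (h : X -> R[i]) : R[i] :=
  Complex (rsum (fun x => complex.Re (h x))) (rsum (fun x => complex.Im (h x))).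

Definition sqnorm (z : R[i]) : R := complex.Re z ^+ 2 + complex.Im z ^+ 2.

Definition esqnorm (f : X -> R[i]) : \bar R :=
  \esum_(x in [set: X]) (sqnorm (f x))%:E.

Definition square_summable : {pred X -> R[i]} :=
  fun f => (esqnorm f < +oo)%E.

Lemma sqnorm_ge0 (z : R[i]) : 0 <= sqnorm z.
Proof. by rewrite addr_ge0// sqr_ge0. Qed.

Lemma sqnormM (z w : R[i]) : sqnorm (z * w) = sqnorm z * sqnorm w.
Proof. by case: z w => [a b] [c e]; rewrite /sqnorm/=; ring. Qed.

Lemma esqnorm_ge0 (f : X -> R[i]) : (0 <= esqnorm f)%E.
Proof. by apply: esum_ge0 => x _; rewrite lee_fin sqnorm_ge0. Qed.

Lemma esqnorm_fin (f : X -> R[i]) : f \in square_summable ->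
  esqnorm f = (fine (esqnorm f))%:E.
Proof. by move=> fl; rewrite fineK// ge0_fin_numE ?esqnorm_ge0. Qed.

Lemma esumZl_le (k : R) (h : X -> \bar R) : 0 <= k ->
  (forall x, 0 <= h x)%E ->
  (\esum_(x in [set: X]) (k%:E * h x) <= k%:E * \esum_(x in [set: X]) h x)%E.
Proof.
move=> k0 h0; apply: ge_ereal_sup => _ [A [fA _] <-].
rewrite fsbig_finite//= -ge0_sume_distrr//.
rewrite lee_wpmul2l ?lee_fin//; apply: ereal_sup_ubound.
by exists A => //; rewrite fsbig_finite.
Qed.

Lemma esqnormZ (c : R[i]) (f : X -> R[i]) :
  (esqnorm (c *: f) <= (sqnorm c)%:E * esqnorm f)%E.
Proof.
apply: le_trans (esumZl_le (sqnorm_ge0 c) _).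
  by apply: le_esum => x _; rewrite -EFinM -sqnormM.
by move=> x; rewrite lee_fin sqnorm_ge0.
Qed.

(* A weighted form of the triangle inequality, for 1/p + 1/q = 1. *)
Lemma sqnormD (p q : R) (z w : R[i]) : 0 < p -> 0 < q -> p * q = p + q ->
  sqnorm (z + w) <= p * sqnorm z + q * sqnorm w.
Proof.
move=> p0 q0 pq; case: z w => [a b] [c e]; rewrite /sqnorm/=.
have p1 : 0 < p - 1.
  have : 0 < (p - 1) * q by rewrite mulrBl mul1r pq addrK.
  by rewrite pmulr_lgt0.
have key u v : (u + v) ^+ 2 <= p * u ^+ 2 + q * v ^+ 2.
  have E : (p - 1) * (p * u ^+ 2 + q * v ^+ 2 - (u + v) ^+ 2) =
    ((p - 1) * u - v) ^+ 2 + (p * q - (p + q)) * v ^+ 2 by ring.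
  rewrite -subr_ge0 -(pmulr_rge0 _ p1) E.
  by rewrite pq subrr mul0r addr0 sqr_ge0.
by rewrite !mulrDr addrACA; apply: lerD; exact: key.
Qed.

Lemma esqnormD (p q : R) (f g : X -> R[i]) :
  0 < p -> 0 < q -> p * q = p + q ->
  (esqnorm (f + g)%R <= p%:E * esqnorm f + q%:E * esqnorm g)%E.
Proof.
move=> p0 q0 pq.
apply: le_trans (leeD (esumZl_le (ltW p0) _) (esumZl_le (ltW q0) _)); last 2 first.
- by move=> x; rewrite lee_fin sqnorm_ge0.
- by move=> x; rewrite lee_fin sqnorm_ge0.
rewrite -esumD; first last.
- by move=> x _; rewrite mule_ge0 ?lee_fin ?sqnorm_ge0// ltW.
- by move=> x _; rewrite mule_ge0 ?lee_fin ?sqnorm_ge0// ltW.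
by apply: le_esum => x _; rewrite -!EFinM -EFinD lee_fin; exact: sqnormD.
Qed.

Lemma square_summable_submod : submod_closed square_summable.
Proof.
have addP f g : f \in square_summable -> g \in square_summable ->
    f + g \in square_summable.
  move=> fl gl; rewrite unfold_in.
  have h2 : 0 < 2 :> R by [].
  apply: (le_lt_trans (esqnormD f g h2 h2 _)); first by ring.
  by rewrite (esqnorm_fin fl) (esqnorm_fin gl) -!EFinM -EFinD ltry.
split.
  rewrite unfold_in /esqnorm esum1 ?ltry// => x _.
  by rewrite /sqnorm/= expr0n addr0.
move=> c f g fl gl; apply: addP => //; rewrite unfold_in.
by apply: (le_lt_trans (esqnormZ c f)); rewrite (esqnorm_fin fl) -EFinM ltry.
Qed.

HB.instance Definition _ := GRing.isSubmodClosed.Build R[i] (X -> R[i])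
  square_summable square_summable_submod.

End sums.

Section l2.
Variables (R : realType) (X : choiceType).

Record l2 := L2 { l2_fun :> X -> R[i] ; l2P : l2_fun \in @square_summable R X }.

HB.instance Definition _ := [isSub for l2_fun].
HB.instance Definition _ := [Choice of l2 by <:].
HB.instance Definition _ := [SubChoice_isSubLmodule of l2 by <:].

Definition l2_norm (f : l2) : R := Num.sqrt (fine (esqnorm f)).

Lemma l2_norm_ge0 (f : l2) : 0 <= l2_norm f.
Proof. exact: sqrtr_ge0. Qed.

Lemma l2_normE (f : l2) : esqnorm f = (l2_norm f ^+ 2)%:E.
Proof.
by rewrite sqr_sqrtr ?fine_ge0 ?esqnorm_ge0// -esqnorm_fin//; exact: l2P.
Qed.

Lemma l2_norm_eq0 (f : l2) : l2_norm f = 0 -> f = 0.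
Proof.
move=> f0; apply: val_inj => /=; apply/funext => x.
have : ((sqnorm (f x))%:E <= esqnorm f)%E.
  rewrite -(@esum_set1 R X x (fun y => (sqnorm (f y))%:E)) ?lee_fin ?sqnorm_ge0//.
  apply: ereal_sup_ubound; exists [set x]; first by split.
  by rewrite fsbig_set1 esum_set1// lee_fin sqnorm_ge0.
rewrite l2_normE f0 expr0n/= lee_fin => fx0.
have : sqnorm (f x) == 0 by rewrite eq_le fx0 sqnorm_ge0.
rewrite /sqnorm paddr_eq0 ?sqr_ge0// !sqrf_eq0 => /andP[/eqP r0 /eqP i0].
by apply/eqP; rewrite eq_complex r0 i0 !eqxx.
Qed.

Lemma l2_normZ_le (c : R[i]) (f : l2) :
  l2_norm (c *: f) <= Num.sqrt (sqnorm c) * l2_norm f.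
Proof.
rewrite -(@ler_pXn2r _ 2) ?nnegrE ?l2_norm_ge0 ?mulr_ge0 ?sqrtr_ge0 ?l2_norm_ge0//.
rewrite exprMn (sqr_sqrtr (sqnorm_ge0 c)) -lee_fin -l2_normE EFinM -l2_normE.
exact: esqnormZ.
Qed.

Lemma l2_normD (f g : l2) : l2_norm (f + g) <= l2_norm f + l2_norm g.
Proof.
have [f0|f0] := eqVneq (l2_norm f) 0.
  by rewrite (l2_norm_eq0 f0) add0r lerDr l2_norm_ge0.
have [g0|g0] := eqVneq (l2_norm g) 0.
  by rewrite (l2_norm_eq0 g0) addr0 lerDl l2_norm_ge0.
have fp : 0 < l2_norm f by rewrite lt_def f0 l2_norm_ge0.
have gp : 0 < l2_norm g by rewrite lt_def g0 l2_norm_ge0.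
have sp : 0 < l2_norm f + l2_norm g by exact: addr_gt0.
rewrite -(@ler_pXn2r _ 2) ?nnegrE ?l2_norm_ge0 ?(ltW sp)//.
rewrite -lee_fin -l2_normE.
pose p := (l2_norm f + l2_norm g) / l2_norm f.
pose q := (l2_norm f + l2_norm g) / l2_norm g.
apply: le_trans (@esqnormD R X p q f g _ _ _) _.
- exact: divr_gt0.
- exact: divr_gt0.
- by rewrite /p /q; field; rewrite f0 g0.
rewrite !l2_normE -!EFinM -EFinD lee_fin le_eqVlt; apply/orP; left; apply/eqP.
by rewrite /p /q; field; rewrite f0 g0.
Qed.

Lemma l2_normZ (c : R[i]) (f : l2) :
  l2_norm (c *: f) = Num.sqrt (sqnorm c) * l2_norm f.
Proof.
apply/eqP; rewrite eq_le l2_normZ_le/=.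
have [->|c0] := eqVneq c 0.
  by rewrite /sqnorm/= expr0n/= addr0 sqrtr0 mul0r l2_norm_ge0.
rewrite -[in leLHS](scale1r f) -(mulVf c0) -scalerA.
apply: (le_trans (ler_wpM2l (sqrtr_ge0 _) (l2_normZ_le _ _))).
rewrite mulrA -sqrtrM ?sqnorm_ge0// -sqnormM mulfV//.
by rewrite /sqnorm/= expr1n expr0n/= addr0 sqrtr1 mul1r.
Qed.

Let l2_normC (f : l2) : R[i] := (l2_norm f)%:C%C.

Let l2_normC_D (f g : l2) : l2_normC (f + g) <= l2_normC f + l2_normC g.
Proof. by rewrite -rmorphD lecR l2_normD. Qed.

Let l2_normC_Z (c : R[i]) (f : l2) : l2_normC (c *: f) = `|c| * l2_normC f.
Proof. by rewrite normc_def -rmorphM -l2_normZ. Qed.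

Let l2_normC_eq0 (f : l2) : l2_normC f = 0 -> f = 0.
Proof. by case=> /l2_norm_eq0. Qed.

HB.instance Definition _ :=
  Lmodule_isNormed.Build R[i] l2 l2_normC_D l2_normC_Z l2_normC_eq0.

(* The inner product, linear in the first variable. *)
Definition l2_dot (f g : l2) : R[i] := csum (fun x => f x * conjc (g x)).

Let l2_basis_subproof (x : X) :
  (fun y => (y == x)%:R : R[i]) \in @square_summable R X.
Proof.
rewrite unfold_in /esqnorm (esumID [set x])/=; last first.
  by move=> y _; rewrite lee_fin sqnorm_ge0.
rewrite setTI esum_set1 ?lee_fin ?sqnorm_ge0// esum1 ?adde0 ?ltry//.
by move=> y [_ /eqP/negbTE ->]; rewrite /sqnorm/= expr0n/= addr0.
Qed.

Definition l2_basis (x : X) : l2 := L2 (l2_basis_subproof x).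

Record unitary_op := Unitary {
  unitary_fun :> l2 -> l2;
  unitary_linear : linear unitary_fun;
  unitary_bij : bijective unitary_fun;
  unitary_dot : forall f g, l2_dot (unitary_fun f) (unitary_fun g) = l2_dot f g
}.

HB.instance Definition _ := gen_eqMixin unitary_op.
HB.instance Definition _ := gen_choiceMixin unitary_op.

Lemma unitary_eqP (u v : unitary_op) : u =1 v -> u = v.
Proof.
case: u v => [u ul ub ud] [v vl vb vd] /= /funext uv; subst v.
by congr Unitary; exact: Prop_irrelevance.
Qed.

Definition unitary_one : unitary_op :=
  @Unitary id (fun _ _ _ => erefl) (Bijective (fun=> erefl) (fun=> erefl))
    (fun _ _ => erefl).

Let unitary_mul_linear (u v : unitary_op) : linear (u \o v).
Proof. by move=> c f g /=; rewrite !unitary_linear. Qed.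

Definition unitary_mul (u v : unitary_op) : unitary_op :=
  @Unitary (u \o v) (unitary_mul_linear u v)
    (bij_comp (unitary_bij u) (unitary_bij v))
    (fun f g => etrans (unitary_dot u _ _) (unitary_dot v f g)).

Lemma unitary_exists_inv (u : unitary_op) :
  exists v : unitary_op, cancel u v /\ cancel v u.
Proof.
case: (unitary_bij u) => v uv vu.
have vb : bijective v by exists u.
have vl : linear v.
  by move=> c f g; rewrite -{1}(vu f) -{1}(vu g) -unitary_linear uv.
have vd f g : l2_dot (v f) (v g) = l2_dot f g.
  by rewrite -{2}(vu f) -{2}(vu g) unitary_dot.
by exists (Unitary vl vb vd).
Qed.

Definition unitary_inv (u : unitary_op) : unitary_op :=
  sval (cid (unitary_exists_inv u)).

Lemma unitaryK (u : unitary_op) : cancel u (unitary_inv u).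
Proof. by rewrite /unitary_inv; case: cid => v /= []. Qed.

Lemma unitaryVK (u : unitary_op) : cancel (unitary_inv u) u.
Proof. by rewrite /unitary_inv; case: cid => v /= []. Qed.

Let unitary_mulA : associative unitary_mul.
Proof. by move=> u v w; exact: unitary_eqP. Qed.

Let unitary_mul1g : left_id unitary_one unitary_mul.
Proof. by move=> u; exact: unitary_eqP. Qed.

Let unitary_mulg1 : right_id unitary_one unitary_mul.
Proof. by move=> u; exact: unitary_eqP. Qed.

Let unitary_mulVg : left_inverse unitary_one unitary_inv unitary_mul.
Proof. by move=> u; apply: unitary_eqP => f /=; rewrite unitaryK. Qed.

Let unitary_mulgV : right_inverse unitary_one unitary_inv unitary_mul.
Proof. by move=> u; apply: unitary_eqP => f /=; rewrite unitaryVK. Qed.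

HB.instance Definition _ := isGroup.Build unitary_op unitary_mulA
  unitary_mul1g unitary_mulg1 unitary_mulVg unitary_mulgV.

(* The strong operator topology. *)
HB.instance Definition _ := Topological.copy unitary_op
  (initial_topology (unitary_fun : unitary_op -> {ptws l2 -> l2})).

Record contraction_op := Contraction {
  contraction_fun :> l2 -> l2;
  contraction_linear : linear contraction_fun;
  contraction_norm : forall f, `|contraction_fun f| <= `|f|
}.

HB.instance Definition _ := gen_eqMixin contraction_op.
HB.instance Definition _ := gen_choiceMixin contraction_op.

Definition contraction_coef (T : contraction_op) : l2 * l2 -> R[i] :=
  fun fg => l2_dot (T fg.1) fg.2.

(* The weak operator topology. *)
HB.instance Definition _ := Topological.copy contraction_op
  (initial_topology
     (contraction_coef : contraction_op -> {ptws (l2 * l2)%type -> R[i]^o})).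

Lemma l2_dotff (f : l2) : complex.Re (l2_dot f f) = l2_norm f ^+ 2.
Proof.
have E x : complex.Re (f x * conjc (f x)) = sqnorm (f x).
  by case: (f x) => a b /=; rewrite /sqnorm/=; ring.
rewrite /l2_dot/= /rsum (_ : (fun=> _) = fun x => sqnorm (f x)); last exact/funext.
rewrite [X in _ - fine X]esum1 ?subr0; last first.
  by move=> x _; rewrite funenegE max_r// leeNl oppe0 lee_fin sqnorm_ge0.
rewrite (_ : esum _ _ = esqnorm f); first by rewrite l2_normE.
by apply: eq_esum => x _; rewrite funeposE max_l// lee_fin sqnorm_ge0.
Qed.

Lemma unitary_norm (u : unitary_op) (f : l2) : l2_norm (u f) = l2_norm f.
Proof.
apply/eqP; rewrite -(@eqrXn2 _ 2) ?l2_norm_ge0//.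
by rewrite -!l2_dotff unitary_dot.
Qed.

Let unitary_contraction_norm (u : unitary_op) (f : l2) : `|u f| <= `|f|.
Proof. by rewrite lecR unitary_norm. Qed.

Definition contraction_of_unitary (u : unitary_op) : contraction_op :=
  Contraction (@unitary_linear u) (unitary_contraction_norm u).

End l2.

Section permutation_operators.
Context {d : Order.disp_t}.
Variables (R : realType) (X : orderType d).
Implicit Types (g : order_aut X) (f : l2 R X).

Let order_aut_inv_bij g : set_bij [set: X] [set: X] (g^-1)%g.
Proof. by rewrite setTT_bijective; exact: order_aut_bij. Qed.

Let esum_order_aut g (a : X -> \bar R) :
  \esum_(x in [set: X]) a ((g^-1)%g x) = \esum_(x in [set: X]) a x.
Proof. by rewrite [RHS](reindex_esum _ _ _ _ (order_aut_inv_bij g)). Qed.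

Let perm_op_subproof g f : (fun x => f ((g^-1)%g x)) \in @square_summable R X.
Proof.
rewrite unfold_in /esqnorm.
by rewrite (esum_order_aut g (fun x => (sqnorm (f x))%:E)); exact: l2P.
Qed.

Definition perm_op_fun g f : l2 R X := L2 (perm_op_subproof g f).

Let perm_op_linear g : linear (perm_op_fun g).
Proof. by move=> c f1 f2; apply: val_inj. Qed.

Let perm_op_bij g : bijective (perm_op_fun g).
Proof.
exists (perm_op_fun (g^-1)%g) => f; apply: val_inj; apply/funext => x /=.
  by rewrite invgK order_autK.
by rewrite invgK order_autVK.
Qed.

Let rsum_order_aut g (h : X -> R) : rsum (fun x => h ((g^-1)%g x)) = rsum h.
Proof.
have hg : EFin \o (fun x => h ((g^-1)%g x)) = (EFin \o h) \o (g^-1)%g by [].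
rewrite /rsum hg.
have -> : ((EFin \o h) \o (g^-1)%g)^\+%E = (EFin \o h)^\+%E \o (g^-1)%g.
  by apply/funext => x; rewrite /= !funeposE.
have -> : ((EFin \o h) \o (g^-1)%g)^\-%E = (EFin \o h)^\-%E \o (g^-1)%g.
  by apply/funext => x; rewrite /= !funenegE.
by rewrite /= !esum_order_aut.
Qed.

Let perm_op_dot g f1 f2 :
  l2_dot (perm_op_fun g f1) (perm_op_fun g f2) = l2_dot f1 f2.
Proof.
congr Complex.
  exact: (rsum_order_aut g (fun x => complex.Re (f1 x * conjc (f2 x)))).
exact: (rsum_order_aut g (fun x => complex.Im (f1 x * conjc (f2 x)))).
Qed.

(* (g f)(x) = f(g^-1 x); equivalently g e_x = e_(g x), see [perm_op_basis]. *)
Definition perm_op g : unitary_op R X :=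
  Unitary (perm_op_linear g) (perm_op_bij g) (perm_op_dot g).

Lemma perm_op_basis g (x : X) : perm_op g (l2_basis R x) = l2_basis R (g x).
Proof.
apply: val_inj; apply/funext => y /=; congr (_%:R); congr (nat_of_bool _).
by apply/eqP/eqP => [<-|->]; rewrite ?order_autVK ?order_autK.
Qed.

End permutation_operators.

(* Main.v *)
(* Let phi be a continuous homomorphism of G = Aut(X) into a compact Hausdorff
   semitopological semigroup S, and V_D the pointwise stabilizer of a finite
   set D.  A gliding hump argument along infinite products of pairwise disjoint
   conjugates of elements of bounded support produces a point of cl phi(V_D)
   fixed by V_D, hence, using the opposite semigroup as well, a zero e_D of
   cl phi(V_D).  Separate continuity gives e_(D,a) e_(D,b) = e_D for a <> b
   outside D, whence e_A e_B = e_(A cap B): so e_E phi(g) e_F only depends on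
   the entries (g x == y) with x in F and y in E.  As e_F tends to phi(1), the
   limit of phi along an ultrafilter is determined by the limits of the matrix
   entries of g on l^2(X), that is, by the limit of g in the weak operator
   topology, and phi extends to the closure of G in the unit ball of operators.

   That unit ball is a compact semitopological semigroup and its coefficients
   are Roelcke uniformly continuous; conversely, two automorphisms with the same
   entries over a finite set A differ by permutation unitaries fixing A, so that
   Roelcke uniformly continuous functions on U(l^2(X)) restricted to G only see
   the entries too.  The closures of G in the three models therefore agree. *)
Require Import Defs.
From HB Require Import structures.
From mathcomp Require Import all_boot all_order all_algebra.
From mathcomp Require Import complex ring lra finmap.
From mathcomp Require Import all_classical all_reals all_analysis.

Set Implicit Arguments.
Unset Strict Implicit.
Unset Printing Implicit Defensive.

Import Order.TTheory GRing.Theory Num.Theory.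
Import numFieldNormedType.Exports.

Local Open Scope classical_set_scope.
Local Open Scope ring_scope.

(** * Compactness and ultrafilters *)

(** Multiplication in S is only separately continuous, so a product of limits can be computed only
    one factor at a time, the others staying frozen. The obstacle is a point fixed by all v in V_D
    at once: compactness alone gives no estimate uniform in v. An infinite product removes it,
    because one automorphism can store infinitely many violations of such an estimate, each in a
    cell of its own, and still be compared with its finite stages.

    S need not be metrizable. Closeness is therefore measured by one continuous pseudometric at a
    time, and exact invariance is recovered at the end from compactness.

    On the side of X, the constructions rest on the lattice order of Aut(X): a join makes finitely
    many pushes simultaneous, and a truncation between two automorphisms produces bounded support.

    The case of the unit ball is proved directly. The other two follow from a pair of continuous
    maps over G, one in each direction between the two closures; density makes them mutually
    inverse. *)

Section closures.
Variables S T : topologicalType.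

Lemma eq_on_closure (h1 h2 : S -> T) (A : set S) :
  hausdorff_space T -> continuous h1 -> continuous h2 ->
  {in A, h1 =1 h2} -> {in closure A, h1 =1 h2}.
Proof.
move=> hT c1 c2 e12 p /set_mem pA; apply: hT => U V Up Vp.
have pU : nbhs p (h1 @^-1` U) by exact: c1.
have pV : nbhs p (h2 @^-1` V) by exact: c2.
have [x [Ax [Ux Vx]]] := pA _ (filterI pU pV).
by exists (h1 x); split => //; rewrite e12// inE.
Qed.

Lemma closure_map (h : S -> T) (A : set S) (B : set T) :
  continuous h -> {homo h : x / A x >-> closure B x} ->
  {homo h : x / closure A x >-> closure B x}.
Proof.
move=> ch AB p pA V Vp.
have pV : nbhs p (h @^-1` V^°) by apply: ch; exact: nbhs_interior.
have [x [Ax Vx]] := pA _ pV.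
exact: AB Ax _ Vx.
Qed.

End closures.

Lemma continuous_cvgP (I : Type) (S T : topologicalType) (F : set_system I)
    (f : I -> S) (h : S -> T) (s : S) {FF : Filter F} :
  continuous h -> f @ F --> s -> (fun i => h (f i)) @ F --> h s.
Proof. by move=> ch; apply: continuous_cvg; exact: ch. Qed.

Section ultrafilters.

Lemma ultra_fmap (I T : Type) (f : I -> T) (U : set_system I) :
  UltraFilter U -> UltraFilter (f @ U).
Proof.
move=> UU; split; first exact: fmap_proper_filter.
move=> G GF sG; apply/seteqP; split=> [A GA|]; last exact: sG.
have [//|UnA] := in_ultra_setVsetC (f @^-1` A) UU.
have : G (A `&` ~` A) by apply: filterI => //; exact: sG.
by rewrite setICr => /filter_not_empty.
Qed.

Lemma compact_ultra_cvg (I : Type) (T : topologicalType) (f : I -> T)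
    (U : set_system I) :
  UltraFilter U -> compact [set: T] -> exists s : T, f @ U --> s.
Proof.
move=> UU; rewrite compact_ultra => /(_ (f @ U) (ultra_fmap f UU)).
by case=> [|s [_ fs]]; [exact: filterT|exists s].
Qed.

Lemma closure_ultra_cvg (I : Type) (T : topologicalType) (A : set T)
    (f : I -> T) (U : set_system I) (s : T) :
  UltraFilter U -> (\forall i \near U, A (f i)) -> f @ U --> s -> closure A s.
Proof.
move=> UU fA fs V /fs /= fV.
by have [i [Ai Vi]] := filter_ex (filterI fA fV); exists (f i).
Qed.

Lemma free_ultrafilter :
  exists U : set_system nat, UltraFilter U /\ forall n, U [set m | (n <= m)%N].
Proof.
have [U [UU sU]] := ultraFilterLemma eventually_filter.
by exists U; split=> // n; apply: sU; exists n.
Qed.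

Lemma cvg_initialP (S : choiceType) (T : topologicalType) (f : S -> T)
    (F : set_system S) (s : S) : Filter F ->
  F --> (s : initial_topology f) <-> f @ F --> f s.
Proof.
move=> FF; split=> [Fs A /initial_continuous|fF A].
  exact: Fs.
move=> [_ [[B Bo <-] Bs BA]]; apply: filterS BA _.
by apply: fF; apply: open_nbhs_nbhs.
Qed.

End ultrafilters.

Lemma compact_hausdorff_regular (S : topologicalType) (s : S) (V : set S) :
  compact_hausdorff S -> nbhs s V -> exists2 C : set S, nbhs s C & closure C `<=` V.
Proof.
move=> [cS hS] sV.
exact: (@compact_regular S s setT hS cS filterT V sV).
Qed.

(* Points of [W] are limits of ultrafilters on the dense subset; the hypothesis
   says that the limit of [phi] depends only on the limit in [W]. *)
Lemma ultrafilter_extension (G : Type) (W S : topologicalType) (w : G -> W)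
    (phi : G -> S) :
  compact_hausdorff S -> dense (range w) ->
  (forall (U U' : set_system G) (p : W) (s s' : S),
     UltraFilter U -> UltraFilter U' -> w @ U --> p -> w @ U' --> p ->
     phi @ U --> s -> phi @ U' --> s' -> s = s') ->
  exists2 psi : W -> S, continuous psi & psi \o w = phi.
Proof.
move=> chS dw H; have [cS hS] := chS.
pose F (p : W) : set_system G := filter_from (nbhs p) (fun A => w @^-1` A).
have FF p : ProperFilter (F p).
  apply: filter_from_proper => [|A pA].
    by apply: filter_from_filter => [|A B pA pB];
      [exists setT; exact: filterT|exists (A `&` B) => //; exact: filterI].
  have A0 : A^° !=set0 by exists p.
  have [x [+ [g _ gx]]] := dw _ A0 (@open_interior _ A).
  by rewrite -gx => /interior_subset; exists g.
have lim p : {s : S | exists U : set_system G,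
    [/\ UltraFilter U, F p `<=` U & phi @ U --> s]}.
  apply: cid; have [U [UU FU]] := ultraFilterLemma (FF p).
  by have [s Us] := compact_ultra_cvg phi UU cS; exists s, U.
have cvgF p (U : set_system G) : UltraFilter U -> F p `<=` U -> w @ U --> p.
  by move=> UU FU A pA; apply: FU; exists A.
pose psi p := sval (lim p).
have psiU p (U : set_system G) : UltraFilter U -> F p `<=` U ->
    phi @ U --> psi p.
  move=> UU FU; have [U' [UU' FU' Us]] := svalP (lim p).
  have [s' Us'] := compact_ultra_cvg phi UU cS.
  by rewrite /psi (H _ _ p _ _ UU' UU _ _ Us Us') //; exact: cvgF.
exists psi; last first.
  apply/funext => g /=; have UU := principal_filter_ultra g.
  have c1 : phi @ principal_filter g --> psi (w g).
    apply: (psiU (w g) _ UU) => B [A wgA AB].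
    by apply/principal_filterP; apply: AB; exact: (nbhs_singleton wgA).
  have c2 : phi @ principal_filter g --> phi g.
    by move=> A gA; apply/principal_filterP; exact: (nbhs_singleton gA).
  exact: (cvg_unique hS c1 c2).
move=> p N pN.
(* Values of [psi] at points near [p] are limits of values of [phi], hence lie only in [closure C];
   this is why that closure has to be inside [N]. *)
have [C pC CN] := compact_hausdorff_regular chS pN.
(* Otherwise the complement of the preimage of [C] meets every member of [F p]; along an ultrafilter
   containing all these traces [phi] would tend to [psi p] while avoiding its neighbourhood [C]. *)
have [A pA AC] : F p (phi @^-1` C).
  apply: contrapT => nFC.
  pose F' := filter_from (F p) (fun A => A `&` ~` (phi @^-1` C)).
  have FF' : ProperFilter F'.
    apply: filter_from_proper => [|A pA].
      apply: filter_from_filter => [|A B pA pB]; first by exists setT; exact: filterT.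
      by exists (A `&` B); [exact: filterI|rewrite setIACA setIid].
    apply: contrapT => nA; apply: nFC; apply: filterS pA => g Ag.
    by apply: contrapT => nC; apply: nA; exists g.
  have [U [UU FU]] := ultraFilterLemma FF'.
  have FpU : F p `<=` U.
    move=> A pA; apply: (@filterS _ U _ (A `&` ~` (phi @^-1` C))).
      exact: subIsetl.
    by apply: FU; exists A.
  have UC : U (phi @^-1` C) by exact: (psiU p U UU FpU).
  have UnC : U (~` (phi @^-1` C)).
    by apply: FU; exists setT; [exact: filterT|exact: subIsetr].
  by have [g []] := filter_ex (filterI UC UnC).
rewrite nbhs_simpl /=; apply: filterS (nbhs_interior pA) => q Aq /=; apply: CN.
have [U [UU FU]] := ultraFilterLemma (FF q).
apply: (closure_ultra_cvg UU _ (psiU q U UU FU)).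
by apply: FU; exists A.
Qed.

(** * Continuous pseudometrics on compact Hausdorff spaces *)

Section continuous_pseudometrics.
Variables (R : realType) (S : topologicalType).

(** A substitute for the uniformity of S, so that errors can be added as real numbers. Smallness
    near the diagonal is enough: the triangle inequality turns it into joint continuity. *)
Record continuous_pseudometric (d : S -> S -> R) : Prop := {
  cpm_sym : forall x y, d x y = d y x;
  cpm_triangle : forall y x z, d x z <= d x y + d y z;
  cpm_cont : forall x e, 0 < e -> \forall y \near x, d x y < e }.

Lemma cpmD d d' : continuous_pseudometric d -> continuous_pseudometric d' ->
  continuous_pseudometric (fun x y => d x y + d' x y).
Proof.
move=> [s t c] [s' t' c']; split.
- by move=> x y; rewrite s s'.
- by move=> y x z; rewrite addrACA lerD.
- move=> x e e0; have e2 : 0 < e / 2 by rewrite divr_gt0.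
  near=> y; rewrite (splitr e); apply: ltrD; near: y; [exact: c|exact: c'].
Unshelve. all: by end_near. Qed.

Lemma cpm_ge0 d : continuous_pseudometric d -> forall x y, 0 <= d x y.
Proof.
move=> [s t _] x y; have := t y x x; have := t x x x; rewrite (s y x); lra.
Qed.

Lemma urysohn_points (x y : S) : compact_hausdorff S -> x <> y ->
  exists f : S -> R, [/\ continuous f, f x = 0 & f y = 1].
Proof.
move=> [cS hS] xy.
have crs : completely_regular_space S.
  apply: (@normal_completely_regular R); first exact: compact_normal.
  exact: hausdorff_accessible.
have /crs : ~ [set y] x by [].
move=> /(_ (@accessible_closed_set1 _ (hausdorff_accessible hS) y)).
move=> /(@uniform_separatorP S R)[f [cf _ fx fy]].
by exists f; split=> //; [apply: fx; exists x|apply: fy; exists y].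
Qed.

(** A Urysohn function may be rescaled, so distinct points can be put at any distance; the later
    estimates can then all be stated with the threshold 1. *)
Lemma cpm_separates (x y : S) (k : R) : compact_hausdorff S -> x <> y ->
  exists2 d, continuous_pseudometric d & k < d x y.
Proof.
move=> chS /(urysohn_points chS)[f [cf fx0 fy1]].
exists (fun u v => (`|k| + 1) * `|f u - f v|); last first.
  rewrite fx0 fy1 sub0r normrN normr1 mulr1; have := ler_norm k; lra.
have k0 : 0 < `|k| + 1 by rewrite ltr_wpDl.
split.
- by move=> u v; rewrite distrC.
- move=> v u z; rewrite -mulrDr ler_wpM2l ?(ltW k0)//.
  exact: ler_distD.
- move=> u e e0; have ek : 0 < e / (`|k| + 1) by rewrite divr_gt0.
  near=> v; rewrite mulrC -ltr_pdivlMr//; near: v.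
  by have /cvgr_dist_lt := cf u; apply.
Unshelve. all: by end_near. Qed.

End continuous_pseudometrics.

(** * Automorphisms of chains *)

Section chains.
Context {d : Order.disp_t} (X : orderType d).
Local Notation G := (order_aut X).
Implicit Types (g h : G) (D A : seq X) (x y : X).
Local Open Scope order_scope.

Definition fixes D g : Prop := {in D, g =1 id}.

Lemma order_autM g h x : (g * h)%g x = g (h x). Proof. by []. Qed.

Lemma order_aut_lt g : {mono g : x y / x < y}.
Proof. by move=> x y; rewrite !ltNge order_aut_mono. Qed.

Lemma order_aut_inj g : injective g.
Proof. exact: can_inj (order_autK g). Qed.

Lemma fixes1 D : fixes D 1%g. Proof. by move=> x. Qed.

Lemma fixesM D g h : fixes D g -> fixes D h -> fixes D (g * h)%g.
Proof. by move=> gD hD x xD; rewrite order_autM hD// gD. Qed.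

Lemma fixesV D g : fixes D g -> fixes D (g^-1)%g.
Proof. by move=> gD x xD; rewrite -{1}(gD x xD) order_autK. Qed.

Lemma fixesX D g n : fixes D g -> fixes D (g ^+ n)%g.
Proof.
move=> gD; elim: n => [|n IH]; first by rewrite expg0; exact: fixes1.
by rewrite expgS; apply: fixesM.
Qed.

Lemma fixesS D A g : {subset D <= A} -> fixes A g -> fixes D g.
Proof. by move=> DA gA x /DA; exact: gA. Qed.

(* Equal cuts over [D]; a point of [D] is alone in its class. *)
Definition same_cut D x y := all (fun c => (x < c) == (y < c)) D &&
  all (fun c => (c < x) == (c < y)) D.

Lemma same_cutP D x y : reflect
  (forall c, c \in D -> (x < c) = (y < c) /\ (c < x) = (c < y)) (same_cut D x y).
Proof.
apply: (iffP andP) => [[/allP l /allP r] c cD|H].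
  by rewrite (eqP (l c cD)) (eqP (r c cD)).
by split; apply/allP => c /H [l r]; apply/eqP.
Qed.

Lemma same_cutxx D x : same_cut D x x. Proof. by apply/same_cutP. Qed.

Lemma same_cutC D x y : same_cut D x y = same_cut D y x.
Proof. by apply/same_cutP/same_cutP => H c /H [-> ->]. Qed.

Lemma same_cut_trans D y x z :
  same_cut D x y -> same_cut D y z -> same_cut D x z.
Proof. by move=> /same_cutP H /same_cutP H'; apply/same_cutP => c cD;
  have [-> ->] := H c cD; exact: H'. Qed.

Lemma same_cut_fixes D g x : fixes D g -> same_cut D (g x) x.
Proof.
move=> gD; apply/same_cutP => c cD.
by rewrite -{1 3}(gD c cD) !order_aut_lt.
Qed.

Lemma same_cut_between D x y z : same_cut D x z -> x <= y -> y <= z ->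
  same_cut D x y.
Proof.
move=> /same_cutP H xy yz; apply/same_cutP => c /H [l r]; split.
  by apply/idP/idP; [rewrite l; exact: le_lt_trans|exact: le_lt_trans].
by apply/idP/idP => [/lt_le_trans|cy]; [exact|rewrite r (lt_le_trans cy)].
Qed.

(** Cuts over [D] are convex, so the order between two different cuts is shared by all of their
    points. *)
Lemma same_cut_lt D x x' y y' : same_cut D x x' -> same_cut D y y' ->
  ~~ same_cut D x y -> x < y -> x' < y'.
Proof.
move=> xx' yy' xy ltxy; rewrite ltNge; apply/negP => y'x'; case/negP: xy.
have [x'x|xx'l] := leP x' x.
  apply: (same_cut_trans xx'); rewrite same_cutC; apply: (same_cut_trans yy').
  apply: (@same_cut_between _ _ _ y); first by rewrite same_cutC.
    exact: y'x'.
  exact: le_trans x'x (ltW ltxy).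
have [yx'|x'y] := leP y x'.
  by apply: (same_cut_between xx') => //; exact: ltW.
apply: (same_cut_trans xx'); rewrite same_cutC; apply: (same_cut_trans yy').
apply: (@same_cut_between _ _ _ y); first by rewrite same_cutC.
  exact: y'x'.
exact: ltW.
Qed.

Lemma same_cut_mem D x y : x \in D -> same_cut D x y -> y = x.
Proof.
move=> xD /same_cutP/(_ x xD); rewrite ltxx => -[l r].
by apply/eqP; rewrite eq_le !leNgt -l -r.
Qed.

(** The automorphisms of a chain form a lattice-ordered group under the pointwise order; the inverse
    of a join is the meet of the inverses. *)
Lemma order_aut_join g h :
  exists k : G, forall x, k x = Order.max (g x) (h x).
Proof.
pose k x := Order.max (g x) (h x).
have km : {homo k : x y / x < y}.
  move=> x y xy; rewrite /k gt_max !lt_max !order_aut_lt xy /=.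
  by rewrite orbT.
have kb : bijective k.
  exists (fun x => Order.min ((g^-1)%g x) ((h^-1)%g x)) => x; rewrite /k.
    by case: (leP (g x) (h x)) => gh; rewrite ?order_autK;
      [rewrite min_r ?order_autK// -(order_aut_mono g) order_autVK|
       rewrite min_l ?order_autK// -(order_aut_mono h) order_autVK ltW].
  case: (leP ((g^-1)%g x) ((h^-1)%g x)) => gh; rewrite ?order_autVK.
    by rewrite max_l// -[leRHS](order_autVK h) order_aut_mono.
  by rewrite max_r// -[leRHS](order_autVK g) order_aut_mono ltW.
by exists (OrderAut kb (le_mono km)).
Qed.

Lemma order_aut_meet g h :
  exists k : G, forall x, k x = Order.min (g x) (h x).
Proof.
have [k kE] := order_aut_join (g^-1)%g (h^-1)%g; exists (k^-1)%g => x.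
apply: (order_aut_inj (g := k)); rewrite order_autVK kE.
case: (leP (g x) (h x)) => gh; rewrite !order_autK.
  by rewrite max_l// -(order_aut_mono h) order_autVK.
by rewrite max_r// -(order_aut_mono g) order_autVK ltW.
Qed.

(** Across two classes of a convex equivalence the order does not change when each class is mapped
    to itself, so the automorphism may be chosen class by class. The map [k'] glues the inverses of
    the pieces and witnesses bijectivity. *)
Lemma order_aut_glue (E : X -> X -> Prop) (k k' : X -> X) :
  (forall x, E x x) -> (forall x y, E x y -> E y x) ->
  (forall x y z, E x y -> E y z -> E x z) ->
  (forall x y z, E x z -> x <= y -> y <= z -> E x y) ->
  (forall x, exists g, forall y, E x y ->
     [/\ k y = g y, E y (g y), k' y = (g^-1)%g y & E y ((g^-1)%g y)]) ->
  exists g, g =1 k /\ (g^-1)%g =1 k'.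
Proof.
move=> Er Es Et Ec H.
have kE x : E x (k x) by have [g /(_ x (Er x))[-> ? _ _]] := H x.
have km : {homo k : x y / x < y}.
  move=> x y xy; have [Exy|nE] := pselect (E x y).
    have [g Hg] := H x.
    have [-> _ _ _] := Hg x (Er x); have [-> _ _ _] := Hg y Exy.
    by rewrite order_aut_lt.
  rewrite ltNge; apply/negP => kyx; apply: nE.
  have [yx|xy'] := leP y (k x).
    exact: Ec (kE x) (ltW xy) yx.
  have Eky : E (k y) (k x).
    by apply: (Ec _ _ y); [exact/Es/kE|exact: kyx|exact: ltW].
  exact: (Et _ _ _ (kE x) (Es _ _ (Et _ _ _ (kE y) Eky))).
have kK : cancel k k'.
  move=> x; have [g Hg] := H x; have [kx gx _ _] := Hg x (Er x).
  by have [_ _] := Hg _ (kE x); rewrite kx order_autK.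
have k'K : cancel k' k.
  move=> x; have [g Hg] := H x; have [_ _ kx gx] := Hg x (Er x).
  by rewrite kx; have [-> _ _ _] := Hg _ gx; rewrite order_autVK.
have kb : bijective k by exists k'.
exists (OrderAut kb (le_mono km)); split=> // x.
apply: (order_aut_inj (g := OrderAut kb (le_mono km))).
by rewrite order_autVK /= k'K.
Qed.

End chains.

(** * Ultrahomogeneity: density, orbits of stabilizers, bounded support *)

Section ultrahomogeneous_chains.
Context {d : Order.disp_t} (X : orderType d).
Hypotheses (Xinf : infinite_set [set: X]) (Xuh : ultrahomogeneous X).
Local Notation G := (order_aut X).
Implicit Types (g h : G) (D A B : seq X) (x y : X).
Local Open Scope order_scope.

(** Ultrahomogeneity for partial maps on unordered lists with repetitions: sorting the underlying
    set gives the increasing tuples. *)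
Lemma extend_partial (s : seq X) (f : X -> X) :
  {in s &, {homo f : x y / x < y}} -> exists g, {in s, g =1 f}.
Proof.
move=> fs; pose s' := sort <=%O (undup s).
have s's : s' =i s by move=> x; rewrite mem_sort mem_undup.
have s'_lt : sorted <%O s' by rewrite lt_sorted_uniq_le sort_uniq undup_uniq sort_le_sorted.
case E : s' => [|x0 s0].
  by exists 1%g => x; rewrite -s's E.
pose u (i : 'I_(size s')) := nth x0 s' i.
have us i : u i \in s by rewrite -s's mem_nth.
have um : {homo u : i j / (i < j)%N >-> i < j}.
  move=> i j ij; rewrite /u (@lt_sorted_ltn_nth _ _ x0)// inE; exact: ltn_ord.
have [g gE] := Xuh um (fun i j ij => fs _ _ (us i) (us j) (um _ _ ij)).
exists g => x; rewrite -s's => xs'.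
have xi : (index x s' < size s')%N by rewrite index_mem.
by have := gE (Ordinal xi); rewrite /u /= nth_index.
Qed.

(** Moved around by automorphisms, three points already force the order to be dense and without
    endpoints. *)
Lemma three_points : exists x y z : X, x < y /\ y < z.
Proof.
have notin (s : seq X) : exists x, x \notin s.
  apply: contrapT => H; apply: Xinf; apply: (sub_finite_set _ (finite_seq s)).
  by move=> x _ /=; apply: contrapT => /negP xs; apply: H; exists x.
have [a _] := notin [::]; have [b] := notin [:: a].
have [c] := notin [:: a; b]; rewrite !inE !negb_or => /andP[ca cb] ba.
wlog ab : a b ca cb ba / a < b => [H|].
  have [/H|/H|ab] := ltgtP a b; first by apply.
    by apply=> //; rewrite eq_sym.
  by rewrite ab eqxx in ba.
have [ac|ac|ac] := ltgtP c a; first by exists c, a, b.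
  have [bc|bc|bc] := ltgtP c b; first by exists a, c, b.
    by exists a, b, c.
  by rewrite bc eqxx in cb.
by rewrite ac eqxx in ca.
Qed.

Lemma chain_above x : exists y, x < y.
Proof.
have [a [b [_ [ab _]]]] := three_points.
have [|g /(_ a (mem_head _ _)) ga] := @extend_partial [:: a] (fun=> x).
  by move=> u v; rewrite !inE => /eqP -> /eqP ->; rewrite ltxx.
by exists (g b); rewrite -ga order_aut_lt.
Qed.

Lemma chain_below x : exists y, y < x.
Proof.
have [b [a [_ [ba _]]]] := three_points.
have [|g /(_ a (mem_head _ _)) ga] := @extend_partial [:: a] (fun=> x).
  by move=> u v; rewrite !inE => /eqP -> /eqP ->; rewrite ltxx.
by exists (g b); rewrite -ga order_aut_lt.
Qed.

Lemma chain_dense x y : x < y -> exists z, x < z < y.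
Proof.
move=> xy; have [a [b [c [ab bc]]]] := three_points.
have ac := lt_trans ab bc.
have [|g gE] := @extend_partial [:: a; c] (fun u => if u == a then x else y).
  move=> u v; rewrite !inE => /orP[]/eqP -> /orP[]/eqP ->;
    by rewrite ?ltxx ?eqxx ?(gt_eqF ac)// lt_gtF.
have := gE a; have := gE c; rewrite !inE !eqxx orbT (gt_eqF ac) => gc ga.
by exists (g b); rewrite -{1}ga// -gc// !order_aut_lt ab.
Qed.

(** Induction on [D]: the point found for the tail is lowered by density below the new element [c]
    when [c] is above [x]. *)
Lemma same_cut_above D x : x \notin D -> exists2 y, x < y & same_cut D x y.
Proof.
elim: D => [|c D IH]; first by have [y xy] := chain_above x; exists y.
rewrite inE negb_or => /andP[xc /IH[y xy Dxy]].
have [y' [xy' y'y y'c]] : exists y', [/\ x < y', y' <= y & x < c -> y' < c].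
  case: (ltP x c) => [xc'|_]; last by exists y.
  have [y' /andP[xy']] : exists y', x < y' < Order.min y c.
    by apply: chain_dense; rewrite lt_min xy.
  by rewrite lt_min => /andP[y'y y'c]; exists y'; split=> //; exact: ltW.
exists y' => //; apply/same_cutP => e; rewrite inE => /predU1P[->|eD].
  have [{}xc|{}cx|E] := ltgtP x c; last by rewrite E eqxx in xc.
    by rewrite y'c//; split=> //; symmetry; apply/negP => /(lt_trans (y'c xc)); rewrite ltxx.
  by rewrite (lt_trans cx)// ltNge (ltW (lt_trans cx xy')).
have /same_cutP : same_cut D x y' by exact: same_cut_between Dxy (ltW xy') y'y.
exact.
Qed.

Lemma same_cut_below D x : x \notin D -> exists2 y, y < x & same_cut D x y.
Proof.
elim: D => [|c D IH]; first by have [y xy] := chain_below x; exists y.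
rewrite inE negb_or => /andP[xc /IH[y xy Dxy]].
have [y' [xy' y'y y'c]] : exists y', [/\ y' < x, y <= y' & c < x -> c < y'].
  case: (ltP c x) => [xc'|_]; last by exists y.
  have [y' /andP[+ xy']] : exists y', Order.max y c < y' < x.
    by apply: chain_dense; rewrite gt_max xy.
  by rewrite gt_max => /andP[y'y y'c]; exists y'; split=> //; exact: ltW.
exists y' => //; apply/same_cutP => e; rewrite inE => /predU1P[->|eD].
  have [{}xc|{}cx|E] := ltgtP x c; last by rewrite E eqxx in xc.
    by rewrite (lt_trans xy')// ltNge (ltW (lt_trans xy' xc)).
  by rewrite y'c//; split=> //; symmetry; apply/negP => /(lt_trans (y'c cx)); rewrite ltxx.
have /same_cutP H : same_cut D y y'.
  by apply: same_cut_between y'y (ltW xy'); rewrite same_cutC.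
by have /same_cutP/(_ e eD)[-> ->] := Dxy; exact: H.
Qed.

(** Together with [same_cut_fixes] this identifies the cuts over [D] with the orbits of its
    pointwise stabilizer. *)
Lemma same_cut_orbit D x y : same_cut D x y -> exists2 g, fixes D g & g x = y.
Proof.
move=> xy; pose f u := if u == x then y else u.
have [|g gE] := @extend_partial (x :: D) f.
  move=> u v; rewrite !inE /f => /predU1P[->|uD] /predU1P[->|vD].
  - by rewrite ltxx.
  - rewrite eqxx; case: eqP => [->|_]; first by rewrite ltxx.
    by have /same_cutP/(_ v vD)[-> _] := xy.
  - rewrite eqxx; case: eqP => [->|_]; first by rewrite ltxx.
    by have /same_cutP/(_ u uD)[_ ->] := xy.
  - have E w : w \in D -> (if w == x then y else w) = w.
      by case: eqP => // -> xD; apply: same_cut_mem xy.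
    by rewrite !E.
exists g; last by rewrite gE ?mem_head// /f eqxx.
move=> w wD; rewrite gE ?inE ?wD ?orbT// /f.
by case: eqP => // E; rewrite -E in xy *; exact: same_cut_mem xy.
Qed.

Lemma push_above D x y : x \notin D -> same_cut D x y ->
  exists2 g, fixes D g & y < g x.
Proof.
move=> xD xy.
have yD : y \notin D by apply: contra xD => yD; rewrite same_cutC in xy;
  rewrite (same_cut_mem yD xy).
have [z yz Dyz] := same_cut_above yD.
have [g gD gx] := same_cut_orbit (same_cut_trans xy Dyz).
by exists g => //; rewrite gx.
Qed.

(* The union, over the cuts of [D], of the convex hulls of the parts of [B]. *)
Definition hull D B x := exists b c,
  [/\ b \in B, c \in B, b <= x, x <= c & same_cut D b c].

Lemma hull_same_cut D x b c : b <= x -> x <= c -> same_cut D b c ->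
  same_cut D b x /\ same_cut D x c.
Proof.
move=> bx xc Dbc; have Dbx := same_cut_between Dbc bx xc; split=> //.
by apply: same_cut_trans Dbc; rewrite same_cutC.
Qed.

Lemma hull_convex D B x y z : hull D B x -> hull D B z -> same_cut D x z ->
  x <= y -> y <= z -> hull D B y.
Proof.
move=> [b [c [bB cB bx xc Dbc]]] [b' [c' [bB' cB' bz zc Dbc']]] Dxz xy yz.
have [Dbx _] := hull_same_cut bx xc Dbc.
have [_ Dzc] := hull_same_cut bz zc Dbc'.
exists b, c'; split=> //; [exact: le_trans xy|exact: le_trans zc|].
exact: same_cut_trans Dbx (same_cut_trans Dxz Dzc).
Qed.

Lemma hullS D A B x : {subset A <= B} -> hull D A x -> hull D B x.
Proof. by move=> AB [b [c [/AB bB /AB cB ? ? ?]]]; exists b, c. Qed.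

Definition disjoint_from D B := {in B, forall b, b \notin D}.

(** Only the finitely many pairs of points of [B] matter: [b <= x] and [y <= c] reduce the claim to
    [c < t b], and the join of one push per pair serves all pairs. The powers of [t] then move the
    hull to disjoint places. *)
Lemma hull_push D B : disjoint_from D B -> exists2 t, fixes D t &
  forall x y, hull D B x -> hull D B y -> same_cut D x y -> y < t x.
Proof.
move=> BD.
have [t tD tB] : exists2 t, fixes D t & {in B &, forall b c, same_cut D b c -> c < t b}.
  have H (l : seq (X * X)) : {in l, forall p, p.1 \in B} ->
      exists2 t, fixes D t & {in l, forall p, same_cut D p.1 p.2 -> p.2 < t p.1}.
    elim: l => [|[b c] l IH] lB; first by exists 1%g => //; exact: fixes1.
    have [|t tD tl] := IH; first by move=> p pl; apply: lB; rewrite inE pl orbT.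
    have [u uD ub] : exists2 u, fixes D u & same_cut D b c -> c < u b.
      have [Dbc|_] := boolP (same_cut D b c); last by exists 1%g => //; exact: fixes1.
      have [|u uD cu] := push_above _ Dbc; last by exists u.
      by apply/BD/(lB (b, c)); rewrite mem_head.
    have [k kE] := order_aut_join t u; exists k.
      by move=> x xD; rewrite kE tD// uD// maxxx.
    move=> p; rewrite inE => /predU1P[-> /ub|pl Dp]; rewrite kE lt_max.
      by move=> ->; rewrite orbT.
    by rewrite (tl p pl Dp).
  have [|t tD tB] := H [seq (b, c) | b <- B, c <- B].
    by move=> p /allpairsP[[b c] /= [bB _ ->]].
  by exists t => // b c bB cB; apply: (tB (b, c)); apply/allpairsP; exists (b, c).
exists t => // x y [b [c [bB cB bx xc Dbc]]] [b' [c' [bB' cB' by' yc Dbc']]] Dxy.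
have [Dbx _] := hull_same_cut bx xc Dbc.
have [_ Dyc] := hull_same_cut by' yc Dbc'.
apply: le_lt_trans yc _; apply: (@lt_le_trans _ _ (t b)); last by rewrite order_aut_mono.
by apply: tB => //; exact: same_cut_trans Dbx (same_cut_trans Dxy Dyc).
Qed.

Definition hull_supported D B g := fixes D g /\ forall x, ~ hull D B x -> g x = x.

Lemma hull_supported1 D B : hull_supported D B 1%g.
Proof. by split => //; exact: fixes1. Qed.

Lemma hull_supportedV D B g : hull_supported D B g -> hull_supported D B (g^-1)%g.
Proof.
move=> [gD gB]; split; first exact: fixesV.
by move=> x /gB gx; rewrite -{1}gx order_autK.
Qed.

Lemma hull_supportedS D A B g : {subset A <= B} ->
  hull_supported D A g -> hull_supported D B g.
Proof. by move=> AB [gD gA]; split=> // x xB; apply: gA => /(hullS AB). Qed.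

Lemma hull_supported_stable D B g x : hull_supported D B g -> hull D B x -> hull D B (g x).
Proof.
by move=> [_ gB] Bx; apply: contrapT => /[dup] /gB /order_aut_inj ->.
Qed.

(** * Disjoint translates of a hull and infinite products over them *)

Section translates.
Variables (D B : seq X) (t : G).
Hypotheses (tD : fixes D t)
  (tB : forall x y, hull D B x -> hull D B y -> same_cut D x y -> y < t x).

(* [t ^+ n] maps the hull onto the [n]-th cell, and distinct cells are disjoint. *)
Definition cell n x := hull D B ((t ^+ n)^-1 x)%g.

Lemma cell_inj m n x : cell m x -> cell n x -> m = n.
Proof.
wlog mn : m n / (m < n)%N => [H xm xn|xm xn].
  have [mn|nm|//] := ltngtP m n; first exact: (H _ _ mn xm xn).
  by rewrite (H _ _ nm xn xm).
have ltX k y z : hull D B y -> hull D B z -> same_cut D y z -> z < (t ^+ k.+1)%g y.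
  move=> yB zB Dyz; have yty := tB yB yB (same_cutxx D y).
  suff H : y <= (t ^+ k)%g y.
    rewrite expgS order_autM; apply: (lt_le_trans (tB yB zB Dyz)).
    by rewrite order_aut_mono.
  elim: k => [|k IH]; first by rewrite expg0.
  by rewrite expgSr order_autM; apply: le_trans IH _; rewrite order_aut_mono ltW.
have Dn k : same_cut D ((t ^+ k)^-1 x)%g x.
  by apply: same_cut_fixes; exact/fixesV/fixesX.
have Dnm : same_cut D ((t ^+ n)^-1 x)%g ((t ^+ m)^-1 x)%g.
  by apply: same_cut_trans (Dn n) _; rewrite same_cutC.
(* The exponent is [n - m], written as a successor: this power of [t] carries the first point to the
   second, which would thus be strictly above itself. *)
have := ltX (n - m.+1)%N _ _ xn xm Dnm.
rewrite subnSK// -order_autM.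
have -> : (t ^+ n = t ^+ m * t ^+ (n - m))%g by rewrite -expgnDr subnKC// ltnW.
by rewrite invgM mulgA mulgV mul1g ltxx.
Qed.

(* The infinite product of the conjugates of the [f n] by [t ^+ n]. *)
Definition glued (f : nat -> G) g := forall x,
  (forall n, cell n x -> g x = (t ^+ n * f n * (t ^+ n)^-1)%g x) /\
  ((forall n, ~ cell n x) -> g x = x).

Lemma glued_exists f : (forall n, hull_supported D B (f n)) -> exists g, glued f g.
Proof.
move=> fB.
pose c n := (t ^+ n * f n * (t ^+ n)^-1)%g.
have cV n : ((c n)^-1 = t ^+ n * (f n)^-1 * (t ^+ n)^-1)%g.
  by rewrite /c !invgM invgK mulgA.
pose loc x (n : option nat) := if n is Some n then cell n x else forall n, ~ cell n x.
have locP x : {n | loc x n}.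
  apply: cid; have [[n xn]|nx] := pselect (exists n, cell n x); first by exists (Some n).
  by exists None => n xn; apply: nx; exists n.
have loc_inj x m n : loc x m -> loc x n -> m = n.
  case: m n => [m|] [n|] //=; first by move=> xm /(cell_inj xm) ->.
  - by move=> xm /(_ m).
  - by move=> H /H.
pose aut n := if n is Some n then c n else 1%g.
pose k x := aut (sval (locP x)) x; pose k' x := ((aut (sval (locP x)))^-1)%g x.
have locE x n : loc x n -> sval (locP x) = n by apply: loc_inj; exact: svalP.
(* A cell may meet several cuts and is convex only inside each of them, so the classes are the
   traces of cells on cuts; every other point is alone. *)
pose E x y := x = y \/ exists n, [/\ cell n x, cell n y & same_cut D x y].
have stable n y (h : G) : hull_supported D B h -> cell n y ->
    E y ((t ^+ n * h * (t ^+ n)^-1)%g y).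
  move=> hB yn; right; exists n; split => //.
    by rewrite /cell -order_autM !mulgA mulVg mul1g order_autM; exact: hull_supported_stable.
  rewrite same_cutC; apply: same_cut_fixes.
  by apply: fixesM; [apply: fixesM|apply: fixesV]; [exact: fixesX|case: hB|exact: fixesX].
have [||||x|g [gk _]] := @order_aut_glue _ X E k k'.
- by move=> x; left.
- by move=> x y [->|[n [xn yn xy]]]; [left|right; exists n; rewrite same_cutC].
- move=> x y z [->//|[n [xn yn xy]]] [<-|[m [ym zm yz]]]; right; first by exists n.
  by rewrite -(cell_inj yn ym) in zm; exists n; split=> //; exact: same_cut_trans yz.
- move=> x y z [<-|[n [xn zn xz]]] xy yz.
    by left; apply/eqP; rewrite eq_le xy yz.
  right; exists n; split=> //; last exact: same_cut_between xz xy yz.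
  apply: (hull_convex xn zn); rewrite ?order_aut_mono//.
  have Dn u : same_cut D ((t ^+ n)^-1 u)%g u by apply: same_cut_fixes; exact/fixesV/fixesX.
  by apply: same_cut_trans (Dn x) _; apply: same_cut_trans xz _; rewrite same_cutC.
- exists (aut (sval (locP x))) => y Exy.
  have yx : loc y (sval (locP x)).
    case: Exy => [<-|[n [xn yn _]]]; first exact: svalP.
    by rewrite (locE x (Some n)).
  rewrite /k /k' (locE _ _ yx); case: (sval (locP x)) yx => [n|] /= yn; last first.
    by rewrite invg1; split=> //; left.
  split=> //; first exact: stable.
  by rewrite cV; apply: stable => //; exact: hull_supportedV.
exists g => x; rewrite gk /k; split=> [n xn|xn]; first by rewrite (locE x (Some n)).
by rewrite (locE x None).
Qed.

Lemma glued_fixes f g : (forall n, hull_supported D B (f n)) -> glued f g -> fixes D g.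
Proof.
move=> fB gf x xD; have [gn g0] := gf x.
have [[n xn]|nx] := pselect (exists n, cell n x).
  rewrite (gn n xn); apply: (fixesM (D := D)) => //; last exact/fixesV/fixesX.
  by apply: fixesM; [exact: fixesX|case: (fB n)].
by apply: g0 => n xn; apply: nx; exists n.
Qed.

(** A point lies in at most one cell and sees only the factor sitting there. Hence the product
    depends continuously on the family of factors, which is the locality required by the gliding
    hump. *)
Lemma glued_agree f f' g g' x : glued f g -> glued f' g' ->
  (forall n, cell n x -> f n = f' n) -> g x = g' x.
Proof.
move=> gf gf' ff'; have [gn g0] := gf x; have [gn' g0'] := gf' x.
have [[n xn]|nx] := pselect (exists n, cell n x).
  by rewrite (gn n xn) (gn' n xn) ff'.
by rewrite g0 ?g0'// => n xn; apply: nx; exists n.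
Qed.

(** Seen through [t ^- n], inserting a factor in an empty place [n] is a left multiplication by that
    factor. This is why the sequence fed to the gliding hump is the image of the inverse powers of
    [t]. *)
Lemma glued_update f f' g g' n : (forall m, hull_supported D B (f m)) ->
  hull_supported D B (f' n) -> glued f g -> glued f' g' -> f n = 1%g ->
  (forall m, m != n -> f' m = f m) ->
  ((t ^+ n)^-1 * g' = f' n * ((t ^+ n)^-1 * g))%g.
Proof.
move=> fB [_ vB] gf gf' fn ff'; apply: order_aut_eqP => x; rewrite !order_autM.
have [xn|xn] := pselect (cell n x).
  rewrite (proj1 (gf' x) n xn) (proj1 (gf x) n xn) fn mulg1 mulgV.
  by rewrite -!order_autM !mulgA mulVg mul1g.
have -> : g' x = g x.
  by apply: (glued_agree gf' gf) => m xm; apply: ff'; apply: contra_notN xn => /eqP <-.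
(* Since [g] maps every cell into itself, [g x] cannot enter cell [n] from outside. *)
rewrite vB// => gxn; apply: xn.
have [[m xm]|nx] := pselect (exists m, cell m x); last first.
  have [_ g0] := gf x; rewrite g0// in gxn.
  by move=> m xm; apply: nx; exists m.
have : cell m (g x).
  have [gm _] := gf x; rewrite (gm m xm) /cell -order_autM !mulgA mulVg mul1g.
  by rewrite order_autM; exact: hull_supported_stable.
by move=> /(cell_inj gxn) ->.
Qed.

End translates.

(** Room is made inside the cut by points [p < x] and [q > y]; an automorphism fixing both and
    sending [x] to [y] is then confined to the interval between them. *)
Lemma bump D x y : same_cut D x y -> exists B g,
  [/\ disjoint_from D B, hull_supported D B g, forall z, z <= g z & y <= g x].
Proof.
move=> Dxy; have [yx|xy] := leP y x.
  by exists [::], 1%g; split=> //; exact: hull_supported1.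
have xD : x \notin D.
  by apply/negP => xD; rewrite (same_cut_mem xD Dxy) ltxx in xy.
have yD : y \notin D.
  apply/negP => yD; move: Dxy; rewrite same_cutC => /(same_cut_mem yD) E.
  by rewrite E ltxx in xy.
have [p px Dxp] := same_cut_below xD; have [q yq Dyq] := same_cut_above yD.
have pq : p < q := lt_trans px (lt_trans xy yq).
have Dpq : same_cut D p q.
  by apply: same_cut_trans Dyq; apply: same_cut_trans Dxy; rewrite same_cutC.
have pD : p \notin D.
  by apply/negP => pD; rewrite (same_cut_mem pD Dpq) ltxx in pq.
have qD : q \notin D.
  apply/negP => qD; move: Dpq; rewrite same_cutC => /(same_cut_mem qD) E.
  by rewrite E ltxx in pq.
have Dpx : same_cut D p x by rewrite same_cutC.
have [u uD ux] : exists2 u, fixes [:: p, q & D] u & u x = y.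
  apply: same_cut_orbit; apply/same_cutP => c; rewrite !inE => /or3P[/eqP->|/eqP->|cD].
  - rewrite px (lt_trans px xy); split=> //.
    by rewrite (lt_gtF px) (lt_gtF (lt_trans px xy)).
  - rewrite yq (lt_trans xy yq); split=> //.
    by rewrite (lt_gtF yq) (lt_gtF (lt_trans xy yq)).
  - by have /same_cutP := Dxy; apply.
have up : u p = p by apply: uD; rewrite !inE eqxx.
have uq : u q = q by apply: uD; rewrite !inE eqxx orbT.
(* [u] fixes both ends, hence preserves the interval; it is kept there and replaced by the identity
   elsewhere. *)
pose I z := p <= z <= q.
pose E z w := z = w \/ I z /\ I w.
have uI (h : G) z : h p = p -> h q = q -> I (h z) = I z.
  by move=> hp hq; rewrite /I -{1}hp -{1}hq !order_aut_mono.
have [||||z|g [gk _]] := @order_aut_glue _ X E (fun z => if I z then u z else z)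
    (fun z => if I z then (u^-1)%g z else z).
- by move=> z; left.
- by move=> z w [->|[]]; [left|right].
- by move=> z w v [->//|[zI wI]] [<-|[_ vI]]; right.
- move=> z w v [<-|[/andP[pz _] /andP[_ vq]]] zw wv.
    by left; apply/eqP; rewrite eq_le zw wv.
  have wq := le_trans wv vq.
  by right; split; apply/andP; split=> //; [exact: le_trans wq|exact: le_trans zw].
- have [zI|zI] := boolP (I z).
    exists u => w Ezw; have wI : I w by case: Ezw => [<-|[]].
    have uVp : (u^-1)%g p = p by rewrite -[in LHS]up order_autK.
    have uVq : (u^-1)%g q = q by rewrite -[in LHS]uq order_autK.
    have I1 : I (u w) by rewrite uI.
    have I2 : I ((u^-1)%g w) by rewrite uI.
    by rewrite wI; split=> //; right.
  exists 1%g => w [<-|[]]; last by rewrite (negbTE zI).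
  by rewrite (negbTE zI) invg1; split=> //; left.
have [k kE] := order_aut_join g 1%g.
exists [:: p; q], k; split.
- by move=> b; rewrite !inE => /orP[]/eqP ->.
- split=> [z zD|z zB].
    by rewrite kE gk; case: ifP => _; rewrite ?uD ?maxxx// !inE zD !orbT.
  rewrite kE gk ifF ?maxxx//; apply/negP => /andP[pz zq]; apply: zB.
  by exists p, q; rewrite !inE !eqxx orbT.
- by move=> z; rewrite kE le_max lexx orbT.
- rewrite kE gk le_max /I (ltW px) (ltW (lt_trans xy yq)) /= ux lexx //.
Qed.

Lemma bumps D (l : seq (X * X)) : {in l, forall p, same_cut D p.1 p.2} ->
  exists B g, [/\ disjoint_from D B, hull_supported D B g, forall z, z <= g z &
    {in l, forall p, p.2 <= g p.1}].
Proof.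
elim: l => [|[x y] l IH] lD.
  by exists [::], 1%g; split=> //; exact: hull_supported1.
have [|B [g [BD gB g1 gl]]] := IH; first by move=> p pl; apply: lD; rewrite inE pl orbT.
have [|A [h [AD hA h1 hxy]]] := @bump D x y; first by apply: (lD (x, y)); rewrite mem_head.
have [k kE] := order_aut_join g h.
have [gD gs] : hull_supported D (A ++ B) g.
  by apply: hull_supportedS gB => b bB; rewrite mem_cat bB orbT.
have [hD hs] : hull_supported D (A ++ B) h.
  by apply: hull_supportedS hA => b bA; rewrite mem_cat bA.
exists (A ++ B), k; split.
- by move=> b; rewrite mem_cat => /orP[/AD|/BD].
- split=> z zz; first by rewrite kE gD// hD// maxxx.
  by rewrite kE gs// hs// maxxx.
- by move=> z; rewrite kE le_max g1.
- by move=> p; rewrite inE kE le_max => /predU1P[->|/gl ->//]; rewrite hxy orbT.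
Qed.

(** Density of bounded support in the stabilizer of [D]: invariance under such elements will pass to
    the whole stabilizer. *)
Lemma hull_supported_approx D A g : fixes D g -> exists B h,
  [/\ disjoint_from D B, hull_supported D B h & {in A, h =1 g}].
Proof.
(* The two families of pairs ask for [g a <= t a] and [a <= t (g a)], so that [g a] lies between the
   images of [a] under the inverse of [t] and under [t]. *)
move=> gD; have [|B [t [BD [tD tB] t1 tl]]] :=
    @bumps D ([seq (a, g a) | a <- A] ++ [seq (g a, a) | a <- A]).
  move=> p; rewrite mem_cat => /orP[]/mapP[a _ ->] /=; last exact: same_cut_fixes.
  by rewrite same_cutC; exact: same_cut_fixes.
(* [h] truncates [g] between [t^-1] and [t], in the lattice order of G. *)
have [k kE] := order_aut_meet g t; have [h hE] := order_aut_join k (t^-1)%g.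
have tVD := fixesV tD.
exists B, h; split=> //.
  split=> z zz; first by rewrite hE kE gD// tD// tVD// minxx maxxx.
  rewrite hE kE tB//; have -> : (t^-1)%g z = z by rewrite -{1}(tB z zz) order_autK.
  by rewrite max_r// ge_min lexx orbT.
move=> a aA; have gt : g a <= t a.
  by apply: (tl (a, g a)); rewrite mem_cat map_f.
have tg : a <= t (g a).
  by apply: (tl (g a, a)); rewrite mem_cat map_f ?orbT.
by rewrite hE kE min_l// max_l// -(order_aut_mono t) order_autVK.
Qed.


End ultrahomogeneous_chains.

(** * Compact semitopological semigroups generated by automorphisms *)

Section gliding_hump.
Variables (R : realType) (S : topologicalType) (T : Type) (t1 : T).
Variables (d : S -> S -> R) (Psi : S -> (nat -> T) -> S) (p : nat -> S).
Hypothesis cS : compact [set: S].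
Hypothesis dP : continuous_pseudometric d.
Hypothesis Psi_continuous : forall f, continuous (Psi^~ f).
Hypothesis Psi_local : forall s f e, closure (range p) s -> 0 < e ->
  exists N, forall f', (forall m, (m < N)%N -> f' m = f m) ->
    d (Psi s f) (Psi s f') < e.

Definition update (f : nat -> T) n v m := if m == n then v else f m.

Let near_lim (I : Type) (U : set_system I) (q : I -> S) (s : S) (f : nat -> T) e :
  UltraFilter U -> q @ U --> s -> 0 < e ->
  \forall i \near U, d (Psi (q i) f) (Psi s f) < e.
Proof.
move=> UU qs e0.
have H : (fun i => Psi (q i) f) @ U --> Psi s f.
  have K : {for s, continuous (Psi^~ f)} by exact: Psi_continuous.
  exact: (@continuous_cvg _ _ _ U _ q (Psi^~ f) s K qs).
have /H : \forall y \near Psi s f, d (Psi s f) y < e by exact: (cpm_cont dP).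
by apply: (@filterS _ U) => i /=; rewrite (cpm_sym dP).
Qed.

(* Otherwise one builds [n_0 < n_1 < ...] and [F], the limit of the [f i], such
   that [Psi (p (n i)) F] stays away from [Psi e F], where [e] is the limit of
   [p] along a free ultrafilter, while [Psi (p (n i)) (f j)] is close to
   [Psi e (f j)] for [j <= i]: the two iterated limits would differ. *)
Lemma gliding_hump : exists n f, f n = t1 /\
  forall v, d (Psi (p n) f) (Psi (p n) (update f n v)) <= 1.
Proof.
apply: contrapT => Hn.
have {}Hn n f : f n = t1 ->
    exists v, 1 < d (Psi (p n) f) (Psi (p n) (update f n v)).
  move=> fn; apply: contrapT => H; apply: Hn; exists n, f; split=> // v.
  by rewrite leNgt; apply/negP => dv; apply: H; exists v.
have [U [UU Ufree]] := free_ultrafilter.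
have pP n : closure (range p) (p n) by apply: subset_closure; exists n.
have lim_closure (q : nat -> nat) e : (p \o q) @ U --> e -> closure (range p) e.
  move=> qe; apply: (closure_ultra_cvg UU _ qe).
  by apply: nearW => n; exists (q n).
have [e pe] := compact_ultra_cvg p UU cS.
have eP : closure (range p) e by exact: (lim_closure id).
(* A state is a family equal to [t1] from some index on, that index, and the set, large for [U], of
   indices still allowed. *)
pose valid (st : (nat -> T) * nat * set nat) :=
  (forall m, (st.1.2 <= m)%N -> st.1.1 m = t1) /\ U st.2.
pose step (st st' : {st | valid st}) :=
  let: (f, M, Q) := sval st in let: (f', M', Q') := sval st' in
  exists n, [/\ Q n, (M <= n < M')%N, (forall m, (m < M)%N -> f' m = f m),
    2^-1 <= d (Psi (p n) f') (Psi e f) &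
    [/\ forall f'', (forall m, (m < M')%N -> f'' m = f' m) ->
        d (Psi (p n) f') (Psi (p n) f'') < 4^-1, Q' `<=` Q &
      forall m, Q' m -> d (Psi (p m) f') (Psi e f') < M'.+1%:R^-1]].
have stepP st : {st' | step st st'}.
  apply: cid; case: st => -[[f M] Q] [/= fM UQ].
  have [n [Qn Mn]] : exists n, Q n /\ (M <= n)%N.
    by have [n []] := filter_ex (filterI UQ (Ufree M)); exists n.
  (* [f] and its update at [n] have images more than 1 apart, so one of them is at distance at least
     1/2 from [Psi e f]; the choice [t1] means keeping [f]. *)
  have [v' dv'] : exists v', 2^-1 <= d (Psi (p n) (update f n v')) (Psi e f).
    have [v dv] := Hn n f (fM _ Mn).
    have fE : update f n t1 = f.
      by apply/funext => m; rewrite /update; case: eqP => // ->; rewrite fM.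
    have [?|dv1] := leP 2^-1 (d (Psi (p n) f) (Psi e f)); first by exists t1; rewrite fE.
    exists v; have := cpm_triangle dP (Psi e f) (Psi (p n) f) (Psi (p n) (update f n v)).
    rewrite [d (Psi e f) _](cpm_sym dP); lra.
  set f' := update f n v' in dv'.
  have c4 : 0 < 4^-1 :> R by rewrite invr_gt0.
  have [N NP] := Psi_local f' (pP n) c4.
  pose M' := maxn n.+1 N.
  pose Q' := Q `&` [set m | d (Psi (p m) f') (Psi e f') < M'.+1%:R^-1].
  have vst : valid (f', M', Q').
    split=> /= [m|]; last by apply: filterI => //; apply: near_lim.
    by rewrite geq_max => /andP[nm _]; rewrite /f' /update gtn_eqF// fM// (leq_trans Mn)// ltnW.
  exists (exist _ _ vst); exists n; split=> //.
  - by rewrite Mn leq_max leqnn.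
  - by move=> m mM; rewrite /f' /update ltn_eqF// (leq_trans mM).
  - split; [|exact: subIsetl|by move=> m []].
    by move=> f'' f''E; apply: NP => m mN; apply: f''E; rewrite leq_max mN orbT.
have v0 : valid ((fun=> t1), 0%N, setT) by split=> //; exact: filterT.
have [st [_ stS]] := dependent_choice stepP (exist _ _ v0).
pose f i := (sval (st i)).1.1; pose M i := (sval (st i)).1.2; pose Q i := (sval (st i)).2.
have {}stS i : {n | [/\ Q i n, (M i <= n < M i.+1)%N,
    (forall m, (m < M i)%N -> f i.+1 m = f i m),
    2^-1 <= d (Psi (p n) (f i.+1)) (Psi e (f i)) &
    [/\ forall f'', (forall m, (m < M i.+1)%N -> f'' m = f i.+1 m) ->
        d (Psi (p n) (f i.+1)) (Psi (p n) f'') < 4^-1, Q i.+1 `<=` Q i &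
      forall m, Q i.+1 m -> d (Psi (p m) (f i.+1)) (Psi e (f i.+1)) < (M i.+1).+1%:R^-1]]}.
  apply: cid; have := stS i; rewrite /step /f /M /Q.
  by case: (sval (st i)) => -[? ?] ?; case: (sval (st i.+1)) => -[? ?] ?.
pose n i := sval (stS i).
have nP i := svalP (stS i).
have Mi i : (i <= M i)%N.
  elim: i => // i IH; have [_ /andP[Mn nM] _ _ _] := nP i.
  exact: (leq_ltn_trans IH (leq_ltn_trans Mn nM)).
have Mmono i j : (i <= j)%N -> (M i <= M j)%N.
  move=> /subnK <-; elim: (j - i)%N => // k IH; rewrite addSn.
  have [_ /andP[Mn nM] _ _ _] := nP (k + i)%N.
  exact: (leq_trans IH (ltnW (leq_ltn_trans Mn nM))).
have Qmono i j : (i <= j)%N -> Q j `<=` Q i.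
  move=> /subnK <-; elim: (j - i)%N => // k IH; rewrite addSn.
  by have [_ _ _ _ [_ QS _]] := nP (k + i)%N; exact: subset_trans QS IH.
have fstab i j m : (i <= j)%N -> (m < M i)%N -> f j m = f i m.
  move=> /subnK <- mi; elim: (j - i)%N => // k IH; rewrite addSn.
  have [_ _ fE _ _] := nP (k + i)%N; rewrite fE//.
  by rewrite (leq_trans mi)// Mmono// leq_addl.
(* Since [i <= M i], coordinate [m] is frozen from stage [m.+1] on. *)
pose F m := f m.+1 m.
have FE i m : (m < M i)%N -> F m = f i m.
  move=> mi; rewrite /F; have [im|mi'] := leqP i m.+1; first exact: fstab.
  by rewrite (@fstab m.+1 i m (ltnW mi') (Mi _)).
have d1 i : 4^-1 < d (Psi (p (n i)) F) (Psi e (f i)).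
  have [_ _ _ d1 [d2 _ _]] := nP i.
  have {}d2 := d2 F (fun m mi => FE i.+1 m mi).
  have := cpm_triangle dP (Psi (p (n i)) F) (Psi (p (n i)) (f i.+1)) (Psi e (f i)).
  rewrite -/(n i) in d1 d2 *; lra.
have local s k : closure (range p) s -> 0 < k -> exists N, forall i, (N <= i)%N ->
    d (Psi s F) (Psi s (f i)) < k.
  move=> sP k0; have [N NP] := Psi_local F sP k0; exists N => i Ni; apply: NP => m mN.
  by rewrite (@FE i)// (leq_trans mN)// (leq_trans Ni).
have [e' pe'] := compact_ultra_cvg (p \o n) UU cS.
have e'P := lim_closure _ _ pe'.
(* For [i > j] the index [n i] lies in [Q j.+1], so the second limit [e'], along the chosen indices,
   acts on [f j.+1] almost as [e] does. *)
have d2 j : d (Psi e' (f j.+1)) (Psi e (f j.+1)) <= (M j.+1).+1%:R^-1.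
  apply/ler_addgt0Pr => k k0.
  have [i [di ji]] := filter_ex (filterI (near_lim (f j.+1) UU pe' k0) (Ufree j.+1)).
  have Qi : Q j.+1 (n i) by apply: (Qmono _ i) => //; have [] := nP i.
  have [_ _ _ _ [_ _ /(_ _ Qi) d3]] := nP j.
  have := cpm_triangle dP (Psi (p (n i)) (f j.+1)) (Psi e' (f j.+1)) (Psi e (f j.+1)).
  rewrite [d (Psi e' _) (Psi (p _) _)](cpm_sym dP) => t0.
  by apply: le_trans t0 _; rewrite addrC; exact: lerD (ltW d3) (ltW di).
(* Five errors of at most 1/32 will join [Psi (p (n i)) F] to [Psi e (f i)], against the lower bound
   1/4 of [d1]. *)
have c16 : 0 < 32^-1 :> R by rewrite invr_gt0.
have [N1 N1P] := local e _ eP c16; have [N2 N2P] := local e' _ e'P c16.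
pose j := maxn 32 (maxn N1 N2).
have [i [di ji]] := filter_ex (filterI (near_lim F UU pe' c16) (Ufree j)).
have j32 : (M j.+1).+1%:R^-1 <= 32^-1 :> R.
  rewrite lef_pV2 ?posrE// ler_nat (leq_trans _ (leqW (Mi j.+1)))//.
  by rewrite leqW// leq_maxl.
have a1 := d1 i; have a2 := le_trans (d2 j) j32.
have a3 : d (Psi e F) (Psi e (f i)) < 32^-1.
  by apply: N1P; rewrite (leq_trans _ ji)// /j !leq_max leqnn orbT.
have a4 : d (Psi e F) (Psi e (f j.+1)) < 32^-1.
  by apply: N1P; rewrite leqW// /j !leq_max leqnn orbT.
have a5 : d (Psi e' F) (Psi e' (f j.+1)) < 32^-1.
  by apply: N2P; rewrite leqW// /j !leq_max leqnn !orbT.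
have t1' := cpm_triangle dP (Psi e' F) (Psi (p (n i)) F) (Psi e (f i)).
have t2' := cpm_triangle dP (Psi e' (f j.+1)) (Psi e' F) (Psi e (f i)).
have t3' := cpm_triangle dP (Psi e (f j.+1)) (Psi e' (f j.+1)) (Psi e (f i)).
have t4' := cpm_triangle dP (Psi e F) (Psi e (f j.+1)) (Psi e (f i)).
rewrite [d (Psi e (f j.+1)) (Psi e F)](cpm_sym dP) in t4'.
have {}di : d (Psi (p (n i)) F) (Psi e' F) < 32^-1 by exact: di.
clear -a1 a2 a3 a4 a5 t1' t2' t3' t4' di; lra.
Qed.

End gliding_hump.

(** * Fixed points of stabilizers in a compact semitopological semigroup *)

Section order_aut_semigroups.
Variable R : realType.
Context {d : Order.disp_t} (X : orderType d).
Hypotheses (Xinf : infinite_set [set: X]) (Xuh : ultrahomogeneous X).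
Local Notation G := (order_aut X).
Implicit Types (g h v : G) (A B D E F : seq X) (x y : X).

(* Continuity at the identity for the permutation topology. *)
Definition continuous_at_one (S : topologicalType) (phi : G -> S) :=
  forall N, nbhs (phi 1%g) N -> exists A, forall g, fixes A g -> N (phi g).

Section representation.
Variables (S : topologicalType) (mul : S -> S -> S) (phi : G -> S).
Hypotheses (chS : compact_hausdorff S) (mulP : semitopological_semigroup mul).
Hypothesis phiM : {morph phi : g h / (g * h)%g >-> mul g h}.
Hypothesis phi1 : continuous_at_one phi.
Local Notation "s ** t" := (mul s t) (at level 40, left associativity).
Implicit Types s t z : S.

Let mulA : associative mul := semitop_mulA mulP.
Let contl : forall a, continuous (mul a) := semitop_mul_continuousl mulP.
Let contr : forall a, continuous (mul^~ a) := semitop_mul_continuousr mulP.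

Definition stab_closure D : set S := closure (phi @` fixes D).

Lemma stab_closure_phi D g : fixes D g -> stab_closure D (phi g).
Proof. by move=> gD; apply: subset_closure; exists g. Qed.

Lemma stab_closureS D E : {subset D <= E} -> stab_closure E `<=` stab_closure D.
Proof. by move=> DE; apply: closure_subset => _ [g /(fixesS DE) gD <-]; exists g. Qed.

Lemma stab_closureM D s t : stab_closure D s -> stab_closure D t ->
  stab_closure D (s ** t).
Proof.
move=> sD tD; apply: (closure_map (h := mul s) (@contl s) _ tD) => _ [g gD <-].
apply: (closure_map (h := mul^~ (phi g)) (@contr (phi g)) _ sD) => _ [h hD <-].
by rewrite /= -phiM; apply: stab_closure_phi; exact: fixesM.
Qed.

Lemma eq_on_stab_closure D (h1 h2 : S -> S) : continuous h1 -> continuous h2 ->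
  (forall g, fixes D g -> h1 (phi g) = h2 (phi g)) ->
  forall s, stab_closure D s -> h1 s = h2 s.
Proof.
move=> c1 c2 e12 s /mem_set; apply: (eq_on_closure chS.2 c1 c2).
by move=> _ /set_mem[g gD <-]; exact: e12.
Qed.

Lemma mul_phi1 D s : stab_closure D s -> s ** phi 1%g = s.
Proof.
apply: (@eq_on_stab_closure D (mul^~ (phi 1%g)) id) => [|x|g _].
- exact: contr.
- exact: cvg_id.
- by rewrite -phiM mulg1.
Qed.

(** In the gliding hump the letters are the elements supported on the hull of [B] and the words are
    their infinite products; by [glued_update], changing a letter is acting by [phi v], whence a
    bound uniform in [v]. *)
Lemma almost_fixed D B (e : S -> S -> R) : continuous_pseudometric e ->
  disjoint_from D B -> exists s, stab_closure D s /\
    forall v, hull_supported D B v -> e s (phi v ** s) <= 1.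
Proof.
move=> eP BD; have [t tD tB] := hull_push Xinf Xuh BD.
pose T := {v | hull_supported D B v}.
pose t1 : T := exist _ 1%g (hull_supported1 D B).
have Yex (f : nat -> T) : {g | glued D B t (fun n => sval (f n)) g}.
  by apply: cid; apply: glued_exists => // n; exact: svalP.
pose Y f := sval (Yex f); have YP f : glued D B t _ (Y f) := svalP (Yex f).
have YD f : fixes D (Y f) by apply: (glued_fixes tD _ (YP f)) => n; exact: svalP.
pose Psi s f := s ** phi (Y f); pose p n := phi ((t ^+ n)^-1)%g.
have pD s : closure (range p) s -> stab_closure D s.
  apply: closure_subset => _ [n _ <-]; exists ((t ^+ n)^-1)%g => //.
  exact/fixesV/fixesX.
have Psi_local s f k : closure (range p) s -> 0 < k ->
    exists N, forall f', (forall m, (m < N)%N -> f' m = f m) ->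
      e (Psi s f) (Psi s f') < k.
  move=> /pD sD k0.
  have near1 : nbhs (phi 1%g) [set r | e (Psi s f) (Psi s f ** r) < k].
    have H : nbhs (Psi s f ** phi 1%g) [set r | e (Psi s f) r < k].
      rewrite (@mul_phi1 D); first exact: (cpm_cont eP).
      by apply: stab_closureM => //; exact: stab_closure_phi.
    exact: (@contl _ _ _ H).
  have [A AP] := phi1 near1.
  (* Each point of [A] lies in at most one cell, so beyond some [N] no factor of the product moves a
     point of [A]. *)
  have [N NP] : exists N, forall a, a \in A -> forall n, cell D B t n a -> (n < N)%N.
    elim: A {AP} => [|a A [N NP]]; first by exists 0%N.
    have [[m am]|na] := pselect (exists m, cell D B t m a).
      exists (maxn m.+1 N) => b; rewrite inE => /predU1P[-> n an|bA n bn].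
        by rewrite (cell_inj tD tB an am) leq_max leqnn.
      by rewrite leq_max (NP b bA n bn) orbT.
    exists N => b; rewrite inE => /predU1P[-> n an|bA]; last exact: NP.
    by case: na; exists n.
  exists N => f' ff'.
  have <- : Psi s f ** phi ((Y f)^-1 * Y f')%g = Psi s f'.
    by rewrite /Psi -mulA -phiM mulgA mulgV mul1g.
  apply: AP => a aA; rewrite order_autM.
  rewrite (glued_agree (YP f') (YP f)) ?order_autK// => n an.
  by rewrite ff'//; exact: NP an.
have Psi_continuous f : continuous (Psi^~ f) by exact: contr.
have [n [f [fn fP]]] := gliding_hump t1 chS.1 eP Psi_continuous Psi_local.
exists (Psi (p n) f); split.
  by rewrite /Psi -phiM; apply/stab_closure_phi/fixesM => //; exact/fixesV/fixesX.
move=> v vP; have := fP (exist _ v vP); congr (_ <= _); congr (e _ _).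
rewrite /Psi -!phiM; congr phi.
rewrite (glued_update tD tB _ _ (YP f) (YP _) (n := n)) ?fn//.
- by rewrite /update eqxx.
- by move=> m; exact: svalP.
- exact: svalP.
- by move=> m mn; rewrite /update (negbTE mn).
Qed.

Lemma stabilizer_fixed_point D : exists z, stab_closure D z /\
  forall v, fixes D v -> phi v ** z = z.
Proof.
pose I := [set i : seq X * (S -> S -> R) |
  disjoint_from D i.1 /\ continuous_pseudometric i.2].
pose Z (i : seq X * (S -> S -> R)) := [set s | stab_closure D s /\
  forall v, hull_supported D i.1 v -> i.2 s (phi v ** s) <= 1].
have cst0 : continuous_pseudometric (fun _ _ : S => 0 : R).
  by split=> [//|? ? ?|? ? ?]; [rewrite addr0|exact: nearW].
have ZF : ProperFilter (filter_from I Z).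
  apply: filter_from_proper => [|[B e] [/= BD eP]]; last first.
    by have [s] := almost_fixed eP BD; exists s.
  apply: filter_from_filter; first by exists ([::], fun _ _ => 0).
  (* The conditions are directed: concatenated supports and added pseudometrics imply both. *)
  move=> [B e] [A e'] [/= BD eP] [/= AD eP'].
  exists (B ++ A, fun r s : S => e r s + e' r s).
    split=> /= [b|]; last exact: cpmD.
    by rewrite mem_cat => /orP[/BD|/AD].
  move=> s [sD /= sv]; split; split=> //= v vS.
  - apply: le_trans (sv v _); first by rewrite lerDl (cpm_ge0 eP').
    by apply: hull_supportedS vS => b bB; rewrite mem_cat bB.
  - apply: le_trans (sv v _); first by rewrite lerDr (cpm_ge0 eP).
    by apply: hull_supportedS vS => b bB; rewrite mem_cat bB orbT.
have [U [UU ZU]] := ultraFilterLemma ZF.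
have [z Uz] := compact_ultra_cvg id UU chS.1.
have UZ i : I i -> U (Z i) by move=> Ii; apply: ZU; exists i.
have zD : stab_closure D z.
  apply: (@closed_closure _ (phi @` fixes D)).
  apply: (closure_ultra_cvg UU _ Uz).
  by apply: filterS (UZ ([::], fun _ _ => 0) _) => // s [].
exists z; split=> // v vD.
(* The path from [z] to [phi w ** z] through [s] and [phi w ** s] has three steps of length at most
   1, which contradicts a separation larger than 3. *)
have hullz B w : disjoint_from D B -> hull_supported D B w -> phi w ** z = z.
  move=> BD wB; apply: contrapT => wz.
  have [e eP] := cpm_separates (3 : R) chS (nesym wz).
  have e1 : U [set s | e z s < 1].
    by apply: (Uz [set s | e z s < 1]); exact: (cpm_cont eP).
  have e2 : U [set s | e (phi w ** z) (phi w ** s) < 1].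
    have H : nbhs (phi w ** z) [set y | e (phi w ** z) y < 1].
      exact: (cpm_cont eP).
    exact: (Uz _ (@contl (phi w) z _ H)).
  have [s [[/= s1 s2] [_ /(_ _ wB) /= s3]]] :=
    filter_ex (filterI (filterI e1 e2) (UZ (B, e) (conj BD eP))).
  have := cpm_triangle eP s z (phi w ** z).
  have := cpm_triangle eP (phi w ** s) s (phi w ** z).
  rewrite [e _ (phi w ** z)](cpm_sym eP) in s2 *.
  rewrite [e (phi w ** s) _](cpm_sym eP); lra.
(* The elements fixing [z] form a closed condition, and by density of bounded support their images
   accumulate at [phi v]. *)
pose P := phi @` [set w | phi w ** z = z].
suff /mem_set vP : closure P (phi v).
  apply: (@eq_on_closure _ _ (mul^~ z) (fun=> z) P chS.2 (@contr z) _ _ _ vP).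
    by move=> x; exact: cvg_cst.
  by move=> _ /set_mem[w wz <-].
move=> N vN.
have : nbhs (phi 1%g) [set r | N (phi v ** r)].
  by apply: (@contl (phi v) _ N); rewrite -phiM mulg1.
move=> /phi1[A AN].
have [B [h [BD hB hv]]] := hull_supported_approx Xinf Xuh A vD.
exists (phi h); split; first by exists h => //; exact: hullz hB.
rewrite (_ : phi h = phi v ** phi (v^-1 * h)%g).
  by apply: AN => a aA; rewrite order_autM hv// order_autK.
by rewrite -phiM mulgA mulgV mul1g.
Qed.

End representation.
End order_aut_semigroups.

(** * Zeros of the closures of stabilizers *)

Section zeros.
Variable R : realType.
Context {d : Order.disp_t} (X : orderType d).
Hypotheses (Xinf : infinite_set [set: X]) (Xuh : ultrahomogeneous X).
Local Notation G := (order_aut X).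
Implicit Types (g h v : G) (A B D E F : seq X) (x y : X).

Record semigroup_rep (S : topologicalType) (mul : S -> S -> S) (phi : G -> S)
    : Prop := SemigroupRep {
  rep_compact : compact_hausdorff S;
  rep_semitop : semitopological_semigroup mul;
  rep_morph : {morph phi : g h / (g * h)%g >-> mul g h};
  rep_one : continuous_at_one phi }.

(** Reversing products and inverting group elements preserves the setting, so each one-sided result
    also holds on the other side. Continuity at the identity survives because stabilizers are closed
    under inverses. *)
Lemma semigroup_rep_op (S : topologicalType) (mul : S -> S -> S) (phi : G -> S) :
  semigroup_rep mul phi -> semigroup_rep (fun s t => mul t s) (phi \o (fun g => g^-1)%g).
Proof.
move=> [cS [mA ml mr] pM p1]; split=> //.
- by split=> [x y z|a|a]; [rewrite mA|exact: mr|exact: ml].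
- by move=> g h /=; rewrite invgM pM.
- move=> N /=; rewrite invg1 => /p1[A AN]; exists A => g gA.
  exact/AN/fixesV.
Qed.

Definition is_zero (S : topologicalType) (mul : S -> S -> S) (phi : G -> S) D e :=
  stab_closure phi D e /\
  forall v, fixes D v -> mul (phi v) e = e /\ mul e (phi v) = e.

Lemma stab_closure_op (S : topologicalType) (phi : G -> S) D :
  stab_closure (phi \o (fun g => g^-1)%g) D = stab_closure phi D.
Proof.
congr closure; apply/seteqP; split=> _ [g /fixesV gD <-]; exists (g^-1)%g => //=.
by rewrite invgK.
Qed.

Lemma is_zero_op (S : topologicalType) (mul : S -> S -> S) (phi : G -> S) D e :
  is_zero mul phi D e -> is_zero (fun s t => mul t s) (phi \o (fun g => g^-1)%g) D e.
Proof.
move=> [eD e0]; split; first by rewrite stab_closure_op.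
by move=> v /fixesV/e0[].
Qed.

(** A point fixed from the left and one fixed from the right have a product equal to each of them,
    so they coincide. *)
Lemma zero_exists (S : topologicalType) (mul : S -> S -> S) (phi : G -> S) D :
  semigroup_rep mul phi -> exists e, is_zero mul phi D e.
Proof.
move=> rP; have [cS mP pM p1] := rP; have [cS' mP' pM' p1'] := semigroup_rep_op rP.
have [z [zD zl]] := stabilizer_fixed_point R Xinf Xuh cS mP pM p1 D.
have [z' [z'D zr]] := stabilizer_fixed_point R Xinf Xuh cS' mP' pM' p1' D.
rewrite stab_closure_op in z'D.
have zr' v : fixes D v -> mul z' (phi v) = z'.
  by move=> /fixesV/zr /=; rewrite invgK.
have e1 : mul z' z = z.
  apply: (eq_on_stab_closure cS (h1 := mul^~ z) (h2 := fun=> z) _ _ zl z'D).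
    exact: (semitop_mul_continuousr mP).
  by move=> x; exact: cvg_cst.
have e2 : mul z' z = z'.
  apply: (eq_on_stab_closure cS (h1 := mul z') (h2 := fun=> z') _ _ zr' zD).
    exact: (semitop_mul_continuousl mP).
  by move=> x; exact: cvg_cst.
have zz' : z' = z by rewrite -e2 e1.
by exists z; split=> // v vD; split; [exact: zl|rewrite -zz'; exact: zr'].
Qed.

Section products.
Variables (S : topologicalType) (mul : S -> S -> S) (phi : G -> S).
Hypothesis rP : semigroup_rep mul phi.
Local Notation "s ** t" := (mul s t) (at level 40, left associativity).
Local Notation is_zero := (is_zero mul phi).
Local Notation stab_closure := (stab_closure phi).
Implicit Types s t e : S.

Let cS := rep_compact rP.
Let mP := rep_semitop rP.
Let mulA : associative mul := semitop_mulA mP.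
Let contl : forall a, continuous (mul a) := semitop_mul_continuousl mP.
Let contr : forall a, continuous (mul^~ a) := semitop_mul_continuousr mP.
Let phiM := rep_morph rP.

Lemma zero_mull D e s : is_zero D e -> stab_closure D s -> e ** s = e.
Proof.
move=> [_ e0]; apply: (eq_on_stab_closure cS (h1 := mul e) (h2 := fun=> e)).
- exact: contl.
- by move=> x; exact: cvg_cst.
- by move=> g /e0[].
Qed.

Lemma zero_mulr D e s : is_zero D e -> stab_closure D s -> s ** e = e.
Proof.
move=> [_ e0]; apply: (eq_on_stab_closure cS (h1 := mul^~ e) (h2 := fun=> e)).
- exact: contr.
- by move=> x; exact: cvg_cst.
- by move=> g /e0[].
Qed.

Lemma zero_unique D e e' : is_zero D e -> is_zero D e' -> e = e'.
Proof.
by move=> e0 e0'; rewrite -(zero_mull e0 (proj1 e0')) (zero_mulr e0' (proj1 e0)).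
Qed.

Lemma zero_perm D E e : D =i E -> is_zero D e -> is_zero E e.
Proof.
move=> DE [eD e0]; split; first by apply: stab_closureS eD => x; rewrite DE.
by move=> v vE; apply: e0 => x; rewrite DE; exact: vE.
Qed.

(* Multiplication by an [h] moving [b] far to the right inside its cut over [D]
   does not change [ea ** phi g ** phi h ** eb], whatever [g] in the stabilizer
   of [D]; passing to the limit in [h] and then in [g] makes it the zero. *)
Lemma zero_mul_lt D a b ea eb e : (a < b)%O -> a \notin D -> b \notin D ->
  is_zero (a :: D) ea -> is_zero (b :: D) eb -> is_zero D e -> ea ** eb = e.
Proof.
move=> ab aD bD Zea Zeb Ze.
(* One limit in [h] has to serve all [g]; the sets [H g] are directed because the meet of [g] and
   [g'] lies below both. *)
pose H g := [set h | fixes D h /\ (a < g (h b))%O].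
have FF : ProperFilter (filter_from (fixes D) H).
  apply: filter_from_proper => [|g gD].
    apply: filter_from_filter; first by exists 1%g; exact: fixes1.
    move=> g g' gD gD'; have [k kE] := order_aut_meet g g'.
    exists k => [x xD|h [hD]]; first by rewrite kE gD// gD'// minxx.
    by rewrite kE lt_min => /andP[]; split.
  (* If [a] and [b] share a cut, [h] pushes [b] above the preimage of [a] under [g]; otherwise the
     order of the two cuts is preserved by [g] and the identity suffices. *)
  have [Dab|Dab] := boolP (same_cut D a b).
    have [|h hD hb] := push_above Xinf Xuh (y := (g^-1 a)%g) bD.
      rewrite same_cutC; apply: same_cut_trans Dab; apply: same_cut_fixes.
      exact: fixesV.
    by exists h; split=> //; rewrite -(order_autVK g a) order_aut_lt.
  exists 1%g; split; first exact: fixes1.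
  apply: (same_cut_lt (D := D) (same_cutxx D a) _ Dab ab).
  by rewrite same_cutC; exact: same_cut_fixes.
have [U [UU HU]] := ultraFilterLemma FF.
have [t Ut] := compact_ultra_cvg (fun h => phi h ** eb) UU cS.1.
have subD x : {subset D <= x :: D} by move=> y; rewrite inE orbC => ->.
have tD : stab_closure D t.
  apply: (@closed_closure _ (phi @` fixes D)); apply: (closure_ultra_cvg UU _ Ut).
  apply: (@filterS _ U _ (H 1%g)) => [h [hD _]|].
    apply: stab_closureM => //; first exact: stab_closure_phi.
    exact: stab_closureS (subD b) _ (proj1 Zeb).
  by apply: HU; exists 1%g => //; exact: fixes1.
have eat g : fixes D g -> ea ** phi g ** t = ea ** eb.
  move=> gD; apply: (cvg_unique cS.2 (F := (fun h => ea ** phi g ** (phi h ** eb)) @ U)).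
    exact: continuous_cvgP (@contl (ea ** phi g)) Ut.
  have UH : U (H g) by apply: HU; exists g.
  apply: cvg_near_cst; apply: filterS UH => h [hD hb].
  (* [b] and [g (h b)] are both above [a] and in one cut over [D], so [g * h] factors as [v] fixing
     [a :: D] times an element fixing [b :: D]; the two zeros absorb these factors. *)
  have [|v vD vb] := @same_cut_orbit _ _ Xuh (a :: D) b (g (h b)).
    apply/same_cutP => c; rewrite inE => /predU1P[->|cD].
      by rewrite ab hb (lt_gtF ab) (lt_gtF hb).
    have /same_cutP : same_cut D b (g (h b)); last exact.
    by rewrite same_cutC -order_autM; apply: same_cut_fixes; exact: fixesM.
  have kD : fixes (b :: D) (v^-1 * (g * h))%g.
    move=> x; rewrite inE => /predU1P[->|xD]; first by rewrite 2!order_autM -vb order_autK.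
    apply: (fixesM (D := D)) => //; last exact: fixesM.
    by apply: fixesV => y yD; apply: vD; exact: subD.
  have -> : ea ** phi g ** (phi h ** eb) = (ea ** phi v) ** (phi (v^-1 * (g * h))%g ** eb).
    by rewrite !mulA -!mulA; congr (_ ** _); rewrite !mulA -!phiM !mulgA mulgV mul1g.
  by rewrite (proj2 (proj2 Zea v vD)) (proj1 (proj2 Zeb _ kD)).
have <- : ea ** e ** t = ea ** eb.
  apply: (eq_on_stab_closure cS (h1 := fun s => ea ** s ** t) (h2 := fun=> ea ** eb)
    _ _ eat (proj1 Ze)) => [x|x]; last exact: cvg_cst.
  apply: (@continuous_cvgP _ _ _ (nbhs x) (mul ea) (mul^~ t)); first exact: contr.
  exact: contl.
rewrite -mulA (zero_mull Ze tD); apply: (zero_mulr Ze).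
exact: stab_closureS (subD a) _ (proj1 Zea).
Qed.

End products.

End zeros.

(** * Products of zeros and the dependence on matrix entries *)

Section zero_products.
Variable R : realType.
Context {d : Order.disp_t} (X : orderType d).
Hypotheses (Xinf : infinite_set [set: X]) (Xuh : ultrahomogeneous X).
Variables (S : topologicalType) (mul : S -> S -> S) (phi : order_aut X -> S).
Hypothesis rP : semigroup_rep mul phi.
Variable z : seq X -> S.
Hypothesis zP : forall D, is_zero mul phi D (z D).
Local Notation G := (order_aut X).
Local Notation "s ** t" := (mul s t) (at level 40, left associativity).
Implicit Types (g h v : G) (A B D E F : seq X) (x y : X) (s t : S).

Let cS := rep_compact rP.
Let mP := rep_semitop rP.
Let mulA : associative mul := semitop_mulA mP.
Let contl : forall a, continuous (mul a) := semitop_mul_continuousl mP.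
Let contr : forall a, continuous (mul^~ a) := semitop_mul_continuousr mP.
Let phiM := rep_morph rP.

Lemma zero_eq A B : A =i B -> z A = z B.
Proof. by move=> AB; apply: (zero_unique rP (zero_perm AB (zP A)) (zP B)). Qed.

Lemma zero_mul_sub A B : {subset A <= B} -> z A ** z B = z A.
Proof.
by move=> AB; apply: (zero_mull rP (zP A)); exact: stab_closureS AB _ (proj1 (zP B)).
Qed.

Lemma zero_mul_sup A B : {subset A <= B} -> z B ** z A = z A.
Proof.
by move=> AB; apply: (zero_mulr rP (zP A)); exact: stab_closureS AB _ (proj1 (zP B)).
Qed.

Lemma zero_mul_points D a b : a != b -> a \notin D -> b \notin D ->
  z (a :: D) ** z (b :: D) = z D.
Proof.
move=> ab aD bD; have [lt|lt|E] := ltgtP a b; last by rewrite E eqxx in ab.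
  exact: (zero_mul_lt Xinf Xuh rP lt aD bD (zP _) (zP _) (zP _)).
(* The opposite semigroup reads the product backwards, which exchanges the roles of [a] and [b]. *)
exact: (zero_mul_lt Xinf Xuh (semigroup_rep_op rP) lt bD aD
  (is_zero_op (zP _)) (is_zero_op (zP _)) (is_zero_op (zP _))).
Qed.

(** The points of [B] are removed one at a time: inserting the zero of [a :: B ++ D] after that of
    [a :: D] exposes a product of the type [zero_mul_points]. *)
Lemma zero_mul_point D B a : a \notin B -> a \notin D ->
  z (a :: D) ** z (B ++ D) = z D.
Proof.
elim: B => [|b B IH] /=.
  by move=> _ _; apply: zero_mul_sup => x xD; rewrite inE xD orbT.
rewrite inE negb_or => /andP[ab aB] aD.
have [bE|bE] := boolP (b \in B ++ D).
  rewrite -IH//; congr (_ ** _); apply: zero_eq => x.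
  by rewrite inE; case: eqP => // ->; rewrite bE.
have -> : z (a :: D) = z (a :: D) ** z (a :: B ++ D).
  rewrite zero_mul_sub// => x; rewrite !inE mem_cat => /orP[->//|->].
  by rewrite !orbT.
by rewrite -mulA zero_mul_points ?IH// mem_cat negb_or aB.
Qed.

Lemma zero_mul_disjoint D A B : {in A, forall a, a \notin B ++ D} ->
  z (A ++ D) ** z (B ++ D) = z D.
Proof.
elim: A => [|a A IH] AB /=.
  by apply: zero_mul_sub => x xD; rewrite mem_cat xD orbT.
have {}IH : z (A ++ D) ** z (B ++ D) = z D.
  by apply: IH => x xA; apply: AB; rewrite inE xA orbT.
have [aE|aE] := boolP (a \in A ++ D).
  rewrite -[RHS]IH; congr (_ ** _); apply: zero_eq => x.
  by rewrite inE; case: eqP => // ->; rewrite aE.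
have -> : z (B ++ D) = z (B ++ (A ++ D)) ** z (B ++ D).
  rewrite zero_mul_sup// => x; rewrite !mem_cat => /orP[->//|->].
  by rewrite !orbT.
rewrite mulA zero_mul_point//.
by have := AB a (mem_head _ _); rewrite mem_cat negb_or => /andP[].
Qed.

Lemma zero_mulE A B : z A ** z B = z [seq x <- A | x \in B].
Proof.
pose D := [seq x <- A | x \in B].
have -> : z A = z ([seq x <- A | x \notin B] ++ D).
  apply: zero_eq => x; rewrite mem_cat !mem_filter.
  by case: (x \in B); rewrite ?orbF.
have -> : z B = z (B ++ D).
  by apply: zero_eq => x; rewrite mem_cat mem_filter; case: (x \in B).
apply: zero_mul_disjoint => x; rewrite mem_filter => /andP[xB _].
by rewrite mem_cat mem_filter (negbTE xB).
Qed.

(** Conjugation carries the stabilizer of [F] to that of its image, and zeros are unique. *)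
Lemma zero_conj g F : phi g ** z F = z (map g F) ** phi g.
Proof.
have zg : is_zero mul phi (map g F) (phi g ** z F ** phi (g^-1)%g).
  have c : continuous (fun s => phi g ** s ** phi (g^-1)%g).
    move=> s; apply: (@continuous_cvgP _ _ _ (nbhs s) (mul (phi g)) (mul^~ (phi g^-1%g))).
      exact: contr.
    exact: contl.
  split.
    apply: (closure_map c _ (proj1 (zP F))) => _ [v vF <-].
    rewrite -!phiM; apply: stab_closure_phi => _ /mapP[x xF ->].
    by rewrite 2!order_autM order_autK vF.
  move=> v vF; have vF' : fixes F (g^-1 * v * g)%g.
    move=> x xF; rewrite 2!order_autM vF ?map_f//.
    exact: order_autK.
  have [e1 e2] := proj2 (zP F) _ vF'; split.
    rewrite !mulA -phiM; congr (_ ** _); rewrite -[in RHS]e1 mulA -phiM.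
    by rewrite !mulgA mulgV mul1g.
  rewrite -!mulA -phiM; congr (_ ** _); rewrite -[in RHS]e2 -mulA -phiM.
  by rewrite -!mulgA mulgV mulg1.
rewrite -(zero_unique rP zg (zP _)) -mulA -phiM mulVg -mulA.
by rewrite (mul_phi1 cS mP phiM (proj1 (zP F))).
Qed.

Lemma zero_phi_zero E F g h :
  (forall x y, x \in F -> y \in E -> (g x == y) = (h x == y)) ->
  z E ** phi g ** z F = z E ** phi h ** z F.
Proof.
move=> gh.
have ghE : [seq x <- E | x \in map g F] = [seq x <- E | x \in map h F].
  apply: eq_in_filter => y yE; apply/mapP/mapP => -[x xF yx]; exists x => //;
    apply/esym/eqP.
  - by rewrite -gh// yx.
  - by rewrite gh// yx.
rewrite -!mulA !zero_conj !mulA !zero_mulE -ghE.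
(* Moving the zeros to the left leaves the zero of the common part of [E] and [map g F]; equality of
   entries makes [h * g^-1] fix that part pointwise. *)
have -> : h = (h * g^-1 * g)%g by rewrite -mulgA mulVg mulg1.
rewrite phiM mulA; congr (_ ** _); symmetry.
apply: (proj2 (proj2 (zP _) _ _)) => y; rewrite mem_filter => /andP[/mapP[x xF ->] gxE].
rewrite order_autM order_autK; apply/eqP.
by rewrite -gh.
Qed.

Lemma zero_limit s t : (forall F, s ** z F = t ** z F) ->
  stab_closure phi [::] s -> stab_closure phi [::] t -> s = t.
Proof.
move=> st sG tG.
rewrite -(mul_phi1 cS mP phiM sG) -(mul_phi1 cS mP phiM tG).
apply: (eq_on_closure (A := range z) cS.2 (@contl s) (@contl t)).
  by move=> _ /set_mem[F _ <-].
rewrite inE => N N1; have [C C1 CN] := compact_hausdorff_regular cS N1.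
have [A AC] := rep_one rP C1.
exists (z A); split; first by exists A.
apply: CN; apply: closure_subset (proj1 (zP A)) => _ [g gA <-].
exact: AC.
Qed.

End zero_products.

(** * Limits determined by matrix entries *)

Section limits.
Variable R : realType.
Context {d : Order.disp_t} (X : orderType d).
Hypotheses (Xinf : infinite_set [set: X]) (Xuh : ultrahomogeneous X).

Lemma near_pattern (U : set_system (order_aut X)) (b : X -> X -> bool) (E F : seq X) :
  Filter U -> (forall x y, \forall g \near U, ((g : order_aut X) x == y) = b x y) ->
  \forall g \near U, forall x y, x \in F -> y \in E -> ((g : order_aut X) x == y) = b x y.
Proof.
move=> UU H.
have {}H x : \forall g \near U, forall y, y \in E -> ((g : order_aut X) x == y) = b x y.
  elim: E => [|y E IH]; first exact: nearW.
  near=> g; move=> y'; rewrite inE => /predU1P[->|]; first by near: g; exact: H.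
  by move: y'; near: g; exact: IH.
elim: F => [|x F IH]; first exact: nearW.
near=> g; move=> x' y; rewrite inE => /predU1P[->|x'F]; first by move: y; near: g; exact: H.
by move: x' y x'F; near: g; exact: IH.
Unshelve. all: by end_near. Qed.

Lemma pattern_limit (S : topologicalType) (mul : S -> S -> S)
    (phi : order_aut X -> S) (U U' : set_system (order_aut X))
    (b : X -> X -> bool) (s s' : S) :
  semigroup_rep mul phi -> UltraFilter U -> UltraFilter U' ->
  (forall x y, \forall g \near U, ((g : order_aut X) x == y) = b x y) ->
  (forall x y, \forall g \near U', ((g : order_aut X) x == y) = b x y) ->
  phi @ U --> s -> phi @ U' --> s' -> s = s'.
Proof.
move=> rP UU UU' Ub Ub' Us Us'.
have [cS mP phiM _] := rP.
pose z D := sval (cid (zero_exists R Xinf Xuh D rP)).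
have zP D : is_zero mul phi D (z D) := svalP (cid (zero_exists R Xinf Xuh D rP)).
have contl := semitop_mul_continuousl mP; have contr := semitop_mul_continuousr mP.
have inG (V : set_system (order_aut X)) t : UltraFilter V -> phi @ V --> t ->
    stab_closure phi [::] t.
  by move=> VV; apply: closure_ultra_cvg; apply: nearW => g; exists g.
have lim (V : set_system (order_aut X)) (t : S) (E F : seq X) (g0 : order_aut X) :
    UltraFilter V -> phi @ V --> t ->
    (\forall g \near V, forall x y, x \in F -> y \in E -> ((g : order_aut X) x == y) = b x y) ->
    (forall x y, x \in F -> y \in E -> (g0 x == y) = b x y) ->
    mul (mul (z E) t) (z F) = mul (mul (z E) (phi g0)) (z F).
  move=> VV Vt Vb g0b.
  apply: (cvg_unique cS.2 (F := (fun g => mul (mul (z E) (phi g)) (z F)) @ V)).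
    apply: (@continuous_cvgP _ _ _ V _ (mul^~ (z F))); first exact: contr.
    by apply: (@continuous_cvgP _ _ _ V _ (mul (z E))); first exact: contl.
  apply: cvg_near_cst; apply: filterS Vb => g gb.
  by apply: (zero_phi_zero Xinf Xuh rP zP) => x y xF yE; rewrite gb// g0b.
apply: (zero_limit rP zP) (inG _ _ UU Us) (inG _ _ UU' Us') => F.
have zsF t V : UltraFilter V -> phi @ V --> t -> stab_closure phi [::] (mul t (z F)).
  move=> VV Vt; apply: (stab_closureM mP phiM); first exact: inG Vt.
  by apply: stab_closureS (proj1 (zP F)).
(* [zero_limit] has inserted a zero on the right; in the opposite semigroup it inserts one on the
   left. A single [g0] with the prescribed entries then evaluates both limits. *)
pose op := semigroup_rep_op rP.
apply: (zero_limit op (fun D => is_zero_op (zP D))) => [E||].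
- rewrite !(semitop_mulA mP).
  have [g0 g0b] := filter_ex (near_pattern E F _ Ub).
  rewrite (lim U s E F g0 UU Us (near_pattern E F _ Ub) g0b).
  by rewrite (lim U' s' E F g0 UU' Us' (near_pattern E F _ Ub') g0b).
- by rewrite stab_closure_op; exact: zsF Us.
- by rewrite stab_closure_op; exact: zsF Us'.
Qed.

End limits.

(** * The Hilbert space and its contractions *)

Section rsum_theory.
Variables (R : realType) (X : choiceType).
Implicit Types (h k : X -> R) (A B : {fset X}).

(** The finite subsets directed by inclusion: sums over X become limits of finite sums, from which
    linearity is inherited. *)
Definition fsets_filter : set_system {fset X} :=
  filter_from setT (fun A => [set B | (A `<=` B)%fset]).

Global Instance fsets_filter_proper : ProperFilter fsets_filter.
Proof.
apply: filter_from_proper => [|A _]; last by exists A => /=.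
apply: filter_from_filter; first by exists fset0.
move=> A B _ _; exists (A `|` B)%fset => // C /=.
by rewrite fsubUset => /andP[].
Qed.

Lemma near_fsets (P : set {fset X}) A : (forall B, (A `<=` B)%fset -> P B) ->
  \forall B \near fsets_filter, P B.
Proof. by move=> H; exists A. Qed.

Definition fset_sum h (B : {fset X}) : R := \sum_(x <- B) h x.

Definition abs_summable h := summable [set: X] (EFin \o h).

Lemma abs_summable_le h k : (forall x, `|h x| <= k x) ->
  (\esum_(x in [set: X]) (k x)%:E < +oo)%E -> abs_summable h.
Proof.
move=> hk ks; apply: le_lt_trans ks; apply: le_esum => x _ /=.
by rewrite lee_fin.
Qed.

Lemma ge0_esum_cvg h : (forall x, 0 <= h x) ->
  (\esum_(x in [set: X]) (h x)%:E < +oo)%E ->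
  fset_sum h @ fsets_filter --> fine (\esum_(x in [set: X]) (h x)%:E).
Proof.
move=> h0 hs; apply/cvgrPdist_lt => e e0.
have S0 : (0 <= \esum_(x in [set: X]) (h x)%:E)%E by apply: esum_ge0 => x _; rewrite lee_fin.
have Sf : \esum_(x in [set: X]) (h x)%:E \is a fin_num by rewrite ge0_fin_numE.
have leS B : \sum_(x <- B) h x <= fine (\esum_(x in [set: X]) (h x)%:E).
  rewrite -lee_fin fineK// -sumEFin; apply: ereal_sup_ubound => /=.
  exists [set` B]; first by split=> //; exact: finite_fset.
  by rewrite fsbig_finite ?set_fsetK//; exact: finite_fset.
have [_ [A [fA _] <-] SA] := ub_ereal_sup_adherent e0 Sf.
apply: (@near_fsets _ (fset_set A)) => B AB.
rewrite /fset_sum ger0_norm ?subr_ge0 ?leS// ltrBlDr -ltrBlDl.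
apply: (@lt_le_trans _ _ (\sum_(x <- fset_set A) h x)).
  by rewrite -lte_fin EFinB fineK// -sumEFin -fsbig_finite.
have -> : \sum_(x <- fset_set A) h x = \sum_(x <- B) (if x \in fset_set A then h x else 0).
  rewrite -(big_fset_incl _ AB); last by move=> x _ /negbTE ->.
  by apply: eq_big_seq => x ->.
by apply: ler_sum => x _; case: ifP.
Qed.

Lemma abs_summable_pos h : abs_summable h ->
  (\esum_(x in [set: X]) (Num.max (h x) 0)%:E < +oo)%E.
Proof.
apply: le_lt_trans; apply: le_esum => x _ /=.
by rewrite lee_fin ge_max ler_norm normr_ge0.
Qed.

Lemma abs_summableN h : abs_summable h -> abs_summable (fun x => - h x).
Proof. by apply: le_lt_trans; apply: le_esum => x _ /=; rewrite normrN. Qed.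

Lemma rsum_cvg h : abs_summable h ->
  fset_sum h @ fsets_filter --> rsum h.
Proof.
move=> hs.
have -> : fset_sum h = (fun B => fset_sum (fun x => Num.max (h x) 0) B -
    fset_sum (fun x => Num.max (- h x) 0) B).
  apply/funext => B; rewrite /fset_sum -sumrB; apply: eq_bigr => x _.
  have [h0|h0] := leP 0 (h x).
    by rewrite max_r ?oppr_le0 ?subr0.
  by rewrite max_l ?oppr_ge0 ?(ltW h0)// sub0r opprK.
apply: cvgB.
  rewrite (_ : esum _ _ = \esum_(x in [set: X]) (Num.max (h x) 0)%:E).
    apply: ge0_esum_cvg; last exact: abs_summable_pos.
    by move=> x; rewrite le_max lexx orbT.
  by apply: eq_esum => x _; rewrite funeposE -EFin_max.
rewrite (_ : esum _ _ = \esum_(x in [set: X]) (Num.max (- h x) 0)%:E).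
  apply: ge0_esum_cvg; last exact/abs_summable_pos/abs_summableN.
  by move=> x; rewrite le_max lexx orbT.
by apply: eq_esum => x _; rewrite funenegE -EFin_max.
Qed.

Lemma rsum_eq h l : abs_summable h ->
  fset_sum h @ fsets_filter --> l -> rsum h = l.
Proof. by move=> hs; apply: (cvg_unique (@Rhausdorff R)); exact: rsum_cvg. Qed.

Lemma abs_summable_lin (a b : R) h k : abs_summable h -> abs_summable k ->
  abs_summable (fun x => a * h x + b * k x).
Proof.
move=> hs ks.
have fin (l : X -> R) : abs_summable l ->
    (\esum_(x in [set: X]) `|(EFin \o l) x|%E = (fine (\esum_(x in [set: X]) `|(EFin \o l) x|%E))%:E)%E.
  by move=> ls; rewrite fineK// ge0_fin_numE// esum_ge0.
apply: (@le_lt_trans _ _ (`|a|%:E * (\esum_(x in [set: X]) `|(EFin \o h) x|) +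
    `|b|%:E * (\esum_(x in [set: X]) `|(EFin \o k) x|))%E).
  have za := @esumZl_le R X `|a| (fun x => `|(EFin \o h) x|%E) (normr_ge0 a) (fun x => abse_ge0 _).
  have zb := @esumZl_le R X `|b| (fun x => `|(EFin \o k) x|%E) (normr_ge0 b) (fun x => abse_ge0 _).
  apply: le_trans (leeD za zb).
  rewrite -esumD => [|x _|x _]; last 2 first.
  - by rewrite mule_ge0// lee_fin.
  - by rewrite mule_ge0// lee_fin.
  apply: le_esum => x _ /=; rewrite -!EFinM -EFinD lee_fin -!normrM.
  exact: ler_normD.
by rewrite (fin h hs) (fin k ks) -!EFinM -EFinD ltry.
Qed.

Lemma rsum_lin (a b : R) h k : abs_summable h -> abs_summable k ->
  rsum (fun x => a * h x + b * k x) = a * rsum h + b * rsum k.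
Proof.
move=> hs ks; apply: rsum_eq; first exact: abs_summable_lin.
have -> : fset_sum (fun x => a * h x + b * k x) =
    (fun B => a * fset_sum h B + b * fset_sum k B).
  by apply/funext => B; rewrite /fset_sum big_split !mulr_sumr.
by apply: cvgD; apply: cvgMr; exact: rsum_cvg.
Qed.

Lemma rsum_fset (A : {fset X}) h : (forall x, x \notin A -> h x = 0) ->
  abs_summable h /\ rsum h = \sum_(x <- A) h x.
Proof.
move=> hA.
have hs : abs_summable h.
  rewrite /abs_summable /summable (esumID [set` A])/=; last by move=> x _.
  rewrite setTI esum_fset ?finite_fset//.
  rewrite esum1 ?adde0; last by move=> x [_ /= /negP/hA ->]; rewrite normr0.
  by rewrite fsbig_finite ?finite_fset//= set_fsetK sumEFin ltry.
split=> //; apply: rsum_eq => //; apply: cvg_near_cst.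
apply: (@near_fsets _ A) => B AB; apply/esym; apply: big_fset_incl AB _.
by move=> x _; exact: hA.
Qed.

End rsum_theory.

(** * Inner product, Cauchy-Schwarz and finite truncations *)

Section l2_theory.
Variables (R : realType) (X : choiceType).
Implicit Types (f g h : l2 R X) (x y : X) (c z w : R[i]).

(** The norm of [R[i]] takes its values in [R[i]]; this is the modulus as an element of [R], where
    the estimates are made. *)
Definition cabs z : R := Num.sqrt (sqnorm z).

Lemma cabs_normC z : `|z| = (cabs z)%:C%C. Proof. by rewrite normc_def. Qed.

Lemma cabs_ge0 z : 0 <= cabs z. Proof. exact: sqrtr_ge0. Qed.

Lemma cabsD z w : cabs (z + w) <= cabs z + cabs w.
Proof. by rewrite -lecR rmorphD /= -!cabs_normC ler_normD. Qed.

Lemma cabsM z w : cabs (z * w) = cabs z * cabs w.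
Proof. by rewrite /cabs sqnormM sqrtrM// sqnorm_ge0. Qed.

Lemma cabsN z : cabs (- z) = cabs z.
Proof. by rewrite -mulN1r cabsM {1}/cabs /sqnorm/= sqrrN oppr0 expr0n addr0 expr1n sqrtr1 mul1r. Qed.

Lemma cabs0_eq0 z : cabs z = 0 -> z = 0.
Proof. by move=> z0; apply/normr0_eq0; rewrite cabs_normC z0. Qed.

Lemma dot_abs_summable f g :
  abs_summable (fun x => complex.Re (f x * conjc (g x))) /\
  abs_summable (fun x => complex.Im (f x * conjc (g x))).
Proof.
have fin : (\esum_(x in [set: X]) (sqnorm (f x) + sqnorm (g x))%:E < +oo)%E.
  rewrite (@eq_esum _ _ _ _ (fun x => (sqnorm (f x))%:E + (sqnorm (g x))%:E)%E)//.
  rewrite esumD => [|x _|x _]; rewrite ?lee_fin ?sqnorm_ge0//.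
  by rewrite -!/(esqnorm _) !l2_normE -EFinD ltry.
split; apply: abs_summable_le fin => x; case: (f x) (g x) => [a b] [u v];
  rewrite /sqnorm /= ler_norml;
  have H1 := sqr_ge0 (a - u); have H2 := sqr_ge0 (a + u);
  have H3 := sqr_ge0 (b - v); have H4 := sqr_ge0 (b + v);
  have H5 := sqr_ge0 (a - v); have H6 := sqr_ge0 (a + v);
  have H7 := sqr_ge0 (b - u); have H8 := sqr_ge0 (b + u);
  apply/andP; split; lra.
Qed.

Lemma l2_dot_linl c f g h : l2_dot (c *: f + g) h = c * l2_dot f h + l2_dot g h.
Proof.
have [fr fi] := dot_abs_summable f h; have [gr gi] := dot_abs_summable g h.
transitivity (csum (fun x => (c * f x + g x) * conjc (h x))); first by [].
case: c => a b; apply/eqP; rewrite eq_complex /=; apply/andP; split; apply/eqP.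
  rewrite -[RHS]/(a * _ - b * _ + _).
  rewrite (_ : (fun x => _) = fun x => 1 * (a * complex.Re (f x * conjc (h x))
    + (- b) * complex.Im (f x * conjc (h x))) + 1 * complex.Re (g x * conjc (h x))).
    rewrite rsum_lin//; last exact: abs_summable_lin.
    by rewrite rsum_lin// !mul1r mulNr.
  apply/funext => x; case: (f x) (g x) (h x) => [? ?] [? ?] [? ?] /=; ring.
rewrite (_ : (fun x => _) = fun x => 1 * (a * complex.Im (f x * conjc (h x))
    + b * complex.Re (f x * conjc (h x))) + 1 * complex.Im (g x * conjc (h x))).
  rewrite rsum_lin//; last exact: abs_summable_lin.
  by rewrite rsum_lin// !mul1r.
apply/funext => x; case: (f x) (g x) (h x) => [? ?] [? ?] [? ?] /=; ring.
Qed.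

Lemma l2_dotC f g : l2_dot g f = conjc (l2_dot f g).
Proof.
have [_ fi] := dot_abs_summable f g; rewrite /l2_dot /csum /=; congr Complex.
  congr rsum; apply/funext => x; case: (f x) (g x) => [? ?] [? ?] /=; ring.
rewrite (_ : (fun x => _) = fun x => (-1) * complex.Im (f x * conjc (g x))
    + 0 * complex.Im (f x * conjc (g x))).
  by rewrite rsum_lin// mul0r addr0 mulN1r.
by apply/funext => x; case: (f x) (g x) => [? ?] [? ?] /=; ring.
Qed.

Lemma l2_dotDl f g h : l2_dot (f + g) h = l2_dot f h + l2_dot g h.
Proof. by rewrite -[f in LHS]scale1r l2_dot_linl mul1r. Qed.

Lemma l2_dot0l h : l2_dot 0 h = 0.
Proof. by apply: (addrI (l2_dot 0 h)); rewrite -l2_dotDl !addr0. Qed.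

Lemma l2_dotZl c f h : l2_dot (c *: f) h = c * l2_dot f h.
Proof. by rewrite -[c *: f]addr0 l2_dot_linl l2_dot0l addr0. Qed.

Lemma l2_dotNl f h : l2_dot (- f) h = - l2_dot f h.
Proof. by rewrite -scaleN1r l2_dotZl mulN1r. Qed.

Lemma l2_dotBl f g h : l2_dot (f - g) h = l2_dot f h - l2_dot g h.
Proof. by rewrite l2_dotDl l2_dotNl. Qed.

Lemma l2_dotDr f g h : l2_dot h (f + g) = l2_dot h f + l2_dot h g.
Proof. by rewrite (l2_dotC (f + g)) (l2_dotC f) (l2_dotC g) l2_dotDl rmorphD. Qed.

Lemma l2_dotZr c f h : l2_dot h (c *: f) = conjc c * l2_dot h f.
Proof. by rewrite (l2_dotC (c *: f)) (l2_dotC f) l2_dotZl rmorphM. Qed.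

Lemma l2_dotNr f h : l2_dot h (- f) = - l2_dot h f.
Proof. by rewrite (l2_dotC (- f)) (l2_dotC f) l2_dotNl rmorphN. Qed.

Lemma l2_dotBr f g h : l2_dot h (f - g) = l2_dot h f - l2_dot h g.
Proof. by rewrite l2_dotDr l2_dotNr. Qed.

Lemma l2_dotff_norm f : l2_dot f f = (l2_norm f ^+ 2)%:C%C.
Proof.
have := l2_dotff f; have := l2_dotC f f.
case: (l2_dot f f) => a b /= [bN] ->; congr Complex; lra.
Qed.

Lemma l2_cauchy_schwarz f g : cabs (l2_dot f g) <= l2_norm f * l2_norm g.
Proof.
have [g0|g0] := eqVneq (l2_norm g) 0.
  rewrite g0 mulr0 (l2_norm_eq0 g0) l2_dotC l2_dot0l.
  by rewrite /cabs /sqnorm /= !(oppr0, expr0n) /= addr0 sqrtr0.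
have gp : 0 < l2_norm g by rewrite lt_def g0 l2_norm_ge0.
rewrite -(@ler_pXn2r _ 2) ?nnegrE ?cabs_ge0 ?mulr_ge0 ?l2_norm_ge0//.
rewrite /cabs sqr_sqrtr ?sqnorm_ge0//.
set c := l2_dot f g.
pose n : R := l2_norm g ^+ 2.
have np : 0 < n by rewrite exprn_gt0.
(* The vector is [n] times the component of [f] orthogonal to [g]. *)
have : 0 <= complex.Re (l2_dot (n%:C%C *: f - c *: g) (n%:C%C *: f - c *: g)).
  by rewrite l2_dotff sqr_ge0.
rewrite !(l2_dotBl, l2_dotBr, l2_dotZl, l2_dotZr) -/c (l2_dotC f g) -/c !l2_dotff_norm -/n.
case: c => a b; rewrite /sqnorm /= => H.
have : 0 <= n * (n * l2_norm f ^+ 2 - (a ^+ 2 + b ^+ 2)).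
  by move: H; congr (_ <= _); ring.
by rewrite pmulr_rge0// subr_ge0 => H'; rewrite exprMn mulrC; exact: H'.
Qed.

Lemma l2_dot_basis f x : l2_dot f (l2_basis R x) = f x.
Proof.
have H (p : R[i] -> R) : p 0 = 0 ->
    rsum (fun y => p (f y * conjc (l2_basis R x y))) = p (f x).
  move=> p0; rewrite (proj2 (rsum_fset (A := [fset x]%fset) _)) => [|y].
    by rewrite big_seq_fset1 /= eqxx conjc_nat mulr1.
  by rewrite inE /= => /negbTE ->; rewrite conjc_nat mulr0.
by rewrite /l2_dot /csum (H (@complex.Re R))// (H (@complex.Im R))//; case: (f x).
Qed.

Lemma l2_norm_sqr f : l2_norm f ^+ 2 = rsum (fun x => sqnorm (f x)).
Proof.
rewrite -l2_dotff /l2_dot /csum /=; congr rsum; apply/funext => x.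
by case: (f x) => a b; rewrite /sqnorm /=; ring.
Qed.

Lemma sqnorm_abs_summable f : abs_summable (fun x => sqnorm (f x)).
Proof.
have [H _] := dot_abs_summable f f; move: H; congr abs_summable; apply/funext => x.
by case: (f x) => a b; rewrite /sqnorm /=; ring.
Qed.

Definition l2_trunc (A : {fset X}) f : l2 R X := \sum_(x <- A) f x *: l2_basis R x.

Lemma l2_sumE (I : Type) (r : seq I) (F : I -> l2 R X) y :
  (\sum_(i <- r) F i) y = \sum_(i <- r) F i y.
Proof. by elim/big_rec2: _ => // i u v _ <-. Qed.

Lemma l2_truncE A f y : l2_trunc A f y = if y \in A then f y else 0.
Proof.
rewrite l2_sumE (eq_bigr (fun x => f x * (y == x)%:R))//; case: ifP => yA.
  rewrite (big_fsetD1 y)//= eqxx mulr1 big1_seq ?addr0// => x /andP[_].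
  by rewrite !inE => /andP[/negbTE xy _]; rewrite eq_sym xy mulr0.
rewrite big1_seq// => x /andP[_ xA] /=; case: eqP => [yx|_]; last by rewrite mulr0.
by rewrite yx xA in yA.
Qed.

(** Pythagoras for the coordinate projection onto [A]. *)
Lemma l2_trunc_norm A f : l2_norm (f - l2_trunc A f) ^+ 2 =
  l2_norm f ^+ 2 - \sum_(x <- A) sqnorm (f x).
Proof.
have sq0 : sqnorm (0 : R[i]) = 0 by rewrite /sqnorm /= expr0n addr0.
pose k x := if x \in A then sqnorm (f x) else 0.
have [ks kE] : abs_summable k /\ rsum k = \sum_(x <- A) sqnorm (f x).
  have [|ks ->] := @rsum_fset R X A k; first by move=> x /negbTE xA; rewrite /k xA.
  by split=> //; apply: eq_big_seq => x xA; rewrite /k xA.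
rewrite !l2_norm_sqr -kE.
rewrite (_ : (fun x => _) = fun x => 1 * sqnorm (f x) + (- 1) * k x).
  by rewrite rsum_lin ?mul1r ?mulN1r//; exact: sqnorm_abs_summable.
apply/funext => x; transitivity (sqnorm (f x - l2_trunc A f x)); first by [].
rewrite l2_truncE /k.
by case: ifP => _; rewrite ?subrr ?sq0 ?subr0; ring.
Qed.

Lemma l2_trunc_approx f e : 0 < e -> exists A, l2_norm (f - l2_trunc A f) < e.
Proof.
move=> e0; have e2 : 0 < e ^+ 2 by rewrite exprn_gt0.
have /cvgrPdist_lt/(_ _ e2)/filter_ex [A] := rsum_cvg (sqnorm_abs_summable f).
move=> H; exists A.
rewrite -(@ltr_pXn2r _ 2) ?nnegrE ?l2_norm_ge0 ?(ltW e0)// l2_trunc_norm l2_norm_sqr.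
exact: le_lt_trans (ler_norm _) H.
Qed.

Lemma sum_sqnorm_le (A : {fset X}) f : \sum_(x <- A) sqnorm (f x) <= l2_norm f ^+ 2.
Proof. by rewrite -subr_ge0 -l2_trunc_norm sqr_ge0. Qed.

Lemma square_summable_le (u : X -> R[i]) (M : R) :
  (forall A : {fset X}, \sum_(x <- A) sqnorm (u x) <= M) ->
  (esqnorm u <= M%:E)%E.
Proof.
move=> uM; apply: ge_ereal_sup => _ [A [fA _] <-].
by rewrite fsbig_finite//= sumEFin lee_fin.
Qed.

End l2_theory.

Section convergence_criteria.
Variables (R : realType) (X : choiceType).

(** Positive elements in the partial order of [R[i]] are real, so tolerances can be taken in [R]. *)
Lemma complex_gt0 (e : R[i]) : 0 < e -> exists2 r : R, 0 < r & e = r%:C%C.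
Proof.
by case: e => a b; rewrite ltcE /= => /andP[/eqP -> a0]; exists a.
Qed.

Lemma l2_cvgP (I : Type) (F : set_system I) (u : I -> l2 R X) (f : l2 R X) :
  Filter F -> u @ F --> f <->
  forall e : R, 0 < e -> \forall i \near F, l2_norm (f - u i) < e.
Proof.
move=> FF; split=> [/cvgrPdist_lt H e e0|H].
  have /H : 0 < (e%:C)%C :> R[i] by rewrite ltcR.
  by apply: (@filterS _ F) => i H'; rewrite -ltcR; exact: H'.
apply/cvgrPdist_lt => _ /complex_gt0[e e0 ->].
by apply: (@filterS _ F) (H e e0) => i H'; have := H'; rewrite -ltcR.
Qed.

Lemma complex_cvgP (I : Type) (F : set_system I) (u : I -> R[i]^o) (z : R[i]^o) :
  Filter F -> u @ F --> z <->
  forall e : R, 0 < e -> \forall i \near F, cabs (z - u i) < e.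
Proof.
move=> FF; split=> [/cvgrPdist_lt H e e0|H].
  have /H : 0 < (e%:C)%C :> R[i] by rewrite ltcR.
  by apply: (@filterS _ F) => i H'; rewrite -ltcR -cabs_normC; exact: H'.
apply/cvgrPdist_lt => _ /complex_gt0[e e0 ->].
by apply: (@filterS _ F) (H e e0) => i H'; have := H'; rewrite -ltcR -cabs_normC.
Qed.

Lemma contraction_cvgP (F : set_system (contraction_op R X)) (T : contraction_op R X) :
  Filter F -> F --> T <-> forall f g (e : R), 0 < e ->
    \forall T' \near F, cabs (l2_dot (T f) g - l2_dot ((T' : contraction_op R X) f) g) < e.
Proof.
move=> FF; split.
  move=> /(@cvg_initialP _ _ (@contraction_coef R X : _ -> {ptws (l2 R X * l2 R X)%type -> R[i]^o}) F _ FF).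
  move=> /pointwise_cvgP H f g e e0.
  by have /complex_cvgP/(_ e e0) := H (f, g).
move=> H; apply/(@cvg_initialP _ _
  (@contraction_coef R X : _ -> {ptws (l2 R X * l2 R X)%type -> R[i]^o}) F _ FF).
by apply/pointwise_cvgP => -[f g]; apply/complex_cvgP => e; exact: H.
Qed.

Lemma unitary_cvgP (F : set_system (unitary_op R X)) (u : unitary_op R X) :
  Filter F -> F --> u <-> forall f (e : R), 0 < e ->
    \forall u' \near F, l2_norm (u f - (u' : unitary_op R X) f) < e.
Proof.
move=> FF; split.
  move=> /(@cvg_initialP _ _ (@unitary_fun R X : _ -> {ptws l2 R X -> l2 R X}) F _ FF).
  move=> /pointwise_cvgP H f e e0.
  by have /l2_cvgP/(_ e e0) := H f.
move=> H; apply/(@cvg_initialP _ _ (@unitary_fun R X : _ -> {ptws l2 R X -> l2 R X}) F _ FF).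
by apply/pointwise_cvgP => f; apply/l2_cvgP => e; exact: H.
Qed.

End convergence_criteria.

Lemma ptws_cvgP (U : choiceType) (V : topologicalType)
    (F : set_system (U -> V)) (f : U -> V) : Filter F ->
  F --> (f : {ptws U -> V}) <-> forall x, (fun g : U -> V => g x) @ F --> f x.
Proof.
move=> FF; split=> [/cvg_sup H x|H].
  by have /cvg_initialP := H x; apply.
by apply/cvg_sup => x; apply/cvg_initialP; exact: H.
Qed.

Section order_aut_convergence.
Context {d : Order.disp_t} (X : orderType d).

Lemma order_aut_cvgP (F : set_system (order_aut X)) (g : order_aut X) :
  Filter F -> F --> g <->
  forall x, \forall h \near F, (h : order_aut X) x = g x.
Proof.
move=> FF; split.
  move=> /(@cvg_initialP _ _ (@order_aut_fun d X : _ -> {ptws X -> discrete_topology X}) F _ FF).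
  move=> /ptws_cvgP H x.
  by have /(_ [set g x]) := H x; apply; apply/principal_filterP.
move=> H; apply/(@cvg_initialP _ _ (@order_aut_fun d X : _ -> {ptws X -> discrete_topology X}) F _ FF).
apply/ptws_cvgP => x A /principal_filterP gA.
by apply: (@filterS _ F) (H x) => h /= ->.
Qed.

End order_aut_convergence.

(** * The unit ball in the weak operator topology *)

Section weak_convergence.
Variables (R : realType) (X : choiceType).
Implicit Types (f g h : l2 R X) (x y : X) (S T : contraction_op R X).

Lemma cvg_seq_sum (K : numFieldType) (V : normedModType K) (I : Type) (J : eqType)
    (F : set_system I) (r : seq J) (u : J -> I -> V) (v : J -> V) : Filter F ->
  (forall j, u j @ F --> v j) ->
  (fun i => \sum_(j <- r) u j i) @ F --> \sum_(j <- r) v j.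
Proof.
move=> FF uv; elim: r => [|j r IH].
  rewrite big_nil (_ : (fun _ => _) = fun=> 0); first exact: cvg_cst.
  by apply/funext => i; rewrite big_nil.
rewrite big_cons (_ : (fun _ => _) = fun i => u j i + \sum_(j <- r) u j i).
  exact: cvgD.
by apply/funext => i; rewrite big_cons.
Qed.

Lemma ultra_cvg_bounded (I : Type) (U : set_system I) (u : I -> R) (M : R) :
  UltraFilter U -> (forall i, `|u i| <= M) -> exists l : R, u @ U --> l.
Proof.
move=> UU uM; have := @segment_compact R (- M) M; rewrite compact_ultra.
move=> /(_ (u @ U) (ultra_fmap u UU))[|l [_ ul]]; last by exists l.
by apply: nearW => i /=; rewrite in_itv /= -ler_norml.
Qed.

Lemma cabs_le_ReIm (z : R[i]) : cabs z <= `|complex.Re z| + `|complex.Im z|.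
Proof.
rewrite -(@ler_pXn2r _ 2) ?nnegrE ?cabs_ge0 ?addr_ge0//.
rewrite /cabs sqr_sqrtr ?sqnorm_ge0// /sqnorm sqrrD !real_normK ?num_real//.
have := mulr_ge0 (normr_ge0 (complex.Re z)) (normr_ge0 (complex.Im z)); lra.
Qed.

Lemma ultra_cvg_complex (I : Type) (U : set_system I) (u : I -> R[i]^o) (M : R) :
  UltraFilter U -> (forall i, cabs (u i) <= M) -> exists z : R[i]^o,
  [/\ u @ U --> z, (fun i => complex.Re (u i)) @ U --> complex.Re z &
    (fun i => complex.Im (u i)) @ U --> complex.Im z].
Proof.
move=> UU uM.
have part (z : R[i]) : `|complex.Re z| <= cabs z /\ `|complex.Im z| <= cabs z.
  by case: z => a b /=; rewrite /cabs /sqnorm /=; split;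
    rewrite -sqrtr_sqr ler_sqrt ?addr_ge0 ?sqr_ge0// ?lerDl ?lerDr sqr_ge0.
have [a ua] := ultra_cvg_bounded (u := fun i => complex.Re (u i)) UU
  (fun i => le_trans (proj1 (part _)) (uM i)).
have [b ub] := ultra_cvg_bounded (u := fun i => complex.Im (u i)) UU
  (fun i => le_trans (proj2 (part _)) (uM i)).
exists (Complex a b); split=> //; apply/complex_cvgP => e e0.
have e2 : 0 < e / 2 by rewrite divr_gt0.
near=> i; apply: le_lt_trans (cabs_le_ReIm _) _; rewrite (splitr e) !raddfB.
apply: ltrD; near: i.
- by have /cvgrPdist_lt := ua; apply.
- by have /cvgrPdist_lt := ub; apply.
Unshelve. all: by end_near. Qed.

Lemma l2_dot_sumr (r : seq X) (c : X -> R[i]) h :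
  l2_dot h (\sum_(x <- r) c x *: l2_basis R x) = \sum_(x <- r) conjc (c x) * h x.
Proof.
elim: r => [|x r IH]; first by rewrite !big_nil l2_dotC l2_dot0l conjc0.
by rewrite !big_cons l2_dotDr l2_dotZr l2_dot_basis IH.
Qed.

Lemma l2_normN f : l2_norm (- f) = l2_norm f.
Proof.
by rewrite -scaleN1r l2_normZ /sqnorm /= sqrrN oppr0 expr0n addr0 expr1n sqrtr1 mul1r.
Qed.

Lemma l2_normB f g : l2_norm (f - g) <= l2_norm f + l2_norm g.
Proof. by rewrite -(l2_normN g) l2_normD. Qed.

(** For bounded families coordinatewise convergence is weak convergence: it settles the truncations
    of [g], and Cauchy-Schwarz bounds the remaining tail. *)
Lemma weak_cvg (I : Type) (F : set_system I) (u : I -> l2 R X) (v : l2 R X)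
    (M : R) g : Filter F -> (forall i, l2_norm (u i) <= M) ->
  (forall y, (fun i => u i y : R[i]^o) @ F --> (v y : R[i]^o)) ->
  (fun i => l2_dot (u i) g : R[i]^o) @ F --> (l2_dot v g : R[i]^o).
Proof.
move=> FF uM uv; apply/complex_cvgP => e e0.
(* The sum in parentheses dominates the norm of [v - u i] and is positive thanks to the 1; the
   factor 2 leaves the tail half of [e]. *)
have K0 : 0 < 2 * (l2_norm v + `|M| + 1).
  by rewrite mulr_gt0// ltr_wpDl// addr_ge0// l2_norm_ge0.
have [A gA] := l2_trunc_approx g (divr_gt0 e0 K0).
have e2 : 0 < e / 2 by rewrite divr_gt0.
have /complex_cvgP/(_ _ e2) H : (fun i => l2_dot (u i) (l2_trunc A g) : R[i]^o) @ F -->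
    (l2_dot v (l2_trunc A g) : R[i]^o).
  rewrite l2_dot_sumr (_ : (fun _ => _) = fun i => \sum_(x <- A) conjc (g x) * u i x); last first.
    by apply/funext => i; rewrite l2_dot_sumr.
  apply: (@cvg_seq_sum R[i] R[i]^o) => x; apply: cvgMr; exact: uv.
apply: (@filterS _ F) H => i H.
have -> : l2_dot v g - l2_dot (u i) g =
    (l2_dot v (l2_trunc A g) - l2_dot (u i) (l2_trunc A g)) +
    l2_dot (v - u i) (g - l2_trunc A g).
  by rewrite l2_dotBl !l2_dotBr; ring.
apply: le_lt_trans (cabsD _ _) _; rewrite (splitr e); apply: ltr_leD H _.
apply: le_trans (l2_cauchy_schwarz _ _) _.
have n1 : l2_norm (v - u i) <= l2_norm v + `|M| + 1.
  apply: le_trans (l2_normB _ _) _; rewrite -addrA lerD2l.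
  by apply: le_trans (uM i) _; apply: le_trans (ler_norm _) _; rewrite lerDl.
have K0' : 0 < l2_norm v + `|M| + 1 by move: K0; rewrite pmulr_rgt0.
apply: (@le_trans _ _ ((l2_norm v + `|M| + 1) * (e / (2 * (l2_norm v + `|M| + 1))))).
  by apply: ler_pM => //; rewrite ?l2_norm_ge0 ?ltW.
by rewrite le_eqVlt; apply/orP; left; apply/eqP; field; rewrite gt_eqF.
Qed.

Lemma contractionD T f g : T (f + g) = T f + T g.
Proof. by have := contraction_linear T 1 f g; rewrite !scale1r. Qed.

Lemma contraction0 T : T 0 = 0.
Proof. by apply: (addrI (T 0)); rewrite -contractionD !addr0. Qed.

Lemma contractionZ T (c : R[i]) f : T (c *: f) = c *: T f.
Proof. by have := contraction_linear T c f 0; rewrite contraction0 !addr0. Qed.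

Lemma contractionB T f g : T (f - g) = T f - T g.
Proof. by rewrite contractionD -scaleN1r contractionZ scaleN1r. Qed.

Lemma contraction_le T f : l2_norm (T f) <= l2_norm f.
Proof. by have := contraction_norm T f; rewrite lecR. Qed.

Lemma contraction_eqP (T T' : contraction_op R X) : T =1 T' -> T = T'.
Proof.
case: T T' => [t tl tn] [t' tl' tn'] /= /funext E; subst t'.
by congr Contraction; exact: Prop_irrelevance.
Qed.

Lemma cabs_coord f x : cabs (f x) <= l2_norm f.
Proof.
rewrite -l2_dot_basis; apply: le_trans (l2_cauchy_schwarz _ _) _.
suff -> : l2_norm (l2_basis R x) = 1 by rewrite mulr1.
apply/eqP; rewrite -(@eqrXn2 _ 2) ?l2_norm_ge0// -l2_dotff l2_dot_basis /= eqxx expr1n.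
by [].
Qed.

(** The limit operator is defined by the ultrafilter limits of coordinates; the bound on finite
    partial sums of squares passes to the limit and puts its values in the Hilbert space. *)
Lemma contraction_compact : compact [set: contraction_op R X].
Proof.
rewrite compact_ultra => U UU _.
have lim f y : {z : R[i]^o | [/\ (fun T : contraction_op R X => T f y : R[i]^o) @ U --> z,
    (fun T : contraction_op R X => complex.Re (T f y)) @ U --> complex.Re z &
    (fun T : contraction_op R X => complex.Im (T f y)) @ U --> complex.Im z]}.
  apply: cid; apply: (ultra_cvg_complex (M := l2_norm f)) => T.
  exact: le_trans (cabs_coord _ _) (contraction_le _ _).
pose t f y : R[i] := sval (lim f y).
have tU f y : (fun T : contraction_op R X => T f y : R[i]^o) @ U --> (t f y : R[i]^o).
  by have [] := svalP (lim f y).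
have t_le f : (esqnorm (t f) <= (l2_norm f ^+ 2)%:E)%E.
  apply: square_summable_le => A.
  apply: (@closed_cvg _ R U _ (fun T => \sum_(x <- A) sqnorm (T f x))
    (fun r => r <= l2_norm f ^+ 2)); first exact: closed_le.
    apply: nearW => T; apply: le_trans (sum_sqnorm_le _ _) _.
    by rewrite ler_pXn2r ?nnegrE ?l2_norm_ge0// contraction_le.
  apply: (@cvg_seq_sum R R^o) => x; rewrite /sqnorm.
  have [_ re im] := svalP (lim f x).
  rewrite (_ : (fun T => _) = fun T : contraction_op R X =>
    complex.Re (T f x) * complex.Re (T f x) + complex.Im (T f x) * complex.Im (T f x)).
    by rewrite !expr2; apply: cvgD; apply: cvgM.
  by apply/funext => T; rewrite !expr2.
have ts f : t f \in @square_summable R X.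
  by rewrite unfold_in; apply: le_lt_trans (t_le f) _; rewrite ltry.
have tl : linear (fun f => L2 (ts f)).
  move=> c f g; apply: val_inj; apply/funext => y.
  apply: (cvg_unique (@norm_hausdorff _ R[i]^o) (tU (c *: f + g) y)).
  rewrite (_ : (fun T => _) = fun T : contraction_op R X => c * T f y + T g y).
    by apply: cvgD; [apply: cvgMr|]; exact: tU.
  by apply/funext => T; rewrite contraction_linear.
have tn f : `|L2 (ts f)| <= `|f|.
  rewrite lecR -(@ler_pXn2r _ 2) ?nnegrE ?l2_norm_ge0//.
  by rewrite -lee_fin -l2_normE; exact: t_le.
exists (Contraction tl tn); split=> //.
apply/contraction_cvgP => f g; apply/complex_cvgP.
apply: (@weak_cvg _ U (fun T : contraction_op R X => T f) _ (l2_norm f)).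
  by move=> T; exact: contraction_le.
exact: tU.
Qed.

Lemma contraction_hausdorff : hausdorff_space (contraction_op R X).
Proof.
move=> S T ST; apply: contraction_eqP => f; apply: val_inj; apply/funext => x.
apply/eqP; rewrite -subr_eq0; apply/eqP/cabs0_eq0/eqP.
rewrite eq_le cabs_ge0 andbT; apply/ler_addgt0Pr => e e0; rewrite add0r.
have e2 : 0 < e / 2 by rewrite divr_gt0.
have [T' [/= S1 T1]] := ST _ _
  (proj1 (@contraction_cvgP R X (nbhs S) S _) cvg_id f (l2_basis R x) _ e2)
  (proj1 (@contraction_cvgP R X (nbhs T) T _) cvg_id f (l2_basis R x) _ e2).
rewrite !l2_dot_basis in S1 T1.
have -> : S f x - T f x = (S f x - T' f x) - (T f x - T' f x) by ring.
apply: le_trans (cabsD _ _) _; rewrite cabsN (splitr e).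
exact: ltW (ltrD S1 T1).
Qed.

Lemma mul_conjc (z : R[i]) : z * conjc z = (sqnorm z)%:C%C.
Proof.
by case: z => a b; apply/eqP; rewrite eq_complex /sqnorm /=; apply/andP; split;
  apply/eqP; ring.
Qed.

(** Separate continuity of composition needs adjoints: a left factor has to be moved to the other
    side of the inner product. The adjoint vector is given by its coordinates. *)
Lemma adjoint_exists T g : exists g', forall h, l2_dot (T h) g = l2_dot h g'.
Proof.
pose u x : R[i] := conjc (l2_dot (T (l2_basis R x)) g).
have Tsum (A : seq X) (c : X -> R[i]) : l2_dot (T (\sum_(x <- A) c x *: l2_basis R x)) g =
    \sum_(x <- A) c x * conjc (u x).
  elim: A => [|x A IH]; first by rewrite !big_nil contraction0 l2_dot0l.
  by rewrite !big_cons contractionD contractionZ l2_dotDl l2_dotZl IH /u conjcK.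
have u_le (A : {fset X}) : \sum_(x <- A) sqnorm (u x) <= l2_norm g ^+ 2.
  (* Testing [T] on the vector with coordinates [u] over [A] gives [s], also its squared norm;
     Cauchy-Schwarz then bounds that norm by the norm of [g]. *)
  set s := \sum_(x <- A) _; pose a := \sum_(x <- A) u x *: l2_basis R x.
  have sE : l2_dot (T a) g = s%:C%C.
    by rewrite Tsum rmorph_sum; apply: eq_bigr => x _; exact: mul_conjc.
  have aE : l2_norm a ^+ 2 = s.
    have ay y : y \in A -> a y = u y.
      move=> yA; rewrite /a l2_sumE (eq_bigr (fun x => u x * (y == x)%:R))//.
      rewrite (big_fsetD1 y yA) eqxx mulr1 big1_seq; first exact: addr0.
      move=> x /andP[_].
      by rewrite !inE => /andP[/negbTE xy _]; rewrite eq_sym xy mulr0.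
    have trA : l2_trunc A a = a.
      by rewrite /l2_trunc /a; apply: eq_big_seq => y yA; rewrite -/a ay.
    have n0 : l2_norm (0 : l2 R X) ^+ 2 = 0 by rewrite -l2_dotff l2_dot0l.
    have := l2_trunc_norm A a; rewrite trA subrr n0 => /esym/eqP.
    rewrite subr_eq0 => /eqP ->.
    by apply: eq_big_seq => y yA; rewrite ay.
  have s0 : 0 <= s by apply: sumr_ge0 => x _; exact: sqnorm_ge0.
  have : s <= l2_norm a * l2_norm g.
    have -> : s = cabs (s%:C%C) by rewrite /cabs /sqnorm /= expr0n addr0 sqrtr_sqr ger0_norm.
    rewrite -sE; apply: le_trans (l2_cauchy_schwarz _ _) _.
    by rewrite ler_wpM2r ?l2_norm_ge0 ?contraction_le.
  rewrite -aE => H; have [a0|a0] := eqVneq (l2_norm a) 0; first by rewrite a0 expr0n sqr_ge0.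
  have ap : 0 < l2_norm a by rewrite lt_def a0 l2_norm_ge0.
  by rewrite ler_pXn2r ?nnegrE ?l2_norm_ge0//; move: H; rewrite expr2 ler_pM2l.
have us : u \in @square_summable R X.
  by rewrite unfold_in; apply: le_lt_trans (square_summable_le u_le) _; rewrite ltry.
exists (L2 us) => h; apply/eqP; rewrite -subr_eq0; apply/eqP/cabs0_eq0/eqP.
rewrite eq_le cabs_ge0 andbT; apply/ler_addgt0Pr => e e0; rewrite add0r.
have K0 : 0 < l2_norm g + l2_norm (L2 us) + 1.
  by rewrite ltr_wpDl// addr_ge0// l2_norm_ge0.
have [A hA] := l2_trunc_approx h (divr_gt0 e0 K0).
have hE : l2_dot (T (l2_trunc A h)) g = l2_dot (l2_trunc A h) (L2 us).
  rewrite Tsum l2_dotC l2_dot_sumr rmorph_sum; apply: eq_bigr => x _.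
  by rewrite rmorphM /= conjcK.
have -> : l2_dot (T h) g - l2_dot h (L2 us) =
    l2_dot (T (h - l2_trunc A h)) g - l2_dot (h - l2_trunc A h) (L2 us).
  by rewrite contractionB !l2_dotBl hE; ring.
apply: le_trans (cabsD _ _) _; rewrite cabsN.
apply: le_trans (lerD (l2_cauchy_schwarz _ _) (l2_cauchy_schwarz _ _)) _.
apply: (@le_trans _ _ (l2_norm (h - l2_trunc A h) * (l2_norm g + l2_norm (L2 us) + 1))).
  rewrite mulrDr mulr1 mulrDr -addrA lerD// ?ler_wpM2r ?l2_norm_ge0 ?contraction_le//.
  by rewrite lerDl l2_norm_ge0.
by rewrite -ler_pdivlMr// ltW.
Qed.

Lemma contraction_mul_linear S T : linear (S \o T).
Proof. by move=> c f g /=; rewrite !contraction_linear. Qed.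

Lemma contraction_mul_norm S T f : `|(S \o T) f| <= `|f|.
Proof. by apply: le_trans (contraction_norm S _) (contraction_norm T f). Qed.

Definition contraction_mul S T : contraction_op R X :=
  Contraction (@contraction_mul_linear S T) (@contraction_mul_norm S T).

Lemma contraction_semitop : semitopological_semigroup contraction_mul.
Proof.
split.
- by move=> S T V; exact: contraction_eqP.
- move=> T S; apply/(@contraction_cvgP R X (contraction_mul T @ nbhs S)) => f g e e0.
  have [g' gg'] := adjoint_exists T g.
  suff : nbhs S [set S' | cabs (l2_dot (T (S f)) g - l2_dot (T (S' f)) g) < e] by [].
  rewrite gg' (_ : mkset _ = [set S' | cabs (l2_dot (S f) g' - l2_dot (S' f) g') < e]).
    exact: (proj1 (@contraction_cvgP R X (nbhs S) S _) cvg_id f g' e e0).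
  by apply/seteqP; split=> S' /=; rewrite gg'.
- move=> T S; apply/(@contraction_cvgP R X (contraction_mul^~ T @ nbhs S)) => f g e e0.
  exact: (proj1 (@contraction_cvgP R X (nbhs S) S _) cvg_id (T f) g e e0).
Qed.

End weak_convergence.

Section order_aut_topology.
Context {d : Order.disp_t} (X : orderType d).

Lemma near_order_aut (g : order_aut X) (A : seq X) :
  \forall h \near g, {in A, (h : order_aut X) =1 g}.
Proof.
have H x : nbhs g [set h : order_aut X | h x = g x].
  exact: (proj1 (@order_aut_cvgP d X (nbhs g) g _) cvg_id x).
elim: A => [|x A IH]; first by apply: (@filterS _ (nbhs g) _ setT) filterT => h.
apply: (@filterS _ (nbhs g)) (filterI (H x) IH) => h [hx hA] y.
by rewrite inE => /predU1P[->//|/hA].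
Qed.

Lemma continuous_continuous_at_one (S : topologicalType) (phi : order_aut X -> S) :
  continuous phi -> continuous_at_one phi.
Proof.
move=> cphi N /cphi N1.
pose F : set_system (order_aut X) := filter_from [set: seq X] (fun A => [set g | fixes A g]).
have FF : Filter F.
  apply: filter_from_filter; first by exists [::].
  move=> A B _ _; exists (A ++ B) => // g gAB; split=> x xA; apply: gAB;
    by rewrite mem_cat xA ?orbT.
have F1 : F --> (1%g : order_aut X).
  apply/order_aut_cvgP => x; exists [:: x] => // g /(_ x); apply.
  by rewrite inE.
by have [A _ AN] := F1 _ N1; exists A => g gA; exact: AN.
Qed.

End order_aut_topology.

(** * Unitaries near the identity and unitaries of bijections *)

Section unitary_operators.
Variables (R : realType) (X : choiceType).
Implicit Types (f g : l2 R X) (u v : unitary_op R X).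

Lemma contraction_of_unitaryM u v : contraction_of_unitary (u * v)%g =
  contraction_mul (contraction_of_unitary u) (contraction_of_unitary v).
Proof. exact: contraction_eqP. Qed.

Lemma unitary_near u f (e : R) : 0 < e ->
  nbhs u [set v : unitary_op R X | l2_norm (u f - v f) < e].
Proof.
by move=> e0; exact: (proj1 (@unitary_cvgP R X (nbhs u) u _) cvg_id f e e0).
Qed.

Lemma contraction_of_unitary_continuous : continuous (@contraction_of_unitary R X).
Proof.
move=> u; apply/(@contraction_cvgP R X (@contraction_of_unitary R X @ nbhs u)) => f g e e0.
have k0 : 0 < l2_norm g + 1 by rewrite ltr_wpDl// l2_norm_ge0.
apply: (@filterS _ (nbhs u)) (unitary_near u f (divr_gt0 e0 k0)) => v /= H.
rewrite -l2_dotBl; apply: le_lt_trans (l2_cauchy_schwarz _ _) _.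
apply: (@le_lt_trans _ _ (l2_norm (u f - v f) * (l2_norm g + 1))).
  by rewrite ler_wpM2l ?l2_norm_ge0// lerDl.
by rewrite -ltr_pdivlMr.
Qed.

Lemma unitaryB u f g : u (f - g) = u f - u g.
Proof. exact: (contractionB (contraction_of_unitary u)). Qed.

Definition fixes_basis (A : {fset X}) u := {in A, forall x, u (l2_basis R x) = l2_basis R x}.

Lemma unitary_trunc_eq (A : {fset X}) u v f :
  {in A, forall x, u (l2_basis R x) = v (l2_basis R x)} ->
  u (l2_trunc A f) = v (l2_trunc A f).
Proof.
move=> uv; rewrite /l2_trunc.
have H (w : unitary_op R X) (r : seq X) : w (\sum_(x <- r) f x *: l2_basis R x) =
    \sum_(x <- r) f x *: w (l2_basis R x).
  elim: r => [|x r IH]; first by rewrite !big_nil; exact: (contraction0 (contraction_of_unitary w)).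
  by rewrite !big_cons unitary_linear IH.
by rewrite !H; apply: eq_big_seq => x xA; rewrite uv.
Qed.

Lemma unitary_trunc_close (A : {fset X}) u v f (e : R) :
  l2_norm (f - l2_trunc A f) < e / 2 ->
  {in A, forall x, u (l2_basis R x) = v (l2_basis R x)} -> l2_norm (u f - v f) < e.
Proof.
move=> fA uv.
have -> : u f - v f = u (f - l2_trunc A f) - v (f - l2_trunc A f).
  by rewrite !unitaryB (unitary_trunc_eq _ uv) opprB addrA addrNK.
apply: le_lt_trans (l2_normB _ _) _; rewrite !unitary_norm (splitr e).
exact: ltrD.
Qed.

(** No unitary enlarges the tail of a vector, so agreeing with the identity on enough basis vectors
    gives strong closeness to it. *)
Lemma nbhs1_fixes_basis (V : set (unitary_op R X)) :
  nbhs (1%g : unitary_op R X) V -> exists A, forall u, fixes_basis A u -> V u.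
Proof.
move=> V1.
pose F : set_system (unitary_op R X) := filter_from [set: {fset X}] (fun A => [set u | fixes_basis A u]).
have FF : Filter F.
  apply: filter_from_filter; first by exists fset0.
  move=> A B _ _; exists (A `|` B)%fset => // u uAB; split=> x xA; apply: uAB;
    by rewrite inE xA ?orbT.
have F1 : F --> (1%g : unitary_op R X).
  apply/unitary_cvgP => f e e0; have [A fA] := l2_trunc_approx f (divr_gt0 e0 (ltr0n R 2)).
  exists A => // u uA; apply: (unitary_trunc_close fA) => x xA.
  by rewrite uA.
by have [A _ AV] := F1 _ V1; exists A => u uA; exact: AV.
Qed.

Section bijections.
Variables (s s' : X -> X) (sK : cancel s s') (s'K : cancel s' s).

Lemma esum_bij (a : X -> \bar R) :
  \esum_(x in [set: X]) a (s' x) = \esum_(x in [set: X]) a x.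
Proof.
have b : set_bij [set: X] [set: X] s' by rewrite setTT_bijective; exists s.
by rewrite [RHS](reindex_esum _ _ _ _ b).
Qed.

Lemma bij_op_subproof f : (fun x => f (s' x)) \in @square_summable R X.
Proof.
rewrite unfold_in /esqnorm (esum_bij (fun x => (sqnorm (f x))%:E)).
exact: l2P.
Qed.

Definition bij_op_fun f : l2 R X := L2 (bij_op_subproof f).

Lemma bij_op_linear : linear bij_op_fun.
Proof. by move=> c f1 f2; apply: val_inj. Qed.

Lemma rsum_bij (h : X -> R) : rsum (fun x => h (s' x)) = rsum h.
Proof.
have hg : EFin \o (fun x => h (s' x)) = (EFin \o h) \o s' by [].
rewrite /rsum hg.
have -> : ((EFin \o h) \o s')^\+%E = (EFin \o h)^\+%E \o s'.
  by apply/funext => x; rewrite /= !funeposE.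
have -> : ((EFin \o h) \o s')^\-%E = (EFin \o h)^\-%E \o s'.
  by apply/funext => x; rewrite /= !funenegE.
by rewrite /= !esum_bij.
Qed.

Lemma bij_op_dot f1 f2 : l2_dot (bij_op_fun f1) (bij_op_fun f2) = l2_dot f1 f2.
Proof.
congr Complex.
  exact: (rsum_bij (fun x => complex.Re (f1 x * conjc (f2 x)))).
exact: (rsum_bij (fun x => complex.Im (f1 x * conjc (f2 x)))).
Qed.

End bijections.

(** The bijections ignore the order: comparing two elements of G inside the unitary group uses
    permutation unitaries that may lie outside G. *)
Lemma bij_op_exists (s s' : X -> X) : cancel s s' -> cancel s' s ->
  exists u, forall x, u (l2_basis R x) = l2_basis R (s x).
Proof.
move=> sK s'K.
have b : bijective (bij_op_fun sK s'K).
  exists (bij_op_fun s'K sK) => f; apply: val_inj; apply/funext => x /=.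
    by rewrite sK.
  by rewrite s'K.
exists (Unitary (bij_op_linear sK s'K) b (bij_op_dot sK s'K)) => x.
apply: val_inj; apply/funext => y /=; congr (_%:R); congr (nat_of_bool _).
by apply/eqP/eqP => [<-|->].
Qed.

(** A new pair [(x, y)] is added by composing with the transposition of [s x] and [y], which
    disturbs none of the earlier pairs. *)
Lemma extend_injection (l : seq (X * X)) :
  {in l &, forall p q, (p.1 == q.1) = (p.2 == q.2)} ->
  exists s s' : X -> X, [/\ cancel s s', cancel s' s & {in l, forall p, s p.1 = p.2}].
Proof.
elim: l => [|[x y] l IH] H; first by exists id, id.
have [|s [s' [sK s'K sl]]] := IH.
  by move=> p q pl ql; apply: H; rewrite inE ?pl ?ql orbT.
have [/mapP[p pl /= xp]|xl] := boolP (x \in map fst l).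
  exists s, s'; split=> // q; rewrite inE => /predU1P[->/=|]; last exact: sl.
  rewrite xp sl//; apply/eqP.
  by rewrite eq_sym -(H (x, y) p) ?mem_head ?inE ?pl ?orbT//= xp.
pose t z := if z == s x then y else if z == y then s x else z.
have tK : involutive t.
  move=> z; rewrite /t; case: (eqVneq z (s x)) => [->|zs].
    by rewrite eqxx; case: eqP => // ->.
  case: (eqVneq z y) => [->|zy]; first by rewrite eqxx.
  by rewrite (negbTE zs) (negbTE zy).
exists (t \o s), (s' \o t); split.
- by move=> z /=; rewrite tK sK.
- by move=> z /=; rewrite s'K tK.
- move=> q; rewrite inE => /predU1P[->/=|ql]; first by rewrite /t eqxx.
  have qx : q.1 != x by apply: contraNneq xl => <-; apply: map_f.
  have qy : q.2 != y.
    have := H q (x, y); rewrite !inE ql eqxx orbT /= => <- //.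
  rewrite /= /t (inj_eq (can_inj sK)) (negbTE qx) sl//.
  by rewrite (negbTE qy).
Qed.

End unitary_operators.

Section permutation_unitaries.
Variable R : realType.
Context {d : Order.disp_t} (X : orderType d).
Implicit Types g h : order_aut X.

Lemma perm_opM g h : perm_op R (g * h)%g = (perm_op R g * perm_op R h)%g.
Proof.
apply: unitary_eqP => f; apply: val_inj; apply/funext => x /=.
by rewrite invgM.
Qed.

Lemma perm_op_continuous : continuous (@perm_op d R X).
Proof.
move=> g; apply/(@unitary_cvgP R X (@perm_op d R X @ nbhs g)) => f e e0.
have [A fA] := l2_trunc_approx f (divr_gt0 e0 (ltr0n R 2)).
apply: (@filterS _ (nbhs g)) (near_order_aut g A) => h hA.
apply: (@unitary_trunc_close R X A (perm_op R g) (perm_op R h) f e fA) => x xA.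
by rewrite !perm_op_basis (hA x xA).
Qed.

(** Equal entries over [A] say exactly that the identity on [A] together with [g x] sent to [h x] is
    a partial injection. If [a] is the unitary of an extension, [h] is [a] times [g] times a unitary
    that, like [a], fixes the basis vectors of [A]. *)
Lemma roelcke_pattern (f : unitary_op R X -> R) (e : R) :
  roelcke_uniformly_continuous f -> 0 < e -> exists A : seq X, forall g h,
  (forall x y, x \in A -> y \in A -> (g x == y) = (h x == y)) ->
  `|f (perm_op R h) - f (perm_op R g)| < e.
Proof.
move=> fR /fR[V /nbhs1_fixes_basis[A AV] Vf]; exists A => g h gh.
have [|s [s' [sK s'K sl]]] := @extend_injection X
    ([seq (x, x) | x <- A] ++ [seq (g x, h x) | x <- A]).
  move=> p q; rewrite !mem_cat => /orP[]/mapP[x xA ->] /orP[]/mapP[y yA ->] //=.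
  - by rewrite eq_sym gh// eq_sym.
  - by rewrite gh.
  - by rewrite !(inj_eq (@order_aut_inj _ _ _)).
have [a aE] := bij_op_exists R sK s'K.
have -> : perm_op R h = (a * perm_op R g * ((perm_op R g)^-1 * a^-1 * perm_op R h))%g.
  by rewrite !mulgA mulgK mulgV mul1g.
apply: Vf; apply: AV => x xA.
  by rewrite aE (sl (x, x))// mem_cat map_f.
have hE : perm_op R h (l2_basis R x) = a (perm_op R g (l2_basis R x)).
  by rewrite !perm_op_basis aE (sl (g x, h x))// mem_cat (map_f (fun x => (g x, h x)))// orbT.
transitivity ((perm_op R g)^-1%g (a^-1%g (perm_op R h (l2_basis R x)))); first by [].
by rewrite hE !unitaryK.
Qed.

End permutation_unitaries.

Section coefficients.
Variables (R : realType) (X : choiceType).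
Implicit Types (f g : l2 R X) (u v : unitary_op R X).

Lemma coef_roelcke f g (p : R[i] -> R) : {morph p : x y / x - y} ->
  (forall z, `|p z| <= cabs z) ->
  (exists M, forall u : unitary_op R X, `|p (l2_dot (u f) g)| <= M) /\
  roelcke_uniformly_continuous (fun u : unitary_op R X => p (l2_dot (u f) g)).
Proof.
move=> pB p_le; split.
  exists (l2_norm f * l2_norm g) => u; apply: le_trans (p_le _) _.
  by apply: le_trans (l2_cauchy_schwarz _ _) _; rewrite unitary_norm.
move=> e e0.
have k0 : 0 < (l2_norm f + l2_norm g + 1) by rewrite ltr_wpDl// addr_ge0// l2_norm_ge0.
have ek := divr_gt0 e0 k0.
exists [set v : unitary_op R X | l2_norm (f - v f) < e / (l2_norm f + l2_norm g + 1) /\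
    l2_norm (g - v g) < e / (l2_norm f + l2_norm g + 1)].
  by apply: filterI; exact: (@unitary_near R X 1%g).
move=> u a b [_ /= ag] [bf _] /=.
rewrite -pB; apply: le_lt_trans (p_le _) _.
have adj w : l2_dot (a w) g = l2_dot w (a^-1%g g).
  by rewrite -(unitary_dot a w) unitaryVK.
(* The perturbations are separated: [b] acts on [f], and [a] is moved onto [g] by unitarity; both
   errors are then uniform in [u]. *)
have -> : l2_dot (a (u (b f))) g - l2_dot (u f) g =
    l2_dot (u (b f - f)) g + l2_dot (u (b f)) (a^-1%g (g - a g)).
  by rewrite !unitaryB l2_dotBr l2_dotBl -adj (unitaryK a); ring.
apply: le_lt_trans (cabsD _ _) _.
apply: le_lt_trans (lerD (l2_cauchy_schwarz _ _) (l2_cauchy_schwarz _ _)) _.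
rewrite !unitary_norm -(l2_normN (b f - f)) opprB.
apply: (@le_lt_trans _ _ (e / (l2_norm f + l2_norm g + 1) * (l2_norm f + l2_norm g))).
  rewrite addrC mulrDr [l2_norm f * _]mulrC.
  by apply: lerD; rewrite ler_wpM2r ?l2_norm_ge0// ltW.
rewrite -mulrA mulrC -ltr_pdivlMr// divff ?gt_eqF//.
by rewrite mulrC ltr_pdivrMr// mul1r ltrDl.
Qed.

End coefficients.

(** * Compactifications *)

Section closed_subspaces.
Variables (K : topologicalType).

Lemma dense_closure (T : topologicalType) (A : set T) (x : T) : dense A -> closure A x.
Proof.
move=> dA N Nx; have [|y [/interior_subset Ny Ay]] := dA (N^°) _ (@open_interior _ N).
  by exists x.
by exists y.
Qed.

Lemma eq_on_dense (I : Type) (T S : topologicalType) (w : I -> T) (h1 h2 : T -> S) :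
  hausdorff_space S -> dense (range w) -> continuous h1 -> continuous h2 ->
  (forall i, h1 (w i) = h2 (w i)) -> h1 =1 h2.
Proof.
move=> hS dw c1 c2 e12 x; apply: (eq_on_closure hS c1 c2 (A := range w)).
  by move=> _ /set_mem[i _ <-].
by rewrite inE; exact: dense_closure.
Qed.

Lemma set_val_continuous (A : set K) : continuous (set_val : A -> K).
Proof. exact: initial_continuous. Qed.

Lemma closure_compact_hausdorff (A : set K) : compact_hausdorff K ->
  compact_hausdorff (closure A : Type).
Proof.
move=> [cK hK]; split.
  rewrite compact_ultra => U UU _.
  have [p Up] := compact_ultra_cvg (set_val : closure A -> K) UU cK.
  have pA : closure A p.
    apply: (@closed_closure _ A); apply: (closure_ultra_cvg UU _ Up).
    by apply: nearW => x; exact: set_mem (valP x).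
  exists (exist _ p (mem_set pA)); split=> //.
  exact/cvg_initialP.
move=> p q pq; apply: val_inj; apply: hK => M N Mp Nq.
have [x [Mx Nx]] := pq _ _ (set_val_continuous Mp) (set_val_continuous Nq).
by exists (val x).
Qed.

Section to_closure.
Variables (T : Type) (j : T -> K).

Lemma to_closure_dense : dense (range (to_closure j)).
Proof.
move=> O [w Ow] [B Bo BO]; rewrite -BO in Ow *.
have [_ [[t _ <-] Bt]] : (range j `&` B) !=set0.
  by apply: (set_mem (valP w)); exact: open_nbhs_nbhs.
by exists (to_closure j t); split=> //; exists t.
Qed.

End to_closure.

Lemma to_closure_continuous (T : topologicalType) (j : T -> K) :
  continuous j -> continuous (to_closure j).
Proof. by move=> cj t; apply/cvg_initialP; exact: cj. Qed.

Lemma corestrict_closure (T : Type) (W : topologicalType) (w : T -> W) (j : T -> K)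
    (psi : W -> K) : dense (range w) -> continuous psi -> psi \o w = j ->
  exists2 psi' : W -> (closure (range j) : Type), continuous psi' & psi' \o w = to_closure j.
Proof.
move=> dw cpsi psiw.
have H x : closure (range j) (psi x).
  apply: (closure_map cpsi (A := range w)); last exact: dense_closure.
  by move=> _ [t _ <-]; apply: subset_closure; exists t => //; rewrite -psiw.
exists (fun x => exist _ (psi x) (mem_set (H x))).
  by move=> x; apply/cvg_initialP; exact: cpsi.
by apply/funext => t; apply: val_inj; rewrite /= -psiw.
Qed.

End closed_subspaces.

Section WAP_compactifications.
Variable G : preTopologicalGroupType.

(** Maps over G in both directions are mutually inverse on dense subsets, hence everywhere; the
    multiplication is then transported along them. *)
Lemma is_WAP_transfer (W W' : topologicalType) (w : G -> W) (w' : G -> W')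
    (a : W -> W') (b : W' -> W) :
  is_WAP_compactification w -> compact_hausdorff W' -> continuous w' ->
  dense (range w') -> continuous a -> a \o w = w' -> continuous b -> b \o w' = w ->
  is_WAP_compactification w'.
Proof.
move=> [chW cw dw [mul [one [mP [m1 m2] [wM w1] univ]]]] chW' cw' dw' ca aw cb bw'.
have aK : cancel a b.
  apply: (eq_on_dense (w := w) chW.2 dw).
  - by move=> x; apply: (@continuous_cvgP _ _ _ (nbhs x) a b); [exact: cb|exact: ca].
  - by move=> x; exact: cvg_id.
  - by move=> g; rewrite -[a (w g)]/((a \o w) g) aw -[LHS]/((b \o w') g) bw'.
have bK : cancel b a.
  apply: (eq_on_dense (w := w') chW'.2 dw').
  - by move=> x; apply: (@continuous_cvgP _ _ _ (nbhs x) b a); [exact: ca|exact: cb].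
  - by move=> x; exact: cvg_id.
  - by move=> g; rewrite -[b (w' g)]/((b \o w') g) bw' -[LHS]/((a \o w) g) aw.
have awE g : a (w g) = w' g by rewrite -aw.
have bwE g : b (w' g) = w g by rewrite -bw'.
have [mA ml mr] := mP.
split=> //; exists (fun x y => a (mul (b x) (b y))), (a one); split.
- split=> [x y z|x y|x y].
  + by rewrite !aK mA.
  + apply: (@continuous_cvgP _ _ _ (nbhs y) (fun y => mul (b x) (b y)) a); first exact: ca.
    by apply: (@continuous_cvgP _ _ _ (nbhs y) b (mul (b x))); [exact: ml|exact: cb].
  + apply: (@continuous_cvgP _ _ _ (nbhs y) (fun y => mul (b y) (b x)) a); first exact: ca.
    by apply: (@continuous_cvgP _ _ _ (nbhs y) b (mul^~ (b x))); [exact: mr|exact: cb].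
- by split=> x; rewrite aK ?m1 ?m2 bK.
- by split=> [g h|]; rewrite -?w1 ?awE// !bwE -wM awE.
- move=> S mulS phi chS sS cphi phiM; have [psi [cpsi psiM psiw]] := univ S mulS phi chS sS cphi phiM.
  exists (psi \o b); split.
  + by move=> x; apply: (@continuous_cvgP _ _ _ (nbhs x) b psi); [exact: cpsi|exact: cb].
  + by move=> x y /=; rewrite aK psiM.
  + by apply/funext => g /=; rewrite bwE -psiw.
Qed.

End WAP_compactifications.

Section closure_semigroups.
Variables (G : groupType) (K : topologicalType) (m : K -> K -> K) (e : K) (j : G -> K).
Hypotheses (mP : semitopological_semigroup m) (me : left_id e m) (em : right_id e m)
  (jM : {morph j : g h / (g * h)%g >-> m g h}) (j1 : j 1%g = e).

(** Separate continuity allows one limit at a time: the right factor is first taken in the image of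
    G, then the left one. *)
Lemma closure_mul_closed x y : closure (range j) x -> closure (range j) y ->
  closure (range j) (m x y).
Proof.
move=> xj yj; apply: (closure_map (h := m x) (@semitop_mul_continuousl _ _ mP x) _ yj) => _ [h _ <-].
apply: (closure_map (h := m^~ (j h)) (@semitop_mul_continuousr _ _ mP (j h)) _ xj) => _ [g _ <-].
by apply: subset_closure; exists (g * h)%g.
Qed.

Definition closure_mul (x y : closure (range j)) : closure (range j) :=
  exist _ (m (val x) (val y))
    (mem_set (closure_mul_closed (set_mem (valP x)) (set_mem (valP y)))).

Lemma closure_mul_semitop : semitopological_semigroup closure_mul.
Proof.
split=> [x y z|x y|x y].
- by apply: val_inj; exact: (semitop_mulA mP).
- apply/cvg_initialP; first exact: (@fmap_filter _ _ _ _ (@nbhs_filter _ y)).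
  exact: (continuous_cvgP (@semitop_mul_continuousl _ _ mP (val x))
    (@set_val_continuous _ (closure (range j)) y)).
- apply/cvg_initialP; first exact: (@fmap_filter _ _ _ _ (@nbhs_filter _ y)).
  exact: (continuous_cvgP (@semitop_mul_continuousr _ _ mP (val x))
    (@set_val_continuous _ (closure (range j)) y)).
Qed.

Lemma closure_mul_id : left_id (to_closure j 1%g) closure_mul /\
  right_id (to_closure j 1%g) closure_mul.
Proof. by split=> x; apply: val_inj; rewrite /= j1 ?me ?em. Qed.

Lemma to_closureM : {morph to_closure j : g h / (g * h)%g >-> closure_mul g h}.
Proof. by move=> g h; apply: val_inj; exact: jM. Qed.

End closure_semigroups.

(** * The closure of G in the three models *)

Section order_aut_WAP.
Variable R : realType.
Context {d : Order.disp_t} (X : orderType d).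
Hypotheses (Xinf : infinite_set [set: X]) (Xuh : ultrahomogeneous X).
Local Notation G := (order_aut X).
Local Notation pi := (@perm_op d R X).

Definition perm_contraction (g : G) : contraction_op R X :=
  contraction_of_unitary (pi g).

Lemma contraction_compact_hausdorff : compact_hausdorff (contraction_op R X).
Proof. by split; [exact: contraction_compact|exact: contraction_hausdorff]. Qed.

Lemma perm_contraction_continuous : continuous perm_contraction.
Proof.
move=> g; apply: (@continuous_cvgP _ _ _ (nbhs g) pi (@contraction_of_unitary R X)).
  exact: contraction_of_unitary_continuous.
exact: perm_op_continuous.
Qed.

Lemma perm_contractionM : {morph perm_contraction : g h / (g * h)%g >-> contraction_mul g h}.
Proof. by move=> g h; rewrite /perm_contraction perm_opM contraction_of_unitaryM. Qed.

Definition contraction_one : contraction_op R X := contraction_of_unitary 1%g.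

Lemma perm_contraction1 : perm_contraction 1%g = contraction_one.
Proof.
apply: contraction_eqP => f; apply: val_inj; apply/funext => x /=.
by rewrite invg1.
Qed.

(* The entries of a limit of permutation operators are 0 or 1. *)
Definition entry (T : contraction_op R X) (x y : X) : bool :=
  cabs (T (l2_basis R x) y - 1) < 2^-1.

(** The entries of permutation operators are 0 or 1, and the tolerance 1/2 separates these values:
    weak convergence makes each entry eventually constant. *)
Lemma near_entry (U : set_system G) (T : contraction_op R X) x y : Filter U ->
  perm_contraction @ U --> T -> \forall g \near U, ((g : G) x == y) = entry T x y.
Proof.
move=> UU UT; have h0 : 0 < 2^-1 :> R by rewrite invr_gt0.
have /(_ (l2_basis R x) (l2_basis R y) _ h0) H :=
  proj1 (@contraction_cvgP R X (perm_contraction @ U) T (@fmap_filter _ _ _ _ UU)) UT.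
apply: (@filterS _ U) H => g gH.
have {gH} : cabs (l2_dot (T (l2_basis R x)) (l2_basis R y) -
    l2_dot (perm_contraction g (l2_basis R x)) (l2_basis R y)) < 2^-1 by exact: gH.
have -> : perm_contraction g (l2_basis R x) = l2_basis R (g x) by exact: perm_op_basis.
have gxy : l2_basis R (g x) y = (g x == y)%:R by rewrite eq_sym.
rewrite !l2_dot_basis gxy /entry; set z := T _ _.
case: (g x == y) => H; first by apply/esym.
move: H; rewrite subr0 => H; apply/esym/negbTE; rewrite -leNgt.
have c1 : cabs (1 : R[i]) = 1 by rewrite /cabs /sqnorm /= expr1n expr0n addr0 sqrtr1.
have := cabsD z (1 - z); rewrite addrC subrK c1 -[1 - z]opprB cabsN; lra.
Qed.

(** A point of the operator closure determines the limiting entries, so limits that depend only on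
    entries extend. It applies both to semigroup compactifications and to the Roelcke
    compactification. *)
Lemma pattern_extension (S : topologicalType) (phi : G -> S) : compact_hausdorff S ->
  (forall (U U' : set_system G) (b : X -> X -> bool) (s s' : S),
     UltraFilter U -> UltraFilter U' ->
     (forall x y, \forall g \near U, ((g : G) x == y) = b x y) ->
     (forall x y, \forall g \near U', ((g : G) x == y) = b x y) ->
     phi @ U --> s -> phi @ U' --> s' -> s = s') ->
  exists2 psi : (closure (range perm_contraction) : Type) -> S,
    continuous psi & psi \o to_closure perm_contraction = phi.
Proof.
move=> chS H; apply: ultrafilter_extension => //; first exact: to_closure_dense.
move=> U U' p s s' UU UU' Up Up' Us Us'.
have val_cvg (V : set_system G) : UltraFilter V ->
    to_closure perm_contraction @ V --> p -> perm_contraction @ V --> val p.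
  move=> VV Vp; exact: (continuous_cvgP (f := to_closure perm_contraction)
    (@set_val_continuous _ (closure (range perm_contraction))) Vp).
apply: (H U U' (entry (val p)) s s' UU UU' _ _ Us Us') => x y.
  by apply: near_entry; exact: val_cvg.
by apply: near_entry; exact: val_cvg.
Qed.

Lemma WAP_perm_contraction : is_WAP_compactification (to_closure perm_contraction).
Proof.
have cmP := contraction_semitop R X.
have m1 : left_id contraction_one (@contraction_mul R X) by move=> T; exact: contraction_eqP.
have m2 : right_id contraction_one (@contraction_mul R X) by move=> T; exact: contraction_eqP.
have chW : compact_hausdorff (closure (range perm_contraction) : Type).
  exact/closure_compact_hausdorff/contraction_compact_hausdorff.
have wM := to_closureM cmP perm_contractionM.
have dw := @to_closure_dense _ _ perm_contraction.
split=> //; first exact/to_closure_continuous/perm_contraction_continuous.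
exists (closure_mul cmP perm_contractionM), (to_closure perm_contraction 1%g); split.
- exact: closure_mul_semitop.
- exact: (closure_mul_id cmP m1 m2 perm_contractionM perm_contraction1).
- by split.
move=> S mulS phi chS sS cphi phiM.
have rP : semigroup_rep mulS phi.
  by split=> //; exact: continuous_continuous_at_one.
have [psi cpsi psiw] := pattern_extension chS
  (fun U U' b s s' => @pattern_limit R d X Xinf Xuh S mulS phi U U' b s s' rP).
exists psi; split=> //.
have psiwE g : psi (to_closure perm_contraction g) = phi g by rewrite -psiw.
have [_ ml mr] := closure_mul_semitop cmP perm_contractionM.
have [_ sl sr] := sS.
(* Multiplicativity spreads from G by density in one variable at a time. *)
move=> x y; move: y; apply: (eq_on_dense chS.2 dw).
- by move=> y; apply: (@continuous_cvgP _ _ _ (nbhs y) _ psi) => //; exact: ml.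
- by move=> y; apply: (@continuous_cvgP _ _ _ (nbhs y) psi (mulS (psi x)));
    [exact: sl|exact: cpsi].
move=> h; move: x; apply: (eq_on_dense chS.2 dw).
- move=> x; apply: (@continuous_cvgP _ _ _ (nbhs x)
    (fun x => closure_mul cmP perm_contractionM x (to_closure perm_contraction h)) psi) => //.
  exact: mr.
- move=> x; apply: (@continuous_cvgP _ _ _ (nbhs x) psi
    (mulS^~ (psi (to_closure perm_contraction h))));
    [exact: sr|exact: cpsi].
by move=> g; rewrite -wM !psiwE phiM.
Qed.

Lemma WAP_closure_transfer (K : topologicalType) (k : unitary_op R X -> K)
    (a : (closure (range perm_contraction) : Type) -> K)
    (b : (closure (range (k \o pi)) : Type) -> contraction_op R X) :
  compact_hausdorff K -> continuous k ->
  continuous a -> a \o to_closure perm_contraction = k \o pi ->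
  continuous b -> b \o to_closure (k \o pi) = perm_contraction ->
  is_WAP_compactification (to_closure (k \o pi)).
Proof.
move=> chK ck ca aw cb bw.
have [a' ca' aw'] := corestrict_closure (@to_closure_dense _ _ perm_contraction) ca aw.
have [b' cb' bw'] := corestrict_closure (@to_closure_dense _ _ (k \o pi)) cb bw.
apply: (is_WAP_transfer WAP_perm_contraction _ _ _ ca' aw' cb' bw').
- exact: closure_compact_hausdorff.
- apply: to_closure_continuous => g.
  apply: (@continuous_cvgP _ _ _ (nbhs g) pi k); first exact: ck.
  exact: perm_op_continuous.
- exact: to_closure_dense.
Qed.

Lemma WAP_Roelcke (K : topologicalType) (k : unitary_op R X -> K) :
  is_Roelcke_compactification R k -> is_WAP_compactification (to_closure (k \o pi)).
Proof.
move=> [chK ck dk kP].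
have [a ca aw] : exists2 a : (closure (range perm_contraction) : Type) -> K,
    continuous a & a \o to_closure perm_contraction = k \o pi.
  apply: pattern_extension => // U U' b s s' UU UU' Ub Ub' Us Us'.
  (* A function separating the two limits would be Roelcke uniformly continuous on the unitary
     group, hence nearly equal at two elements of G with the same entries; three errors below 1/4
     cannot bridge the values 0 and 1. *)
  apply: contrapT => /(urysohn_points R chK)[F [cF Fs Fs']].
  have [_ FR] : (exists M, forall u, `|(F \o k) u| <= M) /\
      roelcke_uniformly_continuous (F \o k) by apply/kP; exists F.
  have e0 : 0 < 4^-1 :> R by rewrite invr_gt0.
  have [A AP] := roelcke_pattern FR e0.
  have near_F (V : set_system G) t : UltraFilter V -> (k \o pi) @ V --> t ->
      \forall g \near V, `|F t - F (k (pi g))| < 4^-1.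
    move=> VV Vt.
    have c : (fun g => F (k (pi g))) @ V --> F t by exact: (continuous_cvgP (f := k \o pi) cF Vt).
    by have /cvgrPdist_lt := c; apply.
  have [g [gb gF]] := filter_ex (filterI (near_pattern A A _ Ub) (near_F U s UU Us)).
  have [h [hb hF]] := filter_ex (filterI (near_pattern A A _ Ub') (near_F U' s' UU' Us')).
  have := AP g h (fun x y xA yA => etrans (gb x y xA yA) (esym (hb x y xA yA))).
  move: gF hF; rewrite /= Fs Fs' sub0r normrN !ltr_norml => /andP[? ?] /andP[? ?] /andP[? ?].
  lra.
have [b cb bw] : exists2 b : (closure (range (k \o pi)) : Type) -> contraction_op R X,
    continuous b & b \o to_closure (k \o pi) = perm_contraction.
  apply: ultrafilter_extension; [exact: contraction_compact_hausdorff|exact: to_closure_dense|].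
  move=> U U' p T T' UU UU' Up Up' UT UT'.
  (* Real and imaginary parts of coefficients are Roelcke uniformly continuous, so they extend to
     [K] and a point of the closure determines every coordinate of the operator. *)
  have coef (q : R[i] -> R) f y : {morph q : x y / x - y} -> (forall z, `|q z| <= cabs z) ->
      q (T f y) = q (T' f y).
    move=> qB q_le; have /kP[F cF Fk] := coef_roelcke f (l2_basis R y) qB q_le.
    have lim (V : set_system G) (T0 : contraction_op R X) : UltraFilter V ->
        to_closure (k \o pi) @ V --> p -> perm_contraction @ V --> T0 ->
        F (val p) = q (T0 f y).
      move=> VV Vp VT.
      have c1 : (fun g => F (k (pi g))) @ V --> F (val p).
        apply: (continuous_cvgP cF (f := k \o pi)).
        exact: (continuous_cvgP (f := to_closure (k \o pi))
          (@set_val_continuous _ (closure (range (k \o pi)))) Vp).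
      apply: (cvg_unique (@Rhausdorff R) c1); apply/cvgrPdist_lt => e e0.
      have H : V [set g | cabs (l2_dot (T0 f) (l2_basis R y) -
          l2_dot (perm_contraction g f) (l2_basis R y)) < e].
        exact: (proj1 (@contraction_cvgP R X (perm_contraction @ V) T0
          (@fmap_filter _ _ _ _ ultra_proper)) VT f (l2_basis R y) e e0).
      suff : V [set g | `|q (T0 f y) - F (k (pi g))| < e] by [].
      apply: (@filterS _ V) H => g H.
      rewrite /= -[F _]/((F \o k) (pi g)) Fk -(l2_dot_basis (T0 f)) -qB.
      exact: le_lt_trans (q_le _) H.
    by rewrite -(lim U T) // -(lim U' T').
  apply: contraction_eqP => f; apply: val_inj; apply/funext => y; apply/eqP.
  rewrite eq_complex; apply/andP; split; apply/eqP; apply: coef; try exact: raddfB.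
  - by move=> [r i]; rewrite /cabs /sqnorm /= -sqrtr_sqr ler_sqrt ?addr_ge0 ?sqr_ge0// lerDl sqr_ge0.
  - by move=> [r i]; rewrite /cabs /sqnorm /= -sqrtr_sqr ler_sqrt ?addr_ge0 ?sqr_ge0// lerDr sqr_ge0.
exact: (WAP_closure_transfer chK ck ca aw cb bw).
Qed.

(** Both comparison maps come from universal properties: that of the operator closure applied to
    [K], and that of [K] applied to the unit ball as a compact semitopological semigroup. *)
Lemma WAP_WAP (K : topologicalType) (k : unitary_op R X -> K) :
  is_WAP_compactification k -> is_WAP_compactification (to_closure (k \o pi)).
Proof.
move=> [chK ck dk [mul [one [mP _ [kM _] univ]]]].
have [_ _ _ [mulG [oneG [_ _ _ univG]]]] := WAP_perm_contraction.
have kpi_continuous : continuous (k \o pi).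
  move=> g; apply: (@continuous_cvgP _ _ _ (nbhs g) pi k); first exact: ck.
  exact: perm_op_continuous.
have kpiM : {morph k \o pi : g h / (g * h)%g >-> mul g h}.
  by move=> g h /=; rewrite perm_opM kM.
have [a [ca _ aw]] := univG K mul (k \o pi) chK mP kpi_continuous kpiM.
have [b [cb _ bk]] := univ _ _ (@contraction_of_unitary R X) contraction_compact_hausdorff
  (contraction_semitop R X) (@contraction_of_unitary_continuous R X) (@contraction_of_unitaryM R X).
apply: (WAP_closure_transfer chK ck ca aw (b := b \o set_val)).
- move=> x; apply: (@continuous_cvgP _ _ _ (nbhs x)
    (set_val : closure (range (k \o pi)) -> K) b); first exact: cb.
  exact: set_val_continuous.
- by apply/funext => g; rewrite /perm_contraction -bk.
Qed.

End order_aut_WAP.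

(* The three clauses read b_r U(l^2(X)) = WAP U(l^2(X)) as the unit ball of
   operators in the weak operator topology, as the Roelcke compactification of
   U(l^2(X)), and as its WAP compactification. *)
Theorem corollary4p25 (R : realType) (d : Order.disp_t) (X : orderType d)
    (hinf : infinite_set [set: X]) (hX : ultrahomogeneous X) :
  [/\ is_WAP_compactification
        (to_closure (fun g : order_aut X =>
           contraction_of_unitary (perm_op R g))),
      (forall (K : topologicalType) (k : unitary_op R X -> K),
         is_Roelcke_compactification R k ->
         is_WAP_compactification
           (to_closure (fun g : order_aut X => k (perm_op R g))))
    & (forall (K : topologicalType) (k : unitary_op R X -> K),
         is_WAP_compactification k ->
         is_WAP_compactification
           (to_closure (fun g : order_aut X => k (perm_op R g))))].
Proof.
split; first exact: WAP_perm_contraction.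
  by move=> K k; exact: WAP_Roelcke.
by move=> K k; exact: WAP_WAP.
Qed.
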